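(* Let $p\geqslant 5$ be a prime. Then there exist a connected bipartite graph $\Gamma$ of valency $p$ and a group $G\leqslant\mathrm{Aut}(\Gamma)$ such that $\Gamma$ is $(G,2)$-arc-transitive and of diagonal PA type, and $\Gamma$ is not isomorphic to the standard double cover of any graph.
   Context: All graphs are finite, simple and undirected. For a graph $\Gamma=(V,E)$ and $G\leqslant\mathrm{Aut}(\Gamma)$, $G_\alpha$ is the stabilizer of the vertex $\alpha$. A $2$-arc is a triple $(\alpha,\beta,\gamma)$ of distinct vertices with $\{\alpha,\beta\},\{\beta,\gamma\}\in E$; $\Gamma$ is $(G,2)$-arc-transitive if $G$ is transitive on $2$-arcs. For an edge $\{\alpha,\beta\}$ put $G^*=\langle G_\alpha,G_\beta\rangle$. A permutation group is quasiprimitive if each of its minimal normal subgroups is transitive. A connected $(G,2)$-arc-transitive graph is of PA type if $G^*$ acts quasiprimitively on each of its orbits on $V$, $G^*$ has a unique minimal normal subgroup $M=T_1\times\cdots\times T_n$ with $n\geqslant2$ and the $T_i$ pairwise isomorphic nonabelian simple groups, and for a vertex $\alpha$ there are pairwise isomorphic subgroups $1\ne R_i<T_i$ with $M_\alpha\leqslant R_1\times\cdots\times R_n$ projecting surjectively onto each $R_i$; it is of diagonal PA type if every projection $M_\alpha\to R_i$ is injective. For a graph $\Sigma=(V_0,E_0)$, the standard double cover of $\Sigma$ is the bipartite graph with vertex set $V_0\times\mathbb{Z}_2$ in which $(\alpha_0,0)$ and $(\beta_0,1)$ are adjacent if and only if $\{\alpha_0,\beta_0\}\in E_0$ (and no other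 adjacencies). *)

(* Defs.v *)
From mathcomp Require Import all_boot all_fingroup all_solvable.
Set Implicit Arguments.
Unset Strict Implicit.
Unset Printing Implicit Defensive.
Local Open Scope group_scope.

Section Graphs.
Variable V : finType.
Variable adj : rel V.

Definition simple_graph : Prop := symmetric adj /\ irreflexive adj.

Definition connected_graph : Prop := forall x y : V, connect adj x y.

Definition bipartite_graph : Prop :=
  exists part : V -> bool, forall x y, adj x y -> part x != part y.

Definition regular_of_valency (k : nat) : Prop :=
  forall x : V, #|[set y | adj x y]| = k.

Definition group_of_automorphisms (G : {group {perm V}}) : Prop :=
  forall g, g \in G -> forall x y, adj (g x) (g y) = adj x y.

Definition two_arc (a b c : V) : bool :=
  [&& adj a b, adj b c, a != b, b != c & a != c].

Definition two_arc_transitive (G : {group {perm V}}) : Prop :=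
  forall a b c a' b' c', two_arc a b c -> two_arc a' b' c' ->
    exists2 g, g \in G & [/\ g a = a', g b = b' & g c = c'].

End Graphs.

Section Groups.
Variable V : finType.

Definition minimal_normal (N H : {group {perm V}}) : bool :=
  (N \subset H) && minnormal N H.

Definition quasiprimitive_on (H : {group {perm V}}) (D : {set V}) : Prop :=
  forall N : {group {perm V}}, minimal_normal N H -> [transitive N, on D | 'P].

Definition Gstar (G : {group {perm V}}) (a b : V) : {group {perm V}} :=
  <<'C_G[a | 'P] :|: 'C_G[b | 'P]>>%G.

Definition induced_on (K : {group {perm V}}) (D : {set V}) : {group {perm V}} :=
  (restr_perm D @* K)%G.

Definition other_factors n (T : 'I_n -> {group {perm V}}) (i : 'I_n)
  : {group {perm V}} := <<\bigcup_(j | j != i) T j>>%G.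

Definition factor_proj n (T : 'I_n -> {group {perm V}}) (i : 'I_n)
  (x : {perm V}) : {perm V} := divgr (T i) (other_factors T i) x.

End Groups.

Definition diagonal_PA_type (V : finType) (adj : rel V)
    (G : {group {perm V}}) : Prop :=
  forall a b : V, adj a b ->
  let Gs := Gstar G a b in
  (forall v : V, quasiprimitive_on (induced_on Gs (orbit 'P Gs v))
                                   (orbit 'P Gs v)) /\
  exists M : {group {perm V}},
    [/\ minimal_normal M Gs,
        (forall N : {group {perm V}}, minimal_normal N Gs -> N = M) &
    exists n : nat, exists T : 'I_n -> {group {perm V}},
      [/\ 2 <= n,
          \big[dprod/1]_(i < n) T i = M,
          (forall i, simple (T i) /\ ~~ abelian (T i)),
          (forall i j, T i \isog T j) &
      forall v : V, exists R : 'I_n -> {group {perm V}},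
        let Mv := 'C_M[v | 'P] in
        [/\ (forall i, R i :!=: 1 /\ R i \proper T i),
            (forall i j, R i \isog R j),
            Mv \subset \prod_(i < n) R i,
            (forall i, factor_proj T i @: Mv = R i) &
            (forall i, {in Mv &, injective (factor_proj T i)})]]].

Definition std_double_cover (V0 : finType) (e0 : rel V0) : rel (V0 * bool) :=
  fun u w => (u.2 != w.2) && e0 u.1 w.1.

Definition graph_iso (V W : finType) (adjV : rel V) (adjW : rel W) : Prop :=
  exists f : V -> W, bijective f /\ forall x y, adjW (f x) (f y) = adjV x y.

Definition is_standard_double_cover (V : finType) (adj : rel V) : Prop :=
  exists (V0 : finType) (e0 : rel V0),
    simple_graph e0 /\ graph_iso adj (std_double_cover e0).

(* Main.v *)
(* Let p = 2r+1 and let T = SL_p(9), with rows and columns indexed by Z/p. Fix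
   iota in F_9 with iota^2 = -1, the Frobenius sigma, and g : Z/p -> F_3 with
   g(k) <> 0 iff k is one of 1, ..., r, such that Phi = (g(j-i)) is invertible.
   With f_i the i-th row of Phi put a_i = 1 + iota e_i f_i, so that
   sigma(a_i) = a_i^-1, and let x be the cyclic shift. Then c(t) = a_0
   sigma(t) a_0^-1 is an involution of T commuting with an involution theta
   that inverts x. Let M, isomorphic to T^r, be the group of functions
   f : Z/p -> T with f(0) = 1 and f(-k) = theta(f(k)), let X be the subgroup of
   functions k |-> x^(tk) and let Y = c(X). The graph is the graph of right
   cosets of X and of Y in M, adjacent when they meet.

   Left multiplication by the elements a_0 a_i^-1 labels the edges at each
   vertex by Z/p, compatibly with the label seen from the other end. A path
   with three edges extends to a hexagon exactly when its outer labels agree, so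
   every automorphism transports labels, and the full automorphism group is
   generated by right translations, the multiplications k |-> rk on
   coordinates, and c. A fixed-point-free involution coming from a double cover
   would be a translate of c or of c theta; a Hilbert 90 argument, respectively
   the classification of symmetric forms over F_9, shows that such an
   involution flips an edge, which no double cover allows. *)

Require Import Defs.
From mathcomp Require Import all_boot all_fingroup all_solvable all_algebra all_field ring zify.

Set Implicit Arguments.
Unset Strict Implicit.
Unset Printing Implicit Defensive.
Import GRing.Theory.

(** * Coset graphs whose hexagons determine the edge labels *)

(** The involution of a double cover need not lie in a prescribed group G, so the whole automorphism
    group has to be known, and for this the labels must be visible in the bare graph. Hexagons close
    because a_j a_i^-1 has cube 1 in characteristic 3; the converse rests on exactly one of g(k),
    g(-k) being zero for k <> 0.

    As theta inverts x and commutes with c, anything generated by X and Y has at -k the theta-image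
    of its value at k, so M is the largest group they can generate. That they do generate it needs a
    relation between the a_i that does not survive k |-> sk for s other than 1 and -1; it comes from
    the tournament i -> j iff g(j-i) <> 0, whose transitive and cyclic triples behave differently.

    The dimension p is odd, hence prime to 8: SL_p(9) has no nontrivial scalars and is simple, and a
    determinant -1 met in either final argument is corrected by a change of sign. *)

Section CosetGraph.

Local Open Scope group_scope.

Variables (F : finFieldType) (mT : finGroupType) (M : {group mT}).
Variables (xh : F -> mT) (ac : mT -> mT) (al : F -> mT -> mT).
Hypothesis F_nat : forall i : F, exists n, i = n%:R%R.
Hypothesis xh_mem : forall i, xh i \in M.
Hypothesis xhD : forall i j, xh (i + j)%R = xh i * xh j.
Hypothesis acM : {morph ac : f g / f * g}.
Hypothesis acK : involutive ac.
Hypothesis ac_mem : forall f, f \in M -> ac f \in M.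
Hypothesis alM : forall r, {morph al r : f g / f * g}.
Hypothesis al_comp : forall r s f, al r (al s f) = al (r * s)%R f.
Hypothesis al1 : forall f, al 1%R f = f.
Hypothesis al_mem : forall r f, f \in M -> al r f \in M.
Hypothesis al_ac : forall r f, al r (ac f) = ac (al r f).
Hypothesis al_xh : forall r t, al r (xh t) = xh (r * t)%R.

Definition zh (b : bool) (i : F) := if b then ac (xh i) else xh i.

Hypothesis zh_TI : forall i j, zh true i = zh false j -> i = 0%R.
Hypothesis M_gen : M \subset <<[set zh false i | i : F] :|: [set zh true i | i : F]>>.

(** Left multiplication by [dstep b i] leads from the coset of m on side [b] to its neighbour with
    label i. The factor [zh (~~ b) i] does not change that neighbour; it makes [dstep (~~ b) i] the
    inverse, so that an edge has one label seen from both ends. *)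
Definition dstep_def b i := zh (~~ b) i * zh b (- i)%R.
Fact dstep_key : unit. Proof. by []. Qed.
Definition dstep := locked_with dstep_key dstep_def.
Lemma dstepE b i : dstep b i = zh (~~ b) i * zh b (- i)%R.
Proof. by rewrite /dstep unlock. Qed.

Hypothesis M_min : forall N : {group mT}, N \subset M -> N :!=: 1 -> M \subset 'N(N) ->
  (forall (r : F) f, r != 0%R -> f \in N -> al r f \in N) -> N = M.
Hypothesis hexagon : forall b i j,
  dstep (~~ b) j * (dstep b i * (dstep (~~ b) j * (dstep b i * (dstep (~~ b) j * dstep b i)))) = 1.
(** The labels are those of a closed walk of length six; [zh false t] accounts for the choice of a
    representative of the starting coset. *)
Hypothesis hexagon_uniq : forall i1 i2 i3 i4 i5 i6 t,
  i1 != i2 -> i2 != i3 -> i3 != i4 ->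
  dstep true i6 * (dstep false i5 * (dstep true i4 * (dstep false i3 *
     (dstep true i2 * dstep false i1)))) = zh false t -> i1 = i3.

Definition ace (e : bool) f := if e then ac f else f.

Lemma aceM e : {morph ace e : f g / f * g}.
Proof. by case: e => // f g; apply: acM. Qed.

Lemma ace_mem e f : f \in M -> ace e f \in M.
Proof. by case: e => //; apply: ac_mem. Qed.

Lemma ace_zh e b i : ace e (zh b i) = zh (e (+) b) i.
Proof. by case: e; case: b => //=; rewrite ?acK. Qed.

Lemma ace_ace e e' f : ace e (ace e' f) = ace (e (+) e') f.
Proof. by case: e; case: e' => //=; rewrite ?acK. Qed.

Lemma al_ace r e f : al r (ace e f) = ace e (al r f).
Proof. by case: e => //=; rewrite al_ac. Qed.

Lemma al_zh r b i : al r (zh b i) = zh b (r * i)%R.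
Proof. by case: b; rewrite /= ?al_ac al_xh. Qed.

Lemma zhD b i j : zh b (i + j)%R = zh b i * zh b j.
Proof. by case: b; rewrite /= xhD ?acM. Qed.

Lemma zh0 b : zh b 0%R = 1.
Proof. by apply: (mulgI (zh b 0%R)); rewrite -zhD addr0 mulg1. Qed.

Lemma zhN b i : zh b (- i)%R = (zh b i)^-1.
Proof. by apply: (mulgI (zh b i)); rewrite -zhD addrN zh0 mulgV. Qed.

Lemma zh_mem b i : zh b i \in M.
Proof. by case: b; rewrite /= ?ac_mem. Qed.

Lemma dstep_mem b i : dstep b i \in M.
Proof. by rewrite dstepE groupM ?zh_mem. Qed.

Lemma dstepK b i : dstep (~~ b) i * dstep b i = 1.
Proof. by rewrite !dstepE negbK !zhN mulgA mulgKV mulgV. Qed.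

Lemma dstepVK b i : dstep b i * dstep (~~ b) i = 1.
Proof. by rewrite -[X in dstep X i * _]negbK dstepK. Qed.

Lemma ace_dstep e b i : ace e (dstep b i) = dstep (e (+) b) i.
Proof. by rewrite !dstepE aceM !ace_zh addbN. Qed.

Lemma zh_TI' b i j : zh (~~ b) i = zh b j -> i = 0%R.
Proof.
case: b => /= [|E]; last exact: (zh_TI E).
by move=> E; apply: (@zh_TI i j); rewrite /= E acK.
Qed.

Fact zgroup_set b : group_set [set zh b i | i : F].
Proof.
apply/group_setP; split=> [|_ _ /imsetP[i _ ->] /imsetP[j _ ->]].
  by rewrite -(zh0 b) imset_f.
by rewrite -zhD imset_f.
Qed.

Definition Zg b := Group (zgroup_set b).

Lemma ZgP b f : reflect (exists i, f = zh b i) (f \in Zg b).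
Proof. by apply: (iffP imsetP) => [[i _ ->]|[i ->]]; exists i. Qed.

Opaque Zg.
Arguments zh : simpl never.

Lemma zmul_mem b i m : m \in M -> zh b i * m \in M.
Proof. by move=> Mm; rewrite groupM ?zh_mem. Qed.

Lemma zh_in b i : zh b i \in Zg b. Proof. by apply/ZgP; exists i. Qed.

Lemma Zg_sub b : Zg b \subset M.
Proof. by apply/subsetP=> _ /ZgP[i ->]; apply: zh_mem. Qed.

Lemma ace_Zg e b f : (ace e f \in Zg (e (+) b)) = (f \in Zg b).
Proof.
apply/idP/idP => [/ZgP[i E]|/ZgP[i ->]].
  have -> : f = zh b i by rewrite -[f]/(ace false f) -(addbb e) -ace_ace E ace_zh addKb.
  exact: zh_in.
by rewrite ace_zh zh_in.
Qed.

Lemma al_Zg r b f : f \in Zg b -> al r f \in Zg b.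
Proof. by case/ZgP=> i ->; rewrite al_zh zh_in. Qed.

Definition vertex := {v : bool * {set mT} | v.2 \in rcosets (Zg v.1) M}.

Lemma vbase_proof : (false, Zg false : {set mT}).2 \in rcosets (Zg false) M.
Proof. by rewrite -[X in X \in _]rcoset1 mem_rcosets mulSGid ?Zg_sub. Qed.

Definition vx_def (b : bool) (m : mT) : vertex :=
  insubd (Sub (false, Zg false : {set mT}) vbase_proof) (b, Zg b :* m).

Fact vx_key : unit. Proof. by []. Qed.
Definition vx := locked_with vx_key vx_def.

Lemma val_vx b m : m \in M -> val (vx b m) = (b, Zg b :* m).
Proof.
move=> Mm; rewrite /vx locked_withE val_insubd; case: ifP => // /negP[]; apply/rcosetsP.
by exists m.
Qed.

Lemma vxP v : exists b m, m \in M /\ v = vx b m.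
Proof.
case: v => [[b A] Av]; have /rcosetsP[m Mm /= defA] := Av.
exists b, m; split=> //; apply: val_inj; rewrite val_vx //= defA //.
Qed.

Lemma vx_eq b m b' m' : m \in M -> m' \in M ->
  (vx b m == vx b' m') = (b == b') && (m * m'^-1 \in Zg b).
Proof.
move=> Mm Mm'; rewrite -val_eqE !val_vx // xpair_eqE.
case: eqP => //= <-; rewrite -mem_rcoset.
by apply/eqP/idP => H; apply/(@rcoset_eqP _ (Zg b)).
Qed.

Lemma vx_mul b m z : z \in Zg b -> m \in M -> vx b (z * m) = vx b m.
Proof.
move=> Zz Mm; apply/eqP; rewrite vx_eq ?eqxx ?mulgK //.
by rewrite groupM // (subsetP (Zg_sub b)).
Qed.

Definition vadj (u w : vertex) : bool :=
  ((val u).1 != (val w).1) && ((val u).2 :&: (val w).2 != set0).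

Definition nbr b m i := vx (~~ b) (dstep b i * m).

Lemma nbrE b m i : m \in M -> nbr b m i = vx (~~ b) (zh b (- i)%R * m).
Proof. by move=> Mm; rewrite /nbr dstepE -mulgA vx_mul ?zh_in // groupM ?zh_mem. Qed.

Lemma vadjP b m w : m \in M -> reflect (exists i, w = nbr b m i) (vadj (vx b m) w).
Proof.
move=> Mm; apply: (iffP idP) => [|[i ->]].
  have [b' [m' [Mm' ->]]] := vxP w.
  rewrite /vadj !val_vx //= => /andP[nb /set0Pn[f /setIP[]]].
  case/rcosetP=> _ /ZgP[i ->] -> H.
  exists (- i)%R; rewrite nbrE // opprK.
  have -> : ~~ b = b' by case: (b) (b') nb => [] [].
  by apply/esym/eqP; rewrite vx_eq ?zmul_mem // eqxx -mem_rcoset.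
rewrite nbrE // /vadj !val_vx ?zmul_mem //=; apply/andP; split; first by case: (b).
apply/set0Pn; exists (zh b (- i)%R * m); rewrite inE mem_rcoset mulgK zh_in /=.
exact: rcoset_refl.
Qed.

Lemma vadj_nbr b m i : m \in M -> vadj (vx b m) (nbr b m i).
Proof. by move=> Mm; apply/vadjP=> //; exists i. Qed.

Lemma vadj_sym : symmetric vadj.
Proof. by move=> u w; rewrite /vadj eq_sym setIC. Qed.

Lemma vadj_irr : irreflexive vadj.
Proof. by move=> u; rewrite /vadj eqxx. Qed.

Lemma zh_inj b : injective (zh b).
Proof.
move=> i j E; apply/eqP; rewrite -subr_eq0; apply/eqP.
apply: (@zh_TI' (~~ b) _ 0%R); rewrite negbK zhD zhN E mulgV zh0 //.
Qed.

Lemma nbr_inj b m : m \in M -> injective (nbr b m).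
Proof.
move=> Mm i j /eqP; rewrite !nbrE // vx_eq ?zmul_mem // => /andP[_].
rewrite invMg mulgA mulgK -zhN -zhD => /ZgP[k E].
have k0 := zh_TI' (esym E).
apply: oppr_inj; apply: (@zh_inj b).
apply: (mulIg (zh b (- - j)%R)); rewrite -zhD E k0 !zh0 zhN mulgV //.
Qed.

Lemma dstep0 b : dstep b 0%R = 1.
Proof. by rewrite !dstepE oppr0 !zh0 mulg1. Qed.

Lemma dmul_mem b i m : m \in M -> dstep b i * m \in M.
Proof. by move=> Mm; rewrite groupM ?dstep_mem. Qed.

Lemma nbr_back b m i : nbr (~~ b) (dstep b i * m) i = vx b m.
Proof. by rewrite /nbr mulgA dstepK mul1g negbK. Qed.

Lemma nbr_backV b m i : nbr b (dstep (~~ b) i * m) i = vx (~~ b) m.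
Proof. by rewrite -[X in nbr X]negbK nbr_back. Qed.

Lemma nbr_shift b a m i : m \in M -> nbr b (zh b a * m) i = nbr b m (i - a)%R.
Proof. by move=> Mm; rewrite !nbrE ?zmul_mem // mulgA -zhD opprB addrC. Qed.

Lemma al_id r : al r 1 = 1.
Proof. by apply: (mulgI (al r 1)); rewrite -alM !mulg1. Qed.

Lemma ace_id e : ace e 1 = 1.
Proof. by apply: (mulgI (ace e 1)); rewrite -aceM !mulg1. Qed.

Lemma al_dstep r b i : al r (dstep b i) = dstep b (r * i)%R.
Proof. by rewrite !dstepE alM !al_zh mulrN. Qed.

(** Conjugating a step by [zh b a] gives a product of two steps, so the steps generate a nontrivial
    normal subgroup stable under the maps [al r], and [M_min] makes it all of M. *)
Lemma M_dgen : M \subset <<[set dstep false i | i : F]>>.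
Proof.
pose D := <<[set dstep false i | i : F]>>%G.
have dD i : dstep false i \in D by rewrite mem_gen ?imset_f.
suff defD : D = M by rewrite -defD.
have eD i : dstep true i \in D.
  by have /(canRL (mulgK _)) := dstepK false i; rewrite mul1g => ->; rewrite groupV.
have zJ b a : zh b a \in 'N(D).
  rewrite inE -genJ gen_subG; apply/subsetP=> _ /imsetP[_ /imsetP[i _ ->] ->].
  rewrite conjgE -zhN.
  suff [h [-> //]] : exists h, zh b (- a)%R * (dstep false i * zh b a) = h /\ h \in D.
  case: b; [exists (dstep false (i - a)%R * dstep true (- a)%R) |
            exists (dstep true (- a)%R * dstep false (i - a)%R)]; split; try exact: groupM.
    rewrite !dstepE /= !opprK opprB !mulgA -zhD.
    rewrite [(- a + i)%R]addrC -!mulgA; congr (_ * _); rewrite !mulgA -zhD.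
    by rewrite addrAC addrN add0r.
  rewrite !dstepE /=.
  rewrite !opprK opprB -!mulgA; congr (_ * _).
  by rewrite !mulgA -zhD [(a + _)%R]addrC subrK -mulgA -zhD [(- i + a)%R]addrC.
apply: M_min.
- by rewrite gen_subG; apply/subsetP=> _ /imsetP[i _ ->]; apply: dstep_mem.
- apply/trivgPn; exists (dstep false 1%R); first exact: dD.
  apply/eqP=> /(congr1 (mulg^~ (zh false 1%R))).
  rewrite mul1g !dstepE -mulgA -zhD addNr zh0 mulg1 => /zh_TI /eqP.
  by rewrite oner_eq0.
- rewrite (subset_trans M_gen) // gen_subG subUset.
  by apply/andP; split; apply/subsetP=> _ /imsetP[i _ ->].
move=> r f r0 /gen_prodgP[n [h Dh ->]].
rewrite (big_morph (al r) (alM r) (al_id r)) group_prod // => i _.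
by have /imsetP[j _ ->] := Dh i; rewrite al_dstep.
Qed.

Lemma M_dind (P : mT -> Prop) : P 1 ->
  (forall i g, g \in M -> P g -> P (dstep false i * g)) -> forall g, g \in M -> P g.
Proof.
move=> P1 Pd g /(subsetP M_dgen)/gen_prodgP[n [h Dh ->]] {g}.
suff: \prod_(i < n) h i \in M /\ P (\prod_(i < n) h i) by case.
elim: n h Dh => [|n IHn] h Dh; first by rewrite big_ord0.
rewrite big_ord_recl.
have [|Mh Ph] := IHn (fun i => h (lift ord0 i)); first by move=> i; apply: Dh.
have /imsetP[j _ ->] := Dh ord0.
by split; [apply: dmul_mem | apply: Pd].
Qed.

(** As [dstep b 0] is 1, the two cosets of one element are adjacent. Left multiplication by
    [dstep false i] is thus a path of length two, and [M_dind] applies. *)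
Lemma connect_vx b m b' m' : m \in M -> m' \in M -> connect vadj (vx b m) (vx b' m').
Proof.
have csym : connect_sym vadj by apply: sym_connect_sym; apply: vadj_sym.
have c0 g : g \in M -> connect vadj (vx false 1) (vx false g).
  move: g; apply: M_dind => // i g Mg /connect_trans; apply.
  apply: connect_trans (connect1 (vadj_nbr false i Mg)) _.
  have := vadj_nbr true 0%R (dmul_mem false i Mg).
  by rewrite /nbr /= dstep0 mul1g => /connect1.
have cb d g : g \in M -> connect vadj (vx false 1) (vx d g).
  case: d => Mg; last exact: c0.
  apply: connect_trans (c0 g Mg) _; have := vadj_nbr false 0%R Mg.
  by rewrite /nbr dstep0 mul1g => /connect1.
by move=> Mm Mm'; apply: (connect_trans (y := vx false 1)); rewrite ?cb // csym cb.
Qed.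

Lemma vadj_connected : connected_graph vadj.
Proof.
move=> u w; have [b [m [Mm ->]]] := vxP u; have [b' [m' [Mm' ->]]] := vxP w.
exact: connect_vx.
Qed.

Lemma vadj_bipartite : bipartite_graph vadj.
Proof. by exists (fun v => (val v).1) => u w /andP[]. Qed.

Lemma vadj_valency : regular_of_valency vadj #|F|.
Proof.
move=> u; have [b [m [Mm ->]]] := vxP u.
have -> : [set w | vadj (vx b m) w] = [set nbr b m i | i : F].
  apply/setP=> w; rewrite inE; apply/(vadjP _ _ Mm)/imsetP => [[i ->]|[i _ ->]]; by exists i.
by rewrite card_imset //; apply: nbr_inj.
Qed.

(** The condition u4 <> u2 supplies the third inequality of [hexagon_uniq]; all the conditions pass
    through injective maps preserving adjacency. *)
Definition hexa u0 u1 u2 u3 := exists u4 u5,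
  [/\ vadj u1 u2, vadj u2 u3, vadj u3 u4, vadj u4 u5 & vadj u5 u0 /\ u4 != u2].

Lemma hexagon_uniq' b i1 i2 i3 i4 i5 i6 t :
  i1 != i2 -> i2 != i3 -> i3 != i4 ->
  dstep (~~ b) i6 * (dstep b i5 * (dstep (~~ b) i4 * (dstep b i3 *
     (dstep (~~ b) i2 * dstep b i1)))) = zh b t -> i1 = i3.
Proof.
case: b => n12 n23 n34; last exact: hexagon_uniq.
move/(congr1 (ace true)); do 5!rewrite aceM ace_dstep; rewrite ace_dstep ace_zh.
exact: hexagon_uniq.
Qed.

(* Label transport: in the path u0 u1 u2 u3 the outer edges have labels i and k. *)
Lemma hexaE b m i j k : m \in M -> i != j -> j != k ->
  hexa (nbr b m i) (vx b m) (nbr b m j) (nbr (~~ b) (dstep b j * m) k) <-> i = k.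
Proof.
move=> Mm nij njk; split=> [[u4 [u5 [_ _ A34 A45 [A50 n42]]]]|<-].
  pose m0 := dstep b i * m; have Mm0 : m0 \in M by apply: dmul_mem.
  have mE : m = dstep (~~ b) i * m0 by rewrite mulgA dstepK mul1g.
  have M2 : dstep b j * m \in M by apply: dmul_mem.
  have M3 : dstep (~~ b) k * (dstep b j * m) \in M by apply: dmul_mem.
  move: A34; rewrite /nbr negbK => /(vadjP _ _ M3)[i4 E4].
  have M4 : dstep b i4 * (dstep (~~ b) k * (dstep b j * m)) \in M by apply: dmul_mem.
  move: A45; rewrite {}E4 /nbr in n42 * => /(vadjP _ _ M4)[i5 E5].
  have M5 : dstep (~~ b) i5 * (dstep b i4 * (dstep (~~ b) k * (dstep b j * m))) \in M.
    exact: dmul_mem.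
  move: A50; rewrite E5 /nbr negbK => /(vadjP _ _ M5)[i6].
  rewrite -/m0 /nbr => /esym/eqP; rewrite vx_eq ?dmul_mem // => /andP[_].
  rewrite -/m0 {1}mE => /ZgP[t]; clearbody m0; rewrite !mulgA mulgK -!mulgA => E.
  apply: (@hexagon_uniq' (~~ b) _ j _ i4 i5 i6 t) => //; last by rewrite negbK.
  by apply: contraNneq n42 => <-; rewrite mulgA dstepVK mul1g.
have M1 : dstep b j * m \in M by apply: dmul_mem.
exists (nbr b (dstep (~~ b) i * (dstep b j * m)) j).
exists (nbr (~~ b) (dstep b j * (dstep (~~ b) i * (dstep b j * m))) i).
have M2 : dstep (~~ b) i * (dstep b j * m) \in M by apply: dmul_mem.
have M3 : dstep b j * (dstep (~~ b) i * (dstep b j * m)) \in M by apply: dmul_mem.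
split.
- exact: vadj_nbr.
- by rewrite {1}/nbr; apply: vadj_nbr.
- by rewrite {1}/nbr negbK; apply: vadj_nbr.
- by rewrite {1}/nbr; apply: vadj_nbr.
split.
  rewrite {1}/nbr negbK; apply/vadjP; first exact: dmul_mem.
  exists j; rewrite /nbr; congr (vx _ _).
  apply: (mulgI (dstep (~~ b) i)); rewrite mulgA dstepK mul1g.
  by rewrite -[in LHS](mul1g m) -(hexagon b j i) !mulgA.
apply: contraNneq nij => E; apply/eqP/(nbr_inj M2 (b := b)).
by rewrite nbr_backV E.
Qed.

(** * Automorphisms from side exchange, multiplications and right translations *)

Definition tau (e : bool) (t : F) (g : mT) (v : vertex) :=
  vx (e (+) (val v).1) (ace e (al t (repr (val v).2)) * g).

Lemma act_mem e t g m : m \in M -> g \in M -> ace e (al t m) * g \in M.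
Proof. by move=> Mm Mg; rewrite groupM ?ace_mem ?al_mem. Qed.

Lemma tau_vx e t g b m : g \in M -> m \in M ->
  tau e t g (vx b m) = vx (e (+) b) (ace e (al t m) * g).
Proof.
move=> Mg Mm; rewrite /tau val_vx //=; case: (repr_rcosetP (Zg b) m) => z Zz.
by rewrite alM aceM -mulgA vx_mul ?act_mem // ace_Zg al_Zg.
Qed.

Lemma tau_nbr e t g b m i : g \in M -> m \in M ->
  tau e t g (nbr b m i) = nbr (e (+) b) (ace e (al t m) * g) (t * i)%R.
Proof.
move=> Mg Mm; rewrite /nbr tau_vx ?dmul_mem // alM aceM al_dstep ace_dstep.
by rewrite mulgA addbN.
Qed.

Lemma tau_adj e t g u w : g \in M -> vadj u w -> vadj (tau e t g u) (tau e t g w).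
Proof.
move=> Mg; have [b [m [Mm ->]]] := vxP u => /(vadjP _ _ Mm)[i ->].
by rewrite tau_nbr // tau_vx // vadj_nbr // act_mem.
Qed.

Lemma tau_comp e t g e' t' g' v : g \in M -> g' \in M ->
  tau e' t' g' (tau e t g v) = tau (e' (+) e) (t' * t)%R (ace e' (al t' g) * g') v.
Proof.
move=> Mg Mg'; have [b [m [Mm ->]]] := vxP v.
rewrite !tau_vx ?act_mem // alM aceM al_ace ace_ace al_comp addbA mulgA.
by [].
Qed.

Lemma tau_id v : tau false 1%R 1 v = v.
Proof. by have [b [m [Mm ->]]] := vxP v; rewrite tau_vx //= al1 mulg1. Qed.

Lemma tauK e t g : t != 0%R -> g \in M ->
  cancel (tau e t g) (tau e t^-1%R (ace e (al t^-1%R g))^-1).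
Proof.
move=> t0 Mg v; rewrite tau_comp ?groupV ?ace_mem ?al_mem // addbb mulVf // mulgV.
exact: tau_id.
Qed.

Fact ptau_key : unit. Proof. by []. Qed.
(** [tau e t g] is known to be a permutation for t <> 0 and g in M; picking a permutation that
    agrees with it, with default 1, avoids proofs as arguments. *)
Definition ptau_def e t g : {perm vertex} :=
  odflt 1 [pick s : {perm vertex} | [forall v, s v == tau e t g v]].
Definition ptau := locked_with ptau_key ptau_def.

Lemma ptauE e t g v : t != 0%R -> g \in M -> ptau e t g v = tau e t g v.
Proof.
move=> t0 Mg; rewrite /ptau locked_withE.
change (unkeyed ptau_def e t g) with (ptau_def e t g); rewrite /ptau_def.
case: pickP => [s /forallP/(_ v)/eqP //|].
move/(_ (perm (can_inj (tauK e t0 Mg)))) => /negP[].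
by apply/forallP=> w; rewrite permE.
Qed.

Lemma ptauM e t g e' t' g' : t != 0%R -> t' != 0%R -> g \in M -> g' \in M ->
  ptau e t g * ptau e' t' g' = ptau (e' (+) e) (t' * t)%R (ace e' (al t' g) * g').
Proof.
move=> t0 t'0 Mg Mg'; apply/permP=> v.
by rewrite permM !ptauE ?mulf_neq0 ?act_mem // tau_comp.
Qed.

Lemma ptau1 : ptau false 1%R 1 = 1.
Proof. by apply/permP=> v; rewrite ptauE ?oner_neq0 // tau_id perm1. Qed.

(** The image of the base vertex gives e, and g up to a left factor [zh e a]; comparing the labels
    there gives t i - a = t' i for all i, so a = 0 and t = t'. *)
Lemma ptau_inj e t g e' t' g' : t != 0%R -> t' != 0%R -> g \in M -> g' \in M ->
  ptau e t g = ptau e' t' g' -> [/\ e = e', t = t' & g = g'].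
Proof.
move=> t0 t'0 Mg Mg' E.
have Ev v : tau e t g v = tau e' t' g' v by rewrite -!ptauE ?E.
have := Ev (vx false 1); rewrite !tau_vx // !al_id !ace_id !mul1g !addbF => /eqP.
rewrite vx_eq // => /andP[/eqP <- /ZgP[a]] /(canRL (mulgKV _)) defg.
have Ei i : (t * i - a = t' * i)%R.
  have := Ev (nbr false 1 i); rewrite !tau_nbr // !al_id !ace_id !mul1g !addbF.
  have <- : e = e'.
    have := Ev (vx false 1); rewrite !tau_vx // => /eqP.
    by rewrite vx_eq ?act_mem // !addbF => /andP[/eqP].
  by rewrite defg nbr_shift // => /nbr_inj; apply.
have a0 : a = 0%R by have := Ei 0%R; rewrite !mulr0 add0r => /eqP; rewrite oppr_eq0 => /eqP.
by split=> //; [have := Ei 1%R; rewrite a0 subr0 !mulr1 | rewrite defg a0 zh0 mul1g].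
Qed.

(** * Rigidity: every automorphism is one of the maps [tau] *)

Section Rigidity.

Variable s : vertex -> vertex.
Hypothesis s_inj : injective s.
Hypothesis s_adj : forall u w, vadj u w -> vadj (s u) (s w).

(* [s] carries the labelled star at the vertex of [m] to that of [m'], acting on
   the labels by [pi]. *)
Definition matches (pi : F -> F) b m b' m' :=
  [/\ m' \in M, s (vx b m) = vx b' m' & forall i, s (nbr b m i) = nbr b' m' (pi i)].

Lemma hexa_s u0 u1 u2 u3 : hexa u0 u1 u2 u3 -> hexa (s u0) (s u1) (s u2) (s u3).
Proof.
case=> u4 [u5 [A12 A23 A34 A45 [A50 n42]]]; exists (s u4), (s u5).
by split; try exact: s_adj; split; [exact: s_adj | rewrite (inj_eq s_inj)].
Qed.

(** For i <> j the path with labels i, j, i extends to a hexagon, hence so does its image, and by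
    [hexaE] the unknown last label of the image equals the first one, [pi i]. For i = j the edge is
    retraced. *)
Lemma matches_step pi b m b' m' j : m \in M -> matches pi b m b' m' ->
  matches pi (~~ b) (dstep b j * m) (~~ b') (dstep b' (pi j) * m').
Proof.
move=> Mm [Mm' Ev En]; have M1 : dstep b j * m \in M by apply: dmul_mem.
split; [exact: dmul_mem | exact: En|] => i.
have [->|nij] := eqVneq i j; first by rewrite !nbr_back.
have /hexa_s : hexa (nbr b m i) (vx b m) (nbr b m j) (nbr (~~ b) (dstep b j * m) i).
  by apply/hexaE; rewrite // eq_sym.
have M1' : dstep b' (pi j) * m' \in M by apply: dmul_mem.
have := s_adj (vadj_nbr (~~ b) i M1); rewrite -/(nbr b m j) !En Ev.
rewrite {1}/nbr => /(vadjP _ _ M1')[k Ek]; rewrite Ek.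
have pij : pi i != pi j.
  by apply: contra_neq nij => /(congr1 (nbr b' m')); rewrite -!En => /s_inj/(nbr_inj Mm).
have pjk : pi j != k.
  apply: contra_neq nij => kj; apply: (nbr_inj M1 (b := ~~ b)); apply: s_inj.
  by rewrite Ek -kj nbr_back nbr_back Ev.
by move/(hexaE _ Mm' pij pjk) => ->.
Qed.

Lemma matches_gen pi b' g m m' : g \in M -> m \in M -> matches pi false m b' m' ->
  exists2 g', g' \in M & matches pi false (g * m) b' (g' * m').
Proof.
move=> Mg Mm H; move: g Mg; apply: M_dind => [|i g Mg [g' Mg' Hg]].
  by exists 1; rewrite ?mul1g ?group1.
have Mgm : g * m \in M by rewrite groupM.
have := matches_step 0%R (dmul_mem false i Mgm) (matches_step i Mgm Hg).
rewrite dstep0 mul1g !negbK => H1.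
exists (dstep (~~ b') (pi 0%R) * (dstep b' (pi i) * g')); first exact: dmul_mem (dmul_mem _ _ _).
by rewrite -!mulgA.
Qed.

Lemma matches_start : exists pi e g, matches pi false 1 e g.
Proof.
have [e [g [Mg Eg]]] := vxP (s (vx false 1)).
exists (fun i => odflt 0%R [pick k | s (nbr false 1 i) == nbr e g k]), e, g.
split=> // i; case: pickP => [k /eqP //|] /=.
have := s_adj (vadj_nbr false i (group1 M)); rewrite Eg => /(vadjP _ _ Mg)[k ->].
by move/(_ k); rewrite eqxx.
Qed.

(* The word [zh false 1] in the steps returns to the base vertex and shifts its
   labels by 1, so [pi] commutes with this shift up to a translation. *)
Lemma matches_affine pi e g : matches pi false 1 e g ->
  exists2 t, t != 0%R & forall i, pi i = (pi 0 + t * i)%R.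
Proof.
move=> H; have [Mg Ev En] := H.
have pi_inj : injective pi.
  move=> i j /(congr1 (nbr e g)); rewrite -!En => /s_inj/nbr_inj; exact.
have [g' Mg'] := matches_gen (zh_mem false 1%R) (group1 M) H.
rewrite mulg1 => -[Mgg Ev1 En1].
have E1 : vx false (zh false 1%R) = vx false 1 by rewrite -[zh _ _]mulg1 vx_mul ?zh_in.
move: Ev1; rewrite E1 Ev => /esym/eqP; rewrite vx_eq // mulgK eqxx => /ZgP[t defg'].
have step i : pi (i - 1)%R = (pi i - t)%R.
  apply: (nbr_inj Mg (b := e)); rewrite -En -nbr_shift // -defg' -En1.
  by rewrite -[zh false 1%R]mulg1 nbr_shift.
have pi_nat n : pi n%:R%R = (pi 0 + t * n%:R)%R.
  elim: n => [|n IHn]; first by rewrite mulr0 addr0.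
  have := step n.+1%:R%R; rewrite -{1}addn1 natrD addrK IHn => /esym/(canRL (subrK _)) ->.
  by rewrite -[in RHS]addn1 natrD mulrDr mulr1 addrA.
exists t; last by move=> i; have [n ->] := F_nat i.
apply/eqP=> t0; have := pi_nat 1%N; rewrite t0 mul0r addr0 => /pi_inj/eqP.
by rewrite oner_eq0.
Qed.

(** Multiplying the representative by [zh e (- pi 0)] makes the affine label map linear. Then [s]
    and [tau e t g] agree on the base star and obey the same rule along every step. *)
Lemma matches_tau : exists e t g, [/\ t != 0%R, g \in M & s =1 tau e t g].
Proof.
have [pi [e [g0 H0]]] := matches_start; have [t t0 pi_t] := matches_affine H0.
have [Mg0 _ _] := H0; pose g := zh e (- pi 0)%R * g0.
have Mg : g \in M by apply: zmul_mem.
have H : matches (fun i => t * i)%R false 1 e g.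
  case: H0 => _ Ev En; split=> //; first by rewrite vx_mul ?zh_in.
  by move=> i; rewrite En pi_t /g nbr_shift // opprK addrC.
exists e, t, g; split=> // v.
have Hm m : m \in M -> matches (fun i => t * i)%R false m e (ace e (al t m) * g).
  move: m; apply: M_dind => [|i m Mm Hm]; first by rewrite al_id ace_id mul1g.
  have := matches_step 0%R (dmul_mem false i Mm) (matches_step i Mm Hm).
  by rewrite mulr0 !dstep0 !mul1g !negbK alM aceM al_dstep ace_dstep addbF mulgA.
have [[] [m [Mm ->]]] := vxP v; have [_ Ev En] := Hm m Mm.
  have := En 0%R; rewrite mulr0 /nbr !dstep0 !mul1g => ->.
  by rewrite tau_vx // addbT.
by rewrite Ev tau_vx // addbF.
Qed.

End Rigidity.

Definition is_aut (s : {perm vertex}) := [forall u, forall w, vadj (s u) (s w) == vadj u w].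

Fact autG_set : group_set [set s | is_aut s].
Proof.
apply/group_setP; split=> [|s s' /[!inE] /forallP As /forallP As'].
  by rewrite inE; apply/forallP=> u; apply/forallP=> w; rewrite !perm1.
apply/forallP=> u; apply/forallP=> w; rewrite !permM.
by rewrite (eqP (forallP (As' _) _)) (forallP (As _) _).
Qed.

Definition autG : {group {perm vertex}} := Group autG_set.

Lemma autG_adj s u w : s \in autG -> vadj (s u) (s w) = vadj u w.
Proof. by rewrite inE => /forallP/(_ u)/forallP/(_ w)/eqP. Qed.

Lemma ptau_aut e t g : t != 0%R -> g \in M -> ptau e t g \in autG.
Proof.
move=> t0 Mg; rewrite inE; apply/forallP=> u; apply/forallP=> w.
rewrite !ptauE //; apply/eqP; apply/idP/idP; last exact: tau_adj.
move=> A; rewrite -(tauK e t0 Mg u) -(tauK e t0 Mg w).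
by apply: tau_adj A; rewrite groupV ace_mem ?al_mem.
Qed.

Lemma autGP s : s \in autG -> exists e t g, [/\ t != 0%R, g \in M & s = ptau e t g].
Proof.
move=> As; have [//|u w|e [t [g [t0 Mg Es]]]] := @matches_tau s; first exact: perm_inj.
  by rewrite autG_adj.
by exists e, t, g; split=> //; apply/permP=> v; rewrite ptauE.
Qed.

(** Labels can be scaled by k - i and translated by i, which carries 0, 1 to i, k: the affine group
    of F is 2-transitive. *)
Lemma two_arc_std a b c : two_arc vadj a b c ->
  exists2 s, s \in autG & [/\ s (nbr false 1 0%R) = a, s (vx false 1) = b & s (nbr false 1 1%R) = c].
Proof.
case/and5P; have [e [m [Mm ->]]] := vxP b.
rewrite vadj_sym => /(vadjP _ _ Mm)[i ->] /(vadjP _ _ Mm)[k ->] _ _ nac.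
have nik : (k - i)%R != 0%R by rewrite subr_eq0 eq_sym; apply: contraNneq nac => ->.
have Mg : zh e (- i)%R * m \in M by apply: zmul_mem.
exists (ptau e (k - i)%R (zh e (- i)%R * m)); first exact: ptau_aut.
rewrite !ptauE // !tau_nbr // tau_vx // al_id ace_id !mul1g addbF mulr0 mulr1.
by rewrite !nbr_shift // vx_mul ?zh_in // opprK add0r subrK.
Qed.

Lemma autG_two_arc : two_arc_transitive vadj autG.
Proof.
move=> a b c a' b' c' /two_arc_std[s As [<- <- <-]] /two_arc_std[s' As' [<- <- <-]].
by exists (s^-1 * s'); rewrite ?groupM ?groupV // !permM !permK.
Qed.

(** * Right translations and the subgroup preserving the sides *)

Definition R g := ptau false 1%R g.

Lemma RM : {in M &, {morph R : f g / f * g}}.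
Proof. by move=> f g Mf Mg; rewrite /R ptauM ?oner_neq0 // mulr1 /= al1. Qed.

Canonical R_morphism := Morphism RM.

Lemma RE g b m : g \in M -> m \in M -> R g (vx b m) = vx b (m * g).
Proof. by move=> Mg Mm; rewrite ptauE ?oner_neq0 // tau_vx //= al1. Qed.

Lemma injm_R : 'injm R.
Proof.
apply/injmP=> f g Mf Mg E.
by have [] := ptau_inj (oner_neq0 F) (oner_neq0 F) Mf Mg E.
Qed.

Definition MR := (R @* M)%G.

Lemma R_mem g : g \in M -> R g \in MR.
Proof. by move=> Mg; apply: mem_morphim. Qed.

Definition al_perm t := ptau false t 1.

Lemma ptau_split t g : t != 0%R -> g \in M -> ptau false t g = al_perm t * R g.
Proof. by move=> t0 Mg; rewrite ptauM ?oner_neq0 //= al_id !mul1r !mul1g. Qed.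

Lemma R_al t g : t != 0%R -> g \in M -> R g * al_perm t = al_perm t * R (al t g).
Proof.
move=> t0 Mg; rewrite !ptauM ?oner_neq0 ?al_mem //= al_id mulr1 mul1r mul1g mulg1.
by [].
Qed.

Definition same_side (s : {perm vertex}) := [forall v, (val (s v)).1 == (val v).1].

Fact Gp_set : group_set [set s in autG | same_side s].
Proof.
apply/group_setP; split=> [|s s' /setIdP[As /forallP Ss] /setIdP[As' /forallP Ss']].
  by apply/setIdP; split; [exact: group1 | apply/forallP=> v; rewrite perm1].
apply/setIdP; split; [exact: groupM | apply/forallP=> v].
by rewrite permM (eqP (Ss' _)) Ss.
Qed.

Definition Gp : {group {perm vertex}} := Group Gp_set.

Lemma Gp_aut : Gp \subset autG.
Proof. by apply/subsetP=> s /setIdP[]. Qed.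

Lemma ptau_Gp t g : t != 0%R -> g \in M -> ptau false t g \in Gp.
Proof.
move=> t0 Mg; apply/setIdP; split; [exact: ptau_aut | apply/forallP=> v; rewrite ptauE //].
by have [b [m [Mm ->]]] := vxP v; rewrite tau_vx // !val_vx ?act_mem.
Qed.

Lemma GpP s : s \in Gp -> exists t g, [/\ t != 0%R, g \in M & s = ptau false t g].
Proof.
case/setIdP=> /autGP[e [t [g [t0 Mg ->]]]] /forallP/(_ (vx false 1)).
rewrite ptauE // tau_vx // !val_vx ?act_mem //=.
by case: e => //= _; exists t, g.
Qed.

Lemma MR_Gp : MR \subset Gp.
Proof. by apply/subsetP=> _ /morphimP[g _ Mg ->]; apply: ptau_Gp; rewrite ?oner_neq0. Qed.

Lemma MR_norm : Gp \subset 'N(MR).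
Proof.
apply/subsetP=> _ /GpP[t [g [t0 Mg ->]]]; rewrite ptau_split // groupM //; last first.
  by rewrite (subsetP (normG _)) // R_mem.
rewrite inE; apply/subsetP=> _ /imsetP[_ /morphimP[f _ Mf ->] ->].
by rewrite /conjg R_al // mulKg R_mem ?al_mem.
Qed.

(** The equation says that [ptau false t g] commutes with the right translations, so these have
    trivial centralizer in [Gp]. *)
Hypothesis M_cent : forall t g, t != 0%R -> g \in M ->
  (forall f, f \in M -> al t f * g = g * f) -> t = 1%R /\ g = 1.

(** If N meets the translations trivially, the two normal subgroups commute, against [M_cent].
    Otherwise the translations in N form a nontrivial normal subgroup of M, stable under the
    multiplications because these lie in [Gp], and [M_min] applies. *)
Lemma MR_least (N : {group {perm vertex}}) :
  N \subset Gp -> Gp \subset 'N(N) -> N :!=: 1 -> MR \subset N.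
Proof.
move=> sNG nNG ntN; have [tiN|ntNM] := eqVneq (N :&: MR) 1.
  have /centsP cN : N \subset 'C(MR).
    apply/commG1P/trivgP; rewrite -tiN subsetI commg_subl commg_subr.
    by rewrite !(subset_trans _ nNG, subset_trans _ MR_norm, MR_Gp).
  case/trivgPn: ntN => s Ns; case/eqP.
  have [t [g [t0 Mg defs]]] := GpP (subsetP sNG s Ns).
  have [|t1 g1] := M_cent t0 Mg; last by rewrite defs t1 g1 ptau1.
  move=> f Mf; have := cN s Ns (R f) (R_mem Mf).
  rewrite /commute defs !ptauM ?oner_neq0 //= al1 => /ptau_inj[] //;
    rewrite ?mulf_neq0 ?oner_neq0 ?groupM ?al_mem //.
suff defP : (R @*^-1 N)%G = M.
  by rewrite sub_morphim_pre //= -{1}defP /=.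
apply: M_min.
- by rewrite subsetIl.
- apply: contra ntNM => /eqP P1; apply/eqP/trivgP/subsetP=> s /setIP[Ns /morphimP[f _ Mf defs]].
  have: f \in R @*^-1 N by rewrite mem_morphpre // -defs.
  by rewrite P1 => /set1P f1; rewrite defs f1 morph1 group1.
- apply/subsetP=> g Mg; rewrite inE; apply/subsetP=> _ /imsetP[f /morphpreP[Mf Nf] ->].
  apply/morphpreP; split; first exact: groupJ.
  rewrite morphJ // memJ_norm // (subsetP nNG) // (subsetP MR_Gp) //.
  exact: R_mem.
move=> t f t0 /morphpreP[Mf Nf]; apply/morphpreP; split; first exact: al_mem.
have nt : al_perm t \in 'N(N) by rewrite (subsetP nNG) // ptau_Gp.
rewrite -[mfun _ _]/(R (al t f)); have /esym/(canRL (mulKg _)) -> := R_al t0 Mf.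
by rewrite -[_ * (_ * _)]/(R f ^ al_perm t) memJ_norm.
Qed.

Lemma vx_edge a b : vadj a b ->
  exists e m, [/\ m \in M, a = vx e m & b = vx (~~ e) m].
Proof.
have [e [m [Mm ->]]] := vxP a => /(vadjP _ _ Mm)[i ->].
have Mim : zh e (- i)%R * m \in M by apply: zmul_mem.
by exists e, (zh e (- i)%R * m); rewrite nbrE // vx_mul ?zh_in.
Qed.

Lemma stab_sub_Gp a : 'C_autG[a | 'P] \subset Gp.
Proof.
apply/subsetP=> _ /setIP[/autGP[e [t [g [t0 Mg ->]]]] /astab1P].
have [b [m [Mm ->]]] := vxP a; rewrite /= /aperm ptauE // tau_vx //.
by case: e => [/eqP|_]; [rewrite vx_eq ?act_mem //; case: b | apply: ptau_Gp].
Qed.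

Lemma R_stab b m z : z \in Zg b -> m \in M -> R (z ^ m) \in 'C_autG[vx b m | 'P].
Proof.
move=> Zz Mm; have Mz : z ^ m \in M by rewrite groupJ // (subsetP (Zg_sub b)).
apply/setIP; split; first by apply: (subsetP _ _ (R_mem Mz)); apply: subset_trans MR_Gp Gp_aut.
by apply/astab1P; rewrite /= /aperm RE // conjgE mulKVg vx_mul.
Qed.

(** The two stabilizers contain the translations by conjugates of [Zg false] and [Zg true] under one
    m, which generate all translations. Any element of [Gp] is an element fixing one end times a
    translation. *)
Lemma Gstar_edge a b : vadj a b -> Gstar autG a b = Gp.
Proof.
move=> /vx_edge[e [m [Mm -> ->]]]; apply: group_inj.
have sub : Gstar autG (vx e m) (vx (~~ e) m) \subset Gp by rewrite gen_subG subUset !stab_sub_Gp.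
apply/eqP; rewrite eqEsubset sub andTb.
pose Gs := Gstar autG (vx e m) (vx (~~ e) m); rewrite -/Gs.
have CGs d : 'C_autG[vx d m | 'P] \subset Gs.
  by rewrite sub_gen //; case: (e) (d) => [] []; rewrite ?subsetUl ?subsetUr.
have RGs g : g \in M -> R g \in Gs.
  move=> Mg; rewrite -(conjgKV m g); move: (g ^ m^-1) (groupJ Mg (groupVr Mm)).
  apply: M_dind => [|i f Mf Rf]; first by rewrite conj1g morph1 group1.
  have Rz d j : R (zh d j ^ m) \in Gs.
    by apply: (subsetP (CGs d)); apply: R_stab; rewrite ?zh_in.
  have Mz d j : zh d j ^ m \in M by rewrite groupJ ?zh_mem.
  have Mfm : f ^ m \in M by rewrite groupJ.
  have -> : (dstep false i * f) ^ m = (zh true i ^ m * zh false (- i)%R ^ m) * f ^ m.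
    by rewrite dstepE !conjMg.
  have RMm d d' : d \in M -> d' \in M -> R d \in Gs -> R d' \in Gs -> R (d * d') \in Gs.
    by move=> Md Md' Rd Rd'; rewrite RM // groupM.
  by apply: (RMm _ _ (groupM (Mz _ _) (Mz _ _)) Mfm _ Rf); apply: RMm.
apply/subsetP=> _ /GpP[t [g [t0 Mg ->]]].
(* With this choice [al t m * h] is m, so [ptau false t h] fixes [vx e m]. *)
pose h := (al t m)^-1 * m; have Mh : h \in M by rewrite groupM ?groupV ?al_mem.
have -> : ptau false t g = ptau false t h * R (h^-1 * g).
  have Mk : h^-1 * g \in M by rewrite groupM ?groupV.
  rewrite /R ptauM ?oner_neq0 //. by rewrite /= al1 mul1r mulKVg.
rewrite groupM ?RGs ?groupM ?groupV //; apply: (subsetP (CGs e)).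
apply/setIP; split; first exact: ptau_aut.
by apply/astab1P; rewrite /= /aperm ptauE // tau_vx //= mulKVg.
Qed.

Lemma orbit_Gp v w : w \in orbit 'P Gp v -> exists2 s, s \in MR & s v = w.
Proof.
case/orbitP=> _ /GpP[t [g [t0 Mg ->]]] <- /=; rewrite /aperm ptauE //.
have [b [m [Mm ->]]] := vxP v; rewrite tau_vx //=.
have Mh : m^-1 * (al t m * g) \in M by rewrite !groupM ?groupV ?al_mem.
by exists (R (m^-1 * (al t m * g))); [exact: R_mem | rewrite RE // mulKVg].
Qed.

(** The preimage of N in [Gp] contains [MR] by [MR_least], and [MR] is already transitive on the
    orbit. *)
Lemma quasi_Gp v : quasiprimitive_on (induced_on Gp (orbit 'P Gp v)) (orbit 'P Gp v).
Proof.
set D := orbit 'P Gp v; move=> N /andP[sNH /mingroupP[/andP[ntN nNH] _]].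
have GD : Gp \subset 'N(D | 'P).
  exact: atrans_acts (atrans_orbit _ _ _).
pose N1 := (Gp :&: restr_perm D @*^-1 N)%G.
have sMN : MR \subset N1.
  apply: MR_least.
  - exact: subsetIl.
  - rewrite normsI ?normG //; apply/subsetP=> s Gs; rewrite inE.
    apply/subsetP=> _ /imsetP[r /morphpreP[Dr Nr] ->].
    apply/morphpreP; split; first by rewrite groupJ // (subsetP GD).
    have Ds := subsetP GD s Gs.
    rewrite -[mfun _ _]/(restr_perm D (r ^ s)) morphJ // memJ_norm //.
    by apply: (subsetP nNH); apply: mem_morphim.
  - apply: contraNneq ntN => N1_1; apply/eqP/trivgP/subsetP=> r Nr.
    have /morphimP[s Ds Gs defr] := subsetP sNH r Nr.
    have: s \in N1 by rewrite inE Gs; apply/morphpreP; rewrite -defr.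
    by rewrite N1_1 => /set1P s1; rewrite defr s1 morph1 group1.
have Dv : v \in D by apply: orbit_refl.
apply/imsetP; exists v => //; apply/setP=> w; apply/idP/idP => [/orbit_Gp[s Ms <-]|].
  have /setIP[Gs /morphpreP[Ds Ns]] := subsetP sMN s Ms.
  by apply/orbitP; exists (restr_perm D s) => //; rewrite /= /aperm restr_permE.
case/orbitP=> r Nr <-; have /morphimP[s Ds Gs ->] := subsetP sNH r Nr.
by rewrite /= /aperm restr_permE //; apply/orbitP; exists s.
Qed.

Lemma MR_minnormal : minimal_normal MR Gp.
Proof.
rewrite /minimal_normal MR_Gp; apply/mingroupP; split=> [|N /andP[ntN nNG] sNM].
  rewrite MR_norm andbT; apply/trivgPn; exists (R (zh false 1%R)); first exact: R_mem (zh_mem _ _).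
  rewrite morph_injm_eq1 ?injm_R ?zh_mem //; apply/eqP=> z1.
  have /eqP := @zh_inj false 1%R 0%R (etrans z1 (esym (zh0 _))).
  by rewrite oner_eq0.
by apply/eqP; rewrite eqEsubset sNM MR_least // (subset_trans sNM MR_Gp).
Qed.

Lemma MR_unique (N : {group {perm vertex}}) : minimal_normal N Gp -> N = MR.
Proof.
case/andP=> sNG /mingroupP[/andP[ntN nNG] minN]; apply/val_inj/esym/minN.
  by have /andP[_ /mingroupP[]] := MR_minnormal.
exact: MR_least.
Qed.

(** * Direct factors of the translations and the diagonal PA type *)

Variables (n : nat) (Tf : 'I_n -> {group mT}) (comp : 'I_n -> mT -> mT).
Hypothesis n_gt1 : 1 < n.
Hypothesis M_dprod : \big[dprod/1]_(i < n) Tf i = M.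
Hypothesis Tf_simple : forall i, simple (Tf i).
Hypothesis Tf_nonabelian : forall i, ~~ abelian (Tf i).
Hypothesis Tf_isog : forall i j, Tf i \isog Tf j.
Hypothesis compM : forall i, {in M &, {morph comp i : f g / f * g}}.
Hypothesis comp_mem : forall i f, f \in M -> comp i f \in Tf i.
Hypothesis comp_split : forall i f, f \in M ->
  exists2 r, r \in <<\bigcup_(j | j != i) Tf j>> & f = comp i f * r.
Hypothesis comp_prod : forall f, f \in M -> f = \prod_(i < n) comp i f.
Hypothesis comp_zh : forall i b t, comp i (zh b t) = 1 -> t = 0%R.

Definition Tperm i : {group {perm vertex}} := (R @* Tf i)%G.

Lemma factor_sub i : Tf i \subset M.
Proof. by rewrite -(bigdprodWY M_dprod) sub_gen // (bigcup_max i). Qed.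

Lemma Tperm_dprod : \big[dprod/1]_(i < n) Tperm i = MR.
Proof.
exact: injm_bigdprod (subxx _) injm_R M_dprod.
Qed.

Lemma Tperm_TI i : Tperm i :&: other_factors Tperm i = 1.
Proof.
have := Tperm_dprod; rewrite (bigD1 i) //= => /dprodP[[K H defK defH] _ _ TI].
move: TI; rewrite defK defH -(bigdprodWY defH) -defK; exact.
Qed.

Lemma comp_in_M i f : f \in M -> comp i f \in M.
Proof. by move=> Mf; apply: (subsetP (factor_sub i)); apply: comp_mem. Qed.

Lemma factor_projE i f : f \in M -> factor_proj Tperm i (R f) = R (comp i f).
Proof.
move=> Mf; have [r Or Ef] := comp_split i Mf.
have sOM : <<\bigcup_(j | j != i) Tf j>> \subset M.
  by rewrite gen_subG; apply/bigcupsP=> j _; apply: factor_sub.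
have Mr := subsetP sOM r Or.
rewrite {1}Ef RM ?comp_in_M // /factor_proj divgrMid ?Tperm_TI //.
  by apply: mem_morphim; rewrite ?comp_in_M ?comp_mem.
have : R r \in R @* <<\bigcup_(j | j != i) Tf j>> by apply: mem_morphim.
rewrite morphim_gen; last by apply/bigcupsP=> j _; apply: factor_sub.
apply: subsetP; rewrite gen_subG; apply/subsetP=> _ /morphimP[k Mk /bigcupP[j ji Tk] ->].
by rewrite mem_gen //; apply/bigcupP; exists j => //; apply: mem_morphim.
Qed.

Lemma stab_MR b m : m \in M -> 'C_MR[vx b m | 'P] = R @* (Zg b :^ m).
Proof.
move=> Mm; have sZM : Zg b :^ m \subset M by rewrite -(conjGid Mm) conjSg Zg_sub.
apply/setP=> s; apply/setIP/morphimP => [[/morphimP[f _ Mf ->] /astab1P]|[f Mf Zf ->]].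
  rewrite /= /aperm RE // => /eqP; rewrite vx_eq ?(groupM Mm Mf) // eqxx /= => Z.
  by exists f => //; rewrite mem_conjg conjgE invgK mulgA.
split; first exact: R_mem.
move: Zf; rewrite mem_conjg conjgE invgK mulgA => Z.
by apply/astab1P; rewrite /= /aperm RE //; apply/eqP; rewrite vx_eq ?eqxx ?(groupM Mm Mf).
Qed.

Lemma Rcomp_morph i : {in M &, {morph (fun f => R (comp i f)) : f g / f * g}}.
Proof. by move=> f g Mf Mg; rewrite compM // RM ?comp_in_M. Qed.

Canonical Rcomp_morphism i := Morphism (@Rcomp_morph i).

Lemma Rcomp_inj b m i : m \in M ->
  {in Zg b :^ m &, injective (fun f => R (comp i f))}.
Proof.
move=> Mm; have sZM : Zg b :^ m \subset M by rewrite -(conjGid Mm) conjSg Zg_sub.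
suff /injmP injZ : 'injm (restrm sZM (Rcomp_morphism i)).
  by move=> f g Zf Zg'; apply: injZ.
apply/injmP=> f g Zf Zg' /(injmP injm_R) E.
have Mf := subsetP sZM f Zf; have Mg := subsetP sZM g Zg'.
have {}E : comp i f = comp i g by apply: E; rewrite comp_in_M.
apply/eqP; rewrite eq_mulgV1; apply/eqP.
have : f * g^-1 \in Zg b :^ m by rewrite groupM ?groupV.
have c1 : comp i 1 = 1 by apply: (mulgI (comp i 1)); rewrite -compM ?mulg1 ?group1.
have : comp i (f * g^-1) = 1.
  rewrite compM ?groupV // E -compM ?groupV // mulgV; exact: c1.
move: (f * g^-1) => h Eh; rewrite mem_conjg => /ZgP[t] /(canRL (conjgKV m)) defh.
have t0 : t = 0%R.
  apply: (@comp_zh i b); have := Eh.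
  rewrite defh /conjg !compM ?groupV ?groupM ?zh_mem // => E1.
  apply: (mulgI (comp i m^-1)); apply: (mulIg (comp i m)).
  rewrite -mulgA E1 mulg1 -compM ?groupV // mulVg; exact: esym c1.
by rewrite defh t0 zh0 conj1g.
Qed.

Lemma autG_diagonal_PA : diagonal_PA_type vadj autG.
Proof.
move=> a b ab Gs; have {Gs}-> : Gs = Gp by apply: Gstar_edge.
split; first exact: quasi_Gp.
exists MR; split; [exact: MR_minnormal | exact: MR_unique | exists n, Tperm].
split=> //.
- exact: Tperm_dprod.
- move=> i; split; first by rewrite (isog_simple (isog_symr (sub_isog (factor_sub i) injm_R))).
  by rewrite injm_abelian ?injm_R ?factor_sub.
- move=> i j; apply: isog_trans (isog_symr (sub_isog (factor_sub i) injm_R)) _.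
  exact: isog_trans (Tf_isog i j) (sub_isog (factor_sub j) injm_R).
move=> v; have [c [m [Mm ->]]] := vxP v; rewrite stab_MR //.
have sZM : Zg c :^ m \subset M by rewrite -(conjGid Mm) conjSg Zg_sub.
have Rinj i : 'injm (restrm sZM (Rcomp_morphism i)).
  by apply/injmP; apply: Rcomp_inj.
pose Ri i := (Rcomp_morphism i @* (Zg c :^ m))%G.
have Ri_iso i : Zg c :^ m \isog Ri i.
  have <- : restrm sZM (Rcomp_morphism i) @* (Zg c :^ m) = Ri i.
    by rewrite morphim_restrm setIid.
  exact: sub_isog.
exists Ri; split.
- move=> i; have ntR : Ri i :!=: 1.
    rewrite -(isog_eq1 (Ri_iso i)); apply/trivgPn; exists (zh c 1%R ^ m); first by rewrite memJ_conjg zh_in.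
    rewrite conjg_eq1; apply/eqP=> z1; have /eqP := @zh_inj c 1%R 0%R (etrans z1 (esym (zh0 _))).
    by rewrite oner_eq0.
  (* Properness: the projected stabilizer is an image of the additive group of F, hence abelian, and
     the factor is not. *)
  split=> //; rewrite properEneq; apply/andP; split.
    apply: contra (Tf_nonabelian i) => /eqP ERi.
    rewrite -(injm_abelian injm_R (factor_sub i)) -[R @* Tf i]ERi -(isog_abelian (Ri_iso i)) abelianJ.
    apply/centsP=> _ /ZgP[k ->] _ /ZgP[l ->]; by rewrite /commute -!zhD addrC.
  apply/subsetP=> _ /morphimP[f Mf Zf ->].
  by apply: mem_morphim; rewrite ?comp_in_M ?comp_mem.
- by move=> i j; apply: isog_trans (isog_symr (Ri_iso i)) (Ri_iso j).
- apply/subsetP=> _ /morphimP[f Mf Zf ->].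
  rewrite {1}(comp_prod Mf) morph_prod => [|i _]; last by rewrite comp_in_M.
  by apply: mem_prodg => i _; apply: (mem_morphim (Rcomp_morphism i)).
- move=> i; apply/setP=> s; apply/imsetP/morphimP => [[_ /morphimP[f Mf Zf ->] ->]|[f Mf Zf ->]].
    by exists f; rewrite // factor_projE.
  by exists (R f); rewrite ?factor_projE ?mem_morphim.
move=> i _ _ /morphimP[f Mf Zf ->] /morphimP[g Mg Zg' ->].
by rewrite !factor_projE // => /(Rcomp_inj Mm Zf Zg') ->.
Qed.

(** The premises say that [ptau true r g] squares to 1, the conclusion that it sends [vx false m] to
    its neighbour [vx true m]. *)
Hypothesis M_invol : forall r g, (r * r = 1)%R -> g \in M -> ac (al r g) * g = 1 ->
  exists2 m, m \in M & ac (al r m) * g = m.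

(** Flipping the second coordinate of a double cover is an automorphism of order two; it maps no
    vertex to a neighbour because the base graph has no loops. *)
Lemma not_double_cover : ~ is_standard_double_cover vadj.
Proof.
case=> V0 [e0 [[_ e0irr] [f [[h fK hK] fadj]]]].
pose s v := h ((f v).1, ~~ (f v).2).
have fs v : f (s v) = ((f v).1, ~~ (f v).2) by rewrite hK.
have sK : involutive s by move=> v; rewrite {1}/s fs /= negbK -surjective_pairing fK.
have s_adj u w : vadj (s u) (s w) = vadj u w.
  by rewrite -!fadj !fs /std_double_cover /= (inj_eq negb_inj).
have sN v : ~~ vadj v (s v).
  by rewrite -fadj fs /std_double_cover /= e0irr andbF.
(* By connectedness the side of a vertex and its second coordinate in the double cover agree up to a
   constant, so the flip exchanges the sides. *)
have side v : (val v).1 (+) (f v).2 = (val (vx false 1)).1 (+) (f (vx false 1)).2.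
  have /connectP[q] := vadj_connected (vx false 1) v.
  elim/last_ind: q v => [|q w IHq] v /=; first by move=> _ ->.
  rewrite rcons_path last_rcons => /andP[pq a] ->; rewrite -(IHq _ pq erefl).
  have := a; rewrite -fadj => /andP[n2 _]; case/andP: a => n1 _; move: n1 n2.
  by case: (_.1) (_.1) (_.2) (_.2) => [] [] [] [].
pose sp : {perm vertex} := perm (can_inj sK).
have As : sp \in autG.
  by rewrite inE; apply/forallP=> u; apply/forallP=> w; rewrite !permE s_adj.
have [e [r [g [r0 Mg defs]]]] := autGP As.
have Es v : s v = tau e r g v by rewrite -ptauE // -defs permE.
have e1 : e = true.
  have := side (s (vx false 1)); rewrite fs Es tau_vx // !val_vx ?act_mem //=.
  by case: (e) (f _).2 => [] [].
rewrite {e}e1 in defs Es.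
have : sp * sp = ptau false 1%R 1 by rewrite ptau1; apply/permP=> v; rewrite permM perm1 !permE.
rewrite defs ptauM // => /ptau_inj[]; rewrite ?mulf_neq0 ?oner_neq0 ?(act_mem true) // => _ r2 g1.
have [m Mm Em] := M_invol r2 Mg g1.
have /negP[] := sN (vx false m); rewrite Es tau_vx //= Em.
have := vadj_nbr false 0%R Mm; by rewrite /nbr dstep0 mul1g.
Qed.

Theorem coset_graph_theorem : exists (V : finType) (adj : rel V) (G : {group {perm V}}),
    [/\ simple_graph adj, connected_graph adj, bipartite_graph adj,
        regular_of_valency adj #|F| & group_of_automorphisms adj G] /\
    [/\ two_arc_transitive adj G, diagonal_PA_type adj G &
        ~ is_standard_double_cover adj].
Proof.
exists vertex, vadj, autG; split; split.
- by split; [exact: vadj_sym | exact: vadj_irr].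
- exact: vadj_connected.
- exact: vadj_bipartite.
- exact: vadj_valency.
- by move=> s As u w; apply: autG_adj.
- exact: autG_two_arc.
- exact: autG_diagonal_PA.
exact: not_double_cover.
Qed.

End CosetGraph.

(** * Powers of a simple group twisted by an involution *)

Section SimpleGroups.

Local Open Scope group_scope.

Lemma simple_TI_center (gT : finGroupType) (G : {group gT}) (g : gT) :
  simple G -> ~~ abelian G -> g \in G -> (forall h, h \in G -> g * h = h * g) -> g = 1.
Proof.
move=> /simpleP[_ simG] nabG Gg cg.
have [Z1|ZG] := simG 'Z(G)%G (center_normal G).
  have: g \in 'Z(G)%G by apply/centerP.
  by rewrite Z1 => /set1P.
by case/negP: nabG; rewrite -ZG; apply: center_abelian.
Qed.

Lemma simple_gen_class (gT : finGroupType) (G H : {group gT}) (g : gT) :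
  simple G -> g \in G -> g != 1 -> (forall h, h \in G -> g ^ h \in H) -> G \subset H.
Proof.
move=> /simpleP[_ simG] Gg ng Hg.
have [|C1|<-] := simG (<<g ^: G>>)%G.
- by rewrite /normal gen_subG class_subG //= norms_gen // class_norm.
- have : g \in <<g ^: G>>%G by rewrite mem_gen // class_refl.
  by rewrite C1 => /set1P/eqP; rewrite (negPf ng).
by rewrite gen_subG; apply/subsetP=> _ /imsetP[h Gh ->]; apply: Hg.
Qed.

End SimpleGroups.

Section Twisted.

Local Open Scope group_scope.

Variables (F : finFieldType) (gT : finGroupType) (T : {group gT}).
Variables (xp : F -> gT) (c th : gT -> gT) (pos : pred F).
Hypothesis F_nat : forall i : F, exists n, i = n%:R%R.
Hypothesis pos0 : ~~ pos 0%R.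
Hypothesis posN : forall k, k != 0%R -> pos (- k)%R = ~~ pos k.
Hypothesis pos_gt1 : 1 < #|pos|.
Hypothesis T_simple : simple T.
Hypothesis T_nonabelian : ~~ abelian T.
Hypothesis xp_mem : forall i, xp i \in T.
Hypothesis xpD : forall i j, xp (i + j)%R = xp i * xp j.
Hypothesis cM : {morph c : f g / f * g}.
Hypothesis cK : involutive c.
Hypothesis c_mem : forall f, f \in T -> c f \in T.
Hypothesis thM : {morph th : f g / f * g}.
Hypothesis thK : involutive th.
Hypothesis th_mem : forall f, f \in T -> th f \in T.
Hypothesis c_th : forall f, c (th f) = th (c f).
Hypothesis th_xp : forall t, th (xp t) = xp (- t)%R.
Hypothesis xp_TI : forall i j, c (xp i) = xp j -> i = 0%R.
Hypothesis T_gen : T \subset <<[set xp i | i : F] :|: [set c (xp i) | i : F]>>.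
Let zT b i := zh xp c b i.
Let dT b i := dstep xp c b i.
Hypothesis T_hexagon : forall b i j,
  dT (~~ b) j * (dT b i * (dT (~~ b) j * (dT b i * (dT (~~ b) j * dT b i)))) = 1.
Hypothesis T_hexagon_uniq : forall i1 i2 i3 i4 i5 i6 t,
  i1 != i2 -> i2 != i3 -> i3 != i4 ->
  dT true i6 * (dT false i5 * (dT true i4 * (dT false i3 *
     (dT true i2 * dT false i1)))) = xp t -> i1 = i3.
(** Passing from one coordinate to another scales all exponents, so such a word makes the two
    coordinates independent. For r = -1 there is none: [th] maps a word to the one with negated
    exponents. *)
Hypothesis T_sep : forall r, r != 0%R -> r != 1%R -> r != (-1)%R ->
  exists2 w : seq (bool * F),
    \prod_(q <- w) zT q.1 q.2 = 1 & \prod_(q <- w) zT q.1 (r * q.2)%R != 1.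
Hypothesis th_outer : forall h, h \in T -> ~ (forall u, u \in T -> th u = u ^ h).
Hypothesis T_coboundary : forall t, t \in T -> c t * t = 1 ->
  exists2 m, m \in T & c m * t = m.
Hypothesis T_coboundary_th : forall t, t \in T -> c (th t) * t = 1 ->
  exists2 m, m \in T & c (th m) * t = m.

Lemma negN (k : F) : k != 0%R -> (k == - k)%R = false.
Proof.
move=> k0; apply/negP=> /eqP E; have := posN k0; rewrite -E.
by case: (pos k).
Qed.

Lemma c1 : c 1 = 1.
Proof. by apply: (mulgI (c 1)); rewrite -cM !mulg1. Qed.

Lemma th1 : th 1 = 1.
Proof. by apply: (mulgI (th 1)); rewrite -thM !mulg1. Qed.

Notation mT := {dffun forall _ : F, gT}.

Definition tw_fun (f : mT) :=
  (f 0%R == 1) && [forall k, (f k \in T) && (f (- k)%R == th (f k))].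

Fact tw_set : group_set [set f : mT | tw_fun f].
Proof.
apply/group_setP; split=> [|f g].
  rewrite inE /tw_fun oneg_ffun eqxx; apply/forallP=> k.
  by rewrite !oneg_ffun group1 th1 eqxx.
rewrite !inE => /andP[/eqP f0 /forallP Hf] /andP[/eqP g0 /forallP Hg].
rewrite /tw_fun mulg_ffun f0 g0 mulg1 eqxx; apply/forallP=> k.
have /andP[fk /eqP fN] := Hf k; have /andP[gk /eqP gN] := Hg k.
by rewrite !mulg_ffun fN gN thM eqxx groupM.
Qed.

Definition M : {group mT} := Group tw_set.

Lemma MP (f : mT) : reflect [/\ f 0%R = 1, forall k, f k \in T & forall k, f (- k)%R = th (f k)]
  (f \in M).
Proof.
rewrite inE; apply: (iffP andP) => [[/eqP f0 /forallP H]|[f0 fT fN]].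
  by split=> // k; have /andP[? /eqP] := H k.
by rewrite f0; split=> //; apply/forallP=> k; rewrite fT fN eqxx.
Qed.

Definition xh (t : F) : mT := [ffun k => xp (t * k)%R].
Definition ac (f : mT) : mT := [ffun k => c (f k)].
Definition al (r : F) (f : mT) : mT := [ffun k => f (r * k)%R].
Definition delta (k : F) (t : gT) : mT :=
  [ffun j => if j == k then t else if j == (- k)%R then th t else 1].

Lemma xp0 : xp 0%R = 1.
Proof. by apply: (mulgI (xp 0%R)); rewrite -xpD addr0 mulg1. Qed.

Lemma zTE b i k : zh xh ac b i k = zT b (i * k)%R.
Proof. by case: b; rewrite /zT /= !ffunE. Qed.

Lemma dTE b i k : dstep xh ac b i k = dT b (i * k)%R.
Proof. by rewrite /dT !dstepE mulg_ffun !zTE mulNr. Qed.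

Lemma acM : {morph ac : f g / f * g}.
Proof. by move=> f g; apply/ffunP=> k; rewrite !ffunE cM. Qed.

Lemma ac_mem f : f \in M -> ac f \in M.
Proof.
case/MP=> f0 fT fN; apply/MP; split=> [|k|k]; rewrite !ffunE ?f0 ?c1 //.
  exact: c_mem.
by rewrite fN c_th.
Qed.

Lemma alM r : {morph al r : f g / f * g}.
Proof. by move=> f g; apply/ffunP=> k; rewrite !ffunE. Qed.

Lemma al_mem r f : f \in M -> al r f \in M.
Proof.
case/MP=> f0 fT fN; apply/MP; split=> [|k|k]; rewrite !ffunE ?mulr0 //.
by rewrite mulrN fN.
Qed.

Lemma xh_mem t : xh t \in M.
Proof. by apply/MP; split=> [|k|k]; rewrite !ffunE ?mulr0 ?xp0 // mulrN th_xp. Qed.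

Lemma delta_mem k t : k != 0%R -> t \in T -> delta k t \in M.
Proof.
move=> k0 Tt; apply/MP; split=> [|j|j]; rewrite !ffunE.
- by rewrite eq_sym (negPf k0) eq_sym oppr_eq0 (negPf k0).
- by case: ifP => // _; case: ifP => // _; apply: th_mem.
rewrite (inj_eq oppr_inj) eqr_oppLR.
case: (eqVneq j k) => [->|_]; first by rewrite negN.
by case: ifP; rewrite ?thK ?th1.
Qed.

Lemma deltaM k : {morph delta k : t u / t * u}.
Proof.
move=> t u; apply/ffunP=> j; rewrite !ffunE.
by case: ifP => // _; case: ifP => // _; rewrite ?thM ?mulg1.
Qed.

Canonical delta_morphism k := @Morphism _ _ setT _ (in2W (@deltaM k)).

Lemma injm_delta k : 'injm (delta k).
Proof.
apply/subsetP=> t /morphpreP[_ /set1P /ffunP/(_ k)].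
by rewrite !ffunE eqxx => ->; apply: set11.
Qed.

Lemma deltaE k f j : f \in M ->
  delta k (f k) j = if (j == k) || (j == - k)%R then f j else 1.
Proof.
case/MP=> _ _ fN; rewrite ffunE; case: eqP => [->//|_].
by case: eqP => [->|//]; rewrite fN.
Qed.

Lemma delta_commg k f t : k != 0%R -> f \in M -> [~ f, delta k t] = delta k [~ f k, t].
Proof.
move=> k0 Mf; have [_ _ fN] := MP _ Mf; apply/ffunP=> j.
rewrite /commg /conjg !(mulg_ffun, invg_ffun) !ffunE.
case: eqP => [->//|_]; case: eqP => [->|_]; last by rewrite invg1 mul1g mulg1 mulVg.
rewrite fN; have thV u : th u^-1 = (th u)^-1.
  by apply: (mulgI (th u)); rewrite -thM !mulgV th1.
by rewrite !thM !thV.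
Qed.

Lemma delta_conj k f t : k != 0%R -> f \in M -> delta k t ^ f = delta k (t ^ f k).
Proof.
move=> k0 Mf; have [_ _ fN] := MP _ Mf; apply/ffunP=> j.
rewrite /conjg !(mulg_ffun, invg_ffun) !ffunE.
case: eqP => [->//|_]; case: eqP => [->|_]; last by rewrite mul1g mulVg.
rewrite fN; have thV u : th u^-1 = (th u)^-1.
  by apply: (mulgI (th u)); rewrite -thM !mulgV th1.
by rewrite !thM !thV.
Qed.

Notation n := #|pos|.
(** [pos] contains one of k and -k for k <> 0, so the values at the [lab i] are free and determine
    an element of M. *)
Definition lab (i : 'I_n) : F := enum_val i.
Definition Tf (i : 'I_n) : {group mT} := (delta (lab i) @* T)%G.
Definition comp (i : 'I_n) (f : mT) : mT := delta (lab i) (f (lab i)).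
Definition near i k := (k == lab i) || (k == - lab i)%R.

Lemma lab0 i : lab i != 0%R.
Proof. by apply: contraNneq pos0 => <-; apply: (enum_valP i). Qed.

Lemma lab_near k : k != 0%R -> exists i, near i k.
Proof.
move=> k0; case pk : (pos k).
  by exists (enum_rank_in pk k); rewrite /near /lab enum_rankK_in // eqxx.
have pNk : pos (- k)%R by rewrite posN ?pk.
by exists (enum_rank_in pNk (- k)%R); rewrite /near /lab enum_rankK_in // opprK eqxx orbT.
Qed.

Lemma lab_near_inj i j k : near i k -> near j k -> i = j.
Proof.
have pl l : pos (lab l) by apply: (enum_valP l).
have pNl l : ~~ pos (- lab l)%R by rewrite posN ?lab0 ?pl.
case/orP=> /eqP-> /orP[] /eqP.
- exact: enum_val_inj.
- by move=> E; have := pl i; rewrite E (negPf (pNl j)).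
- by move=> E; have := pl j; rewrite -E (negPf (pNl i)).
by move/oppr_inj/enum_val_inj.
Qed.

Lemma compE i f k : f \in M -> comp i f k = if near i k then f k else 1.
Proof. exact: deltaE. Qed.

Lemma comp_mem i f : f \in M -> comp i f \in Tf i.
Proof. by case/MP=> _ fT _; apply: mem_morphim; rewrite ?inE. Qed.

Lemma Tf_sub i : Tf i \subset M.
Proof. by apply/subsetP=> _ /morphimP[t _ Tt ->]; apply: delta_mem; rewrite ?lab0. Qed.

Lemma comp_split i f : f \in M ->
  exists2 r, r \in <<\bigcup_(j | j != i) Tf j>> & f = comp i f * r.
Proof.
move=> Mf; exists (\prod_(j | j != i) comp j f).
  apply: group_prod => j ji; apply: mem_gen; apply/bigcupP; exists j => //.
  exact: comp_mem.
apply/ffunP=> k; rewrite mulg_ffun prodg_ffun compE //.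
case: ifP => [ik|nik].
  rewrite big1 ?mulg1 // => j ji; rewrite compE //; case: ifP => // jk.
  by rewrite (lab_near_inj jk ik) eqxx in ji.
have [k0|k0] := eqVneq k 0%R.
  rewrite k0 big1 ?mulg1; first by case/MP: Mf.
  by move=> j _; rewrite compE //; case/MP: Mf => -> _ _; case: ifP.
have [j jk] := lab_near k0; rewrite (big_only1 j) => [||l lj _]; rewrite ?compE ?jk ?mul1g //.
  by apply: contraFneq nik => <-.
by case: ifP => // lk; rewrite (lab_near_inj lk jk) eqxx in lj.
Qed.

Lemma comp_prod f : f \in M -> f = \prod_(i < n) comp i f.
Proof.
move=> Mf; apply/ffunP=> k; rewrite prodg_ffun.
have [k0|k0] := eqVneq k 0%R.
  rewrite k0 big1; first by case/MP: Mf.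
  by move=> j _; rewrite compE //; case/MP: Mf => -> _ _; case: ifP.
have [j jk] := lab_near k0; rewrite (big_only1 j) => [||l lj _]; rewrite ?compE ?jk ?mul1g //.
by case: ifP => // lk; rewrite (lab_near_inj lk jk) eqxx in lj.
Qed.

Fact off_set k : group_set [set f : mT | f k == 1].
Proof.
apply/group_setP; split=> [|f g /[!inE] /eqP fk /eqP gk]; first by rewrite inE oneg_ffun.
by rewrite mulg_ffun fk gk mulg1.
Qed.
Definition off k := Group (off_set k).

Lemma M_dprod : \big[dprod/1]_(i < n) Tf i = M.
Proof.
have -> : M :=: (\prod_(i < n) Tf i)%G.
  apply/eqP; rewrite bigprodGE eqEsubset gen_subG; apply/andP; split; last first.
    by apply/bigcupsP=> i _; apply: Tf_sub.
  apply/subsetP=> f Mf; rewrite (comp_prod Mf); apply: group_prod => i _.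
  by apply: mem_gen; apply/bigcupP; exists i => //; apply: comp_mem.
apply/eqP/bigdprodYP=> i _; rewrite bigprodGE /=.
apply/subsetP=> f Hf.
have off1 k : near i k -> f k = 1.
  move=> ik; suff : f \in off k by rewrite inE => /eqP.
  apply: (subsetP _ f Hf); rewrite gen_subG; apply/bigcupsP=> j ji.
  apply/subsetP=> _ /morphimP[t _ Tt ->]; rewrite inE ffunE.
  case: ifP => [kj|nkj].
    by rewrite (@lab_near_inj j i k) ?eqxx // /near kj in ji.
  by case: ifP => // kj; rewrite (@lab_near_inj j i k) ?eqxx // /near kj orbT in ji.
rewrite inE; apply/andP; split.
  apply/negP=> /setD1P[nf /morphimP[t _ Tt Ef]]; case/eqP: nf.
  have := off1 (lab i); rewrite /near eqxx => /(_ isT).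
  by rewrite Ef ffunE eqxx => ->; rewrite (morph1 (delta_morphism _)).
apply/centP=> _ /morphimP[t _ Tt ->]; apply/ffunP=> k; rewrite !mulg_ffun.
have [ik|nik] := boolP (near i k); first by rewrite off1 // mulg1 mul1g.
rewrite -[mfun _ _]/(delta (lab i) t) [delta _ _ _]ffunE; move: nik; rewrite /near; do 2!case: ifP => //=.
by rewrite mulg1 mul1g.
Qed.

(** Elements normalizing H take every value of T at k, so H contains all T-conjugates of one
    nontrivial t in this factor, and these generate the simple group T. *)
Lemma delta_full (H : {group mT}) (k : F) :  k != 0%R ->
  (forall h, h \in T -> exists2 f, f \in M & f \in 'N(H) /\ f k = h) ->
  (exists2 t, t \in T & t != 1 /\ delta k t \in H) -> delta k @* T \subset H.
Proof.
move=> k0 nH [t Tt [nt Ht]].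
rewrite sub_morphim_pre ?subsetT //; apply: (simple_gen_class T_simple Tt nt) => h Th.
apply/morphpreP; split; first by rewrite inE.
have [f Mf [nf <-]] := nH h Th.
by rewrite -[mfun _ _]/(delta k (t ^ f k)) -delta_conj // memJ_norm.
Qed.

(** A multiplication moves a nontrivial value to the coordinate [lab i]; the commutator with an
    element supported there is a nontrivial element of N inside the i-th factor. *)
Lemma M_min (N : {group mT}) : N \subset M -> N :!=: 1 -> M \subset 'N(N) ->
  (forall (r : F) f, r != 0%R -> f \in N -> al r f \in N) -> N = M.
Proof.
move=> sNM /trivgPn[f Nf nf] nN alN; apply/val_inj/eqP; rewrite /= eqEsubset sNM.
have Mf := subsetP sNM f Nf.
have [k0 fk0] : exists k, f k != 1.
  apply/existsP; rewrite -negb_forall; apply: contra nf => /forallP f1.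
  by apply/eqP/ffunP=> k; rewrite oneg_ffun; apply/eqP.
have k00 : k0 != 0%R by apply: contraNneq fk0 => ->; case/MP: Mf => ->.
have sT i : Tf i \subset N.
  apply: delta_full (lab0 i) _ _ => [h Th|].
    exists (delta (lab i) h); first by rewrite delta_mem ?lab0.
    by rewrite (subsetP nN) ?delta_mem ?lab0 // ffunE eqxx.
  pose h := al (k0 / lab i)%R f.
  have Nh : h \in N by rewrite alN // mulf_neq0 // invr_eq0 lab0.
  have Mh := subsetP sNM h Nh; have [_ hT _] := MP _ Mh.
  have hk : h (lab i) != 1 by rewrite ffunE divfK ?lab0.
  have [u Tu nu] : exists2 u, u \in T & [~ h (lab i), u] != 1.
    apply/exists_inP; apply: contraNT hk => /exists_inPn H.
    apply/eqP/(simple_TI_center T_simple T_nonabelian (hT _)) => u Tu.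
    by apply/commgP; move: (H u Tu); rewrite negbK.
  exists [~ h (lab i), u]; first by rewrite groupR.
  split=> //; rewrite -delta_commg ?lab0 //.
  by rewrite groupM ?groupV // memJ_norm // (subsetP nN) // delta_mem ?lab0.
apply/subsetP=> g Mg; rewrite (comp_prod Mg) group_prod // => i _.
by apply: (subsetP (sT i)); apply: comp_mem.
Qed.

(** For t = 1 the values of g are central. For t = -1, evaluation at 1 would make [th] inner. For
    any other t, an f supported on t and -t is trivial at 1, and the equation there forces f(t) =
    1. *)
Lemma M_cent t g : t != 0%R -> g \in M ->
  (forall f, f \in M -> al t f * g = g * f) -> t = 1%R /\ g = 1.
Proof.
move=> t0 Mg cg; have [g0 gT_ _] := MP _ Mg.
have cgk f k : f \in M -> f (t * k)%R * g k = g k * f k.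
  by move=> Mf; have /ffunP/(_ k) := cg f Mf; rewrite !mulg_ffun ffunE.
have [t1|nt1] := eqVneq t 1%R.
  split=> //; apply/ffunP=> k; rewrite oneg_ffun; have [->//|k0] := eqVneq k 0%R.
  apply: (simple_TI_center T_simple T_nonabelian (gT_ k)) => u Tu.
  by have := cgk _ k (delta_mem k0 Tu); rewrite t1 mul1r ffunE eqxx => ->.
have [u Tu nu] := trivgPn _ (proj1 (simpleP _ T_simple)).
have [tN1|ntN1] := eqVneq t (-1)%R.
  case: (@th_outer (g 1%R)^-1); first by rewrite groupV.
  move=> v Tv; have := cgk _ 1%R (delta_mem (oner_neq0 F) Tv).
  rewrite mulr1 tN1 !ffunE !eqxx eq_sym negN ?oner_neq0 // /conjg invgK mulgA => <-.
  by rewrite mulgK.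
case/eqP: nu; have := cgk _ 1%R (delta_mem t0 Tu).
rewrite mulr1 !ffunE eqxx eq_sym (negPf nt1) -eqr_oppLR eq_sym (negPf ntN1).
by rewrite mulg1 => /(canRL (mulgK _)); rewrite mulgV.
Qed.

(** Here r is 1 or -1, so the equation splits into coordinates, each for [c] or for [c] composed
    with [th]. It is solved on [pos] and the solution is extended by [th]. *)
Lemma M_invol r g : (r * r = 1)%R -> g \in M -> ac (al r g) * g = 1 ->
  exists2 m, m \in M & ac (al r m) * g = m.
Proof.
move=> r2 Mg g1; have [g0 gT_ gN] := MP _ Mg.
have rpm : r = 1%R \/ r = (-1)%R.
  have /eqP := r2; rewrite -[X in (_ == X) -> _](expr1n _ 2) -expr2 eqf_sqr.
  by case/orP=> /eqP; auto.
pose phi u := if r == 1%R then c u else c (th u).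
have phi_th u : phi (th u) = th (phi u) by rewrite /phi; case: ifP => _; rewrite ?c_th // -?c_th thK.
have phiE f k : f \in M -> c (f (r * k)%R) = phi (f k).
  case/MP=> _ _ fN; rewrite /phi; case: rpm => ->; first by rewrite eqxx mul1r.
  by rewrite mulN1r fN eq_sym negN ?oner_neq0.
pose wit k := odflt 1 [pick m in T | phi m * g k == m].
have witP k : wit k \in T /\ phi (wit k) * g k = wit k.
  rewrite /wit; case: pickP => [m /andP[Tm /eqP //]|] /=.
  have := congr1 (fun f : mT => f k) g1; rewrite mulg_ffun oneg_ffun !ffunE phiE // /phi.
  by case: ifP => _ E; [have [m Tm Em] := T_coboundary (gT_ k) E |
     have [m Tm Em] := T_coboundary_th (gT_ k) E] => /(_ m); rewrite Tm Em eqxx.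
pose m : mT := [ffun k => if k == 0%R then 1 else if pos k then wit k else th (wit (- k)%R)].
have Mm : m \in M.
  apply/MP; split=> [|k|k]; rewrite !ffunE ?eqxx //.
    case: ifP => // _; case: ifP => _; first by case: (witP k).
    by apply: th_mem; case: (witP (- k)%R).
  rewrite oppr_eq0; case: eqVneq => [_|k0]; first by rewrite th1.
  by rewrite posN // opprK; case: (pos k) => //=; rewrite thK.
exists m => //; apply/ffunP=> k; rewrite mulg_ffun !ffunE.
have -> : c (if (r * k)%R == 0%R then 1 else
      if pos (r * k)%R then wit (r * k)%R else th (wit (- (r * k))%R)) = phi (m k).
  by rewrite -phiE // ffunE.
rewrite ffunE; case: eqVneq => [->|k0].
  by rewrite g0 mulg1 /phi; case: ifP; rewrite ?th1 c1.
case: ifP => _; first by case: (witP k).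
have [_ {2}<-] := witP (- k)%R.
by rewrite phi_th thM gN thK.
Qed.

Lemma comp_zh i b t : comp i (zh xh ac b t) = 1 -> t = 0%R.
Proof.
move/(congr1 (fun f : mT => f (lab i))); rewrite /= ffunE eqxx zTE oneg_ffun => E.
have : (t * lab i)%R = 0%R.
  by apply: (@xp_TI _ 0%R); rewrite xp0; case: b E; rewrite /zT /= => // ->; rewrite c1.
by move/eqP; rewrite mulf_eq0 (negPf (lab0 i)) orbF => /eqP.
Qed.

(** * Generation of the twisted power *)

Definition Dg : {group mT} :=
  <<[set zh xh ac false i | i : F] :|: [set zh xh ac true i | i : F]>>%G.

Lemma zh_Dg b i : zh xh ac b i \in Dg.
Proof. by apply: mem_gen; rewrite inE; case: b; rewrite imset_f ?orbT. Qed.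

Lemma Dg_sub : Dg \subset M.
Proof.
rewrite gen_subG subUset; apply/andP; split; apply/subsetP=> _ /imsetP[i _ ->].
  exact: xh_mem.
exact: ac_mem (xh_mem _).
Qed.

Lemma Dg_proj k t : k != 0%R -> t \in T -> exists2 f, f \in Dg & f k = t.
Proof.
move=> k0 /(subsetP T_gen)/gen_prodgP[m [h Sh ->]].
elim: m h Sh => [|m IHm] h Sh; first by exists 1; rewrite ?oneg_ffun ?big_ord0.
have [f Df fk] := IHm (fun i => h (lift ord0 i)) (fun i => Sh _).
suff [g Dg_ gk] : exists2 g, g \in Dg & g k = h ord0.
  by exists (g * f); rewrite ?groupM // mulg_ffun big_ord_recl gk fk.
case/setUP: (Sh ord0) => /imsetP[i _ ->]; [exists (zh xh ac false (i / k)%R)|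
  exists (zh xh ac true (i / k)%R)]; by rewrite ?zh_Dg // zTE divfK.
Qed.

(** For l <> 0, take a separating word for the ratio k/l and divide its exponents by l: it becomes
    trivial at l and nontrivial at k. *)
Lemma Dg_sep k l : k != 0%R -> l != k -> l != (- k)%R ->
  exists2 h, h \in Dg & h l = 1 /\ h k != 1.
Proof.
move=> k0 lk lNk; have [->|l0] := eqVneq l 0%R.
  have [u Tu nu] := trivgPn _ (proj1 (simpleP _ T_simple)).
  have [f Df fk] := Dg_proj k0 Tu; exists f; rewrite // fk.
  by have [-> _ _] := MP _ (subsetP Dg_sub f Df).
have [|||w w1 wr] := @T_sep (k / l)%R.
- by rewrite mulf_neq0 ?invr_eq0.
- by apply: contra lk => /eqP/divr1_eq ->.
- by apply: contra lNk => /eqP/(canRL (mulfVK l0)) ->; rewrite mulN1r opprK.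
exists (\prod_(q <- w) zh xh ac q.1 (q.2 / l)%R); first by rewrite group_prod // => q _; apply: zh_Dg.
rewrite !prodg_ffun; split.
  by rewrite -[RHS]w1; apply: eq_bigr => q _; rewrite zTE divfK.
suff -> : \prod_(q <- w) zh xh ac q.1 (q.2 / l)%R k = \prod_(q <- w) zT q.1 (k / l * q.2)%R by [].
by apply: eq_bigr => q _; rewrite zTE mulrAC [(k / l * _)%R]mulrC mulrA mulrAC.
Qed.

(** The commutator of f with a conjugate of h is trivial wherever f or h is, so coordinates are
    removed one by one. Some conjugate keeps the value at k nontrivial: conjugates of h(k) generate
    T, and f(k) is not central. *)
Lemma Dg_single k (s : seq F) : k != 0%R -> {in s, forall l, (l != k) && (l != - k)%R} ->
  exists2 f, f \in Dg & f k != 1 /\ {in s, forall l, f l = 1}.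
Proof.
move=> k0; elim: s => [|l s IHs] Hs.
  have [u Tu nu] := trivgPn _ (proj1 (simpleP _ T_simple)).
  by have [f Df fk] := Dg_proj k0 Tu; exists f; rewrite // fk.
have [|f Df [nfk fs]] := IHs; first by move=> j sj; rewrite Hs // inE sj orbT.
have /andP[lk lNk] := Hs l (mem_head _ _).
have [h Dh [hl nhk]] := Dg_sep k0 lk lNk.
have Tk g : g \in Dg -> g k \in T by move=> /(subsetP Dg_sub)/MP[].
have [u Tu nu] : exists2 u, u \in T & [~ f k, h k ^ u] != 1.
  apply/exists_inP; apply: contraNT nfk => /exists_inPn H.
  apply/eqP/(simple_TI_center T_simple T_nonabelian (Tk _ Df)) => v Tv.
  have /subsetP/(_ v Tv) : T \subset 'C[f k].
    apply: (simple_gen_class T_simple (Tk _ Dh) nhk) => w Tw; apply/cent1P.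
    by apply: commute_sym; apply/commgP; move: (H w Tw); rewrite negbK.
  by move/cent1P/commute_sym.
have [d Dd du] := Dg_proj k0 Tu.
have FE j : [~ f, h ^ d] j = [~ f j, h j ^ d j].
  by rewrite /commg /conjg !(mulg_ffun, invg_ffun).
exists [~ f, h ^ d]; first by rewrite groupR ?groupJ.
split=> [|j]; first by rewrite FE du.
rewrite inE => /predU1P[->|sj]; rewrite FE; first by rewrite hl conj1g commg1.
by rewrite fs // comm1g.
Qed.

Lemma M_gen : M \subset Dg.
Proof.
suff sT i : Tf i \subset Dg.
  apply/subsetP=> g Mg; rewrite (comp_prod Mg) group_prod // => i _.
  by apply: (subsetP (sT i)); apply: comp_mem.
apply: delta_full (lab0 i) _ _ => [h Th|].
  have [f Df fk] := Dg_proj (lab0 i) Th; exists f; first exact: (subsetP Dg_sub).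
  by rewrite fk (subsetP (normG _)).
have [|f Df [nf f1]] := @Dg_single (lab i) [seq l <- enum F | (l != lab i) && (l != - lab i)%R] (lab0 i).
  by move=> l; rewrite mem_filter => /andP[].
have Mf := subsetP Dg_sub f Df; have [_ fT _] := MP _ Mf.
exists (f (lab i)) => //; split=> //; suff -> : delta (lab i) (f (lab i)) = f by [].
apply/ffunP=> k; rewrite deltaE //; case: ifP => // /norP nk.
by rewrite f1 // mem_filter mem_enum andbT; apply/andP.
Qed.

Theorem twisted_graph_theorem : exists (V : finType) (adj : rel V) (G : {group {perm V}}),
    [/\ simple_graph adj, connected_graph adj, bipartite_graph adj,
        regular_of_valency adj #|F| & group_of_automorphisms adj G] /\
    [/\ two_arc_transitive adj G, diagonal_PA_type adj G &
        ~ is_standard_double_cover adj].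
Proof.
have sT (f g : mT) k : f = g -> f k = g k by move->.
apply: (@coset_graph_theorem F _ M xh ac al _ _ _ _ _ _ _ _ _ _ _ _ _ _ _ _ _ _ n Tf comp).
- exact: F_nat.
- exact: xh_mem.
- by move=> i j; apply/ffunP=> k; rewrite !ffunE mulrDl xpD.
- exact: acM.
- by move=> f; apply/ffunP=> k; rewrite !ffunE cK.
- exact: ac_mem.
- exact: alM.
- by move=> r s f; apply/ffunP=> k; rewrite !ffunE mulrA [(s * r)%R]mulrC.
- by move=> f; apply/ffunP=> k; rewrite !ffunE mul1r.
- exact: al_mem.
- by move=> r f; apply/ffunP=> k; rewrite !ffunE.
- by move=> r t; apply/ffunP=> k; rewrite !ffunE mulrA [(t * r)%R]mulrC.
- by move=> i j /(sT _ _ 1%R); rewrite !zTE !mulr1 => /xp_TI.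
- exact: M_gen.
- exact: M_min.
- by move=> b i j; apply/ffunP=> k; rewrite !mulg_ffun !dTE oneg_ffun; apply: T_hexagon.
- move=> i1 i2 i3 i4 i5 i6 t n12 n23 n34 /(sT _ _ 1%R).
  rewrite !mulg_ffun !dTE zTE !mulr1; exact: T_hexagon_uniq.
- exact: M_cent.
- exact: pos_gt1.
- exact: M_dprod.
- by move=> i; rewrite -(isog_simple (sub_isog (subsetT _) (injm_delta _))).
- by move=> i; rewrite injm_abelian ?injm_delta ?subsetT.
- move=> i j; apply: isog_trans (isog_symr (sub_isog (subsetT _) (injm_delta _))) _.
  exact: sub_isog (subsetT _) (injm_delta _).
- move=> i f g _ _; rewrite /comp mulg_ffun; exact: deltaM.
- exact: comp_mem.
- exact: comp_split.
- exact: comp_prod.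
- exact: comp_zh.
exact: M_invol.
Qed.

End Twisted.

(** * Special linear groups *)

Section SpecialLinear.

Local Open Scope ring_scope.

Variables (K : finFieldType) (n : nat).
Local Notation GL := {unit 'M[K]_n.+1}.
Implicit Types (A B : 'M[K]_n.+1) (u v : GL) (H : {group GL}).

Fact SL_set : group_set [set u : GL | \det (val u) == 1].
Proof.
apply/group_setP; split=> [|u v /[!inE] /eqP du /eqP dv]; first by rewrite inE det1.
by rewrite det_mulmx du dv mulr1.
Qed.

Definition SL : {group GL} := Group SL_set.

Lemma SLP u : reflect (\det (val u) = 1) (u \in SL).
Proof. by rewrite inE; apply: eqP. Qed.

(** Membership in a group of units as a predicate on all matrices, so that computations stay in the
    matrix ring. *)
Definition mxin H A := [exists u in H, val u == A].

Lemma mxinP H A : reflect (exists2 u, u \in H & val u = A) (mxin H A).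
Proof.
by apply: (iffP exists_inP) => -[u Hu /eqP Eu]; exists u => //; rewrite Eu.
Qed.

Lemma mxin_val H u : mxin H (val u) = (u \in H).
Proof.
apply/mxinP/idP => [[v Hv /val_inj <-] //|Hu]; by exists u.
Qed.

Lemma mxin1 H : mxin H 1.
Proof. by rewrite -[1]/(val (1%g : GL)) mxin_val group1. Qed.

Lemma mxinM H A B : mxin H A -> mxin H B -> mxin H (A * B).
Proof.
move=> /mxinP[u Hu <-] /mxinP[v Hv <-].
by rewrite -[_ * _]/(val (u * v)%g) mxin_val groupM.
Qed.

Lemma mxinV H A B : mxin H A -> A * B = 1 -> mxin H B.
Proof.
move=> /mxinP[u Hu <-] uB.
have -> : B = val (u^-1)%g by rewrite -[LHS](mulKr (valP u)) uB mulr1.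
by rewrite mxin_val groupV.
Qed.

Lemma mxin_div H A B C : mxin H A -> mxin H B -> A = C * B -> mxin H C.
Proof.
move=> HA HB AE; have uB : B \is a GRing.unit by case/mxinP: HB => u _ <-; apply: valP.
by rewrite -[C](mulrK uB) -AE mxinM // (mxinV HB) // mulrV.
Qed.

Lemma mxin_unit H A : mxin H A -> A \is a GRing.unit.
Proof. by case/mxinP=> u _ <-; apply: valP. Qed.

Lemma mxin_SL A : mxin SL A = (\det A == 1).
Proof.
apply/mxinP/eqP => [[u /SLP du <-] //|dA].
have uA : A \is a GRing.unit by rewrite -[_ \is a _]/(_ \in unitmx) unitmxE dA unitr1.
by exists (FinRing.unit _ uA) => //; apply/SLP.
Qed.

Lemma mxin_sub H H' A : H \subset H' -> mxin H A -> mxin H' A.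
Proof. by move=> sHH' /mxinP[u /(subsetP sHH') H'u <-]; rewrite mxin_val. Qed.

Lemma sub_SL H : (forall A, \det A = 1 -> mxin H A) -> SL \subset H.
Proof. by move=> HA; apply/subsetP=> u /SLP/HA; rewrite mxin_val. Qed.

Lemma el_mul i j (l : K) A a b :
  ((1 + l *: delta_mx i j) * A) a b = A a b + (a == i)%:R * (l * A j b).
Proof.
rewrite mulrDl mul1r mxE; congr (_ + _).
rewrite -scalerAl mxE mxE (bigD1 j) //= big1 => [|k kj]; rewrite mxE.
  by rewrite eqxx andbT addr0 mulrCA.
by rewrite (negPf kj) andbF mul0r.
Qed.

Lemma det_el i j (l : K) : i != j -> \det (1 + l *: delta_mx i j : 'M[K]_n.+1) = 1.
Proof.
move=> nij; wlog lt_ji : i j nij / (j < i)%N => [IH|].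
  have [/IH-> //|le_ij] := ltnP j i.
  rewrite -det_tr linearD /= linearZ /= trmx_delta -[1]/1%:M tr_scalar_mx.
  by apply: IH; rewrite 1?eq_sym // ltn_neqAle le_ij andbT.
rewrite det_trig => [|]; last first.
  apply/is_trig_mxP=> a b ab; rewrite !mxE -val_eqE (ltn_eqF ab) add0r.
  case: eqP => [ai|]; last by rewrite mulr0.
  case: eqP => [bj|]; last by rewrite mulr0.
  by move: ab; rewrite ai bj ltnNge ltnW.
rewrite big1 // => a _; rewrite !mxE eqxx.
case: eqP => [ai|]; last by rewrite mulr0 addr0.
by rewrite ai (negPf nij) mulr0 addr0.
Qed.

Lemma mxin_col H (k : 'I_n.+1) (m : 'I_n.+1 -> K) (s : seq 'I_n.+1) : k \notin s ->
  (forall i, i != k -> mxin H (1 + m i *: delta_mx i k)) ->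
  mxin H (1 + \sum_(i <- s) m i *: delta_mx i k).
Proof.
move=> ks Hm; elim: s ks => [|i s IHs]; first by rewrite big_nil addr0 mxin1.
rewrite inE negb_or => /andP[ki ks]; rewrite big_cons.
have <- : (1 + m i *: delta_mx i k) * (1 + \sum_(j <- s) m j *: delta_mx j k)
    = 1 + (m i *: delta_mx i k + \sum_(j <- s) m j *: delta_mx j k) :> 'M[K]_n.+1.
  rewrite mulrDr mulr1 mulrDl mul1r -addrA; congr (_ + (_ + _)).
  rewrite -[RHS]addr0; congr (_ + _).
  rewrite big_distrr big1_seq //= => j sj.
  rewrite -scalerAl -scalerAr -[_ * _]/(_ *m _) mul_delta_mx_0 ?scaler0 //.
  by apply: contraNneq ks => ->.
by rewrite mxinM ?IHs // Hm // eq_sym.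
Qed.

(* Gaussian elimination, one column at a time. *)
Lemma SL_gen H : (forall i j l, i != j -> mxin H (1 + l *: delta_mx i j)) -> SL \subset H.
Proof.
move=> H0; wlog sHS : H H0 / H \subset SL => [IH|].
  suff : SL \subset (H :&: SL)%G by rewrite subsetI => /andP[].
  apply: IH (subsetIr _ _) => i j l nij; have /mxinP[u Hu Eu] := H0 i j l nij.
  by apply/mxinP; exists u; rewrite // inE Hu; apply/SLP; rewrite Eu det_el.
pose id_on k A := forall i j : 'I_n.+1, (j < k)%N -> A i j = (i == j)%:R.
have dH A : mxin H A -> \det A = 1 by move/(mxin_sub sHS); rewrite mxin_SL => /eqP.
have step k A : (k < n)%N -> \det A = 1 -> id_on k A ->
    exists2 h, mxin H h & id_on k.+1 (h * A).
  move=> kn dA idA; pose k0 : 'I_n.+1 := Ordinal (leqW kn).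
  have fin B : B k0 k0 = 1 -> id_on k B -> exists2 h, mxin H h & id_on k.+1 (h * B).
    move=> B1 idB; pose m i := - B i k0.
    pose C : 'M[K]_n.+1 := \sum_(i <- [seq i <- enum 'I_n.+1 | i != k0]) m i *: delta_mx i k0.
    exists (1 + C).
      by apply: mxin_col => [|i ik]; [rewrite mem_filter eqxx | apply: H0].
    have CE a b : C a b = (a != k0)%:R * (b == k0)%:R * m a.
      rewrite /C summxE big_filter big_enum_cond /=.
      have [->|ak] := eqVneq a k0.
        by rewrite mul0r mul0r big1 // => i ik; rewrite !mxE eq_sym (negPf ik) mulr0.
      rewrite mul1r (bigD1 a) //= big1 => [|i /andP[_ ia]]; rewrite !mxE.
        by rewrite eqxx addr0 mulrC.
      by rewrite eq_sym (negPf ia) mulr0.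
    have E a b : ((1 + C) * B) a b = B a b - (a != k0)%:R * (B a k0 * B k0 b).
      rewrite mulrDl mul1r mxE; congr (_ + _); rewrite mxE (bigD1 k0) //= big1 => [|j jk].
        by rewrite addr0 CE eqxx mulr1 /m mulrN mulNr mulrA.
      by rewrite CE (negPf jk) mulr0 !mul0r.
    move=> a b; rewrite E ltnS leq_eqVlt => /orP[/eqP bk|bk].
      have -> : b = k0 by apply: val_inj.
      rewrite B1 mulr1; case: (eqVneq a k0) => [->|_]; first by rewrite B1 mul0r subr0.
      by rewrite mul1r subrr.
    rewrite [B a b]idB // [B k0 b]idB // -[k0 == b]val_eqE /= gtn_eqF //.
    by rewrite !mulr0 subr0.
  have mid B (i : 'I_n.+1) : (k < i)%N -> B i k0 != 0 -> id_on k B ->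
      exists2 h, mxin H h & id_on k.+1 (h * B).
    move=> ki Bi idB; pose l := (1 - B k0 k0) / B i k0.
    have nki : k0 != i by rewrite -val_eqE /= ltn_eqF.
    have [||h Hh idh] := fin ((1 + l *: delta_mx k0 i) * B).
    - by rewrite el_mul eqxx mul1r divfK // addrC subrK.
    - move=> a b bk; rewrite el_mul [B a b]idB // [B i b]idB // -[i == b]val_eqE /=.
      by rewrite gtn_eqF ?(ltn_trans bk) // !mulr0 addr0.
    by exists (h * (1 + l *: delta_mx k0 i)); rewrite -?mulrA // mxinM // H0.
  have [/existsP[i /andP[ki Ai]]|/existsPn A0] := boolP [exists i : 'I_n.+1, (k < i)%N && (A i k0 != 0)].
    exact: mid ki Ai idA.
  pose k1 : 'I_n.+1 := Ordinal (kn : (k.+1 < n.+1)%N).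
  have Ak : A k0 k0 != 0.
    (* If the column vanished from row k on, w would be a nonzero vector killed by A. *)
    apply/eqP=> Ak0; pose w : 'cV[K]_n.+1 := \col_i (if (i < k)%N then - A i k0 else (i == k0)%:R).
    have Aw : A *m w = 0.
      apply/matrixP=> i j; rewrite !mxE (bigD1 k0) //= !mxE ltnn eqxx mulr1.
      have [ik|ki] := ltnP i k.
        rewrite (bigD1 i) /=; last by rewrite -val_eqE /= neq_ltn ik.
        rewrite !mxE ik [A i i]idA // eqxx mul1r big1 ?addr0 ?addrN // => j' /andP[j'k j'i].
        rewrite !mxE; case: ifP => [j'lt|_]; last by rewrite (negPf j'k) mulr0.
        by rewrite [A i j']idA // eq_sym (negPf j'i) mul0r.
      have -> : A i k0 = 0.
        move: ki; rewrite leq_eqVlt => /orP[/eqP ki|ki]; last first.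
          by apply/eqP; move: (A0 i); rewrite ki /= negbK.
        by rewrite -[RHS]Ak0; congr (A _ _); apply: val_inj.
      rewrite big1 ?addr0 // => j' j'k; rewrite !mxE; case: ifP => [j'lt|_].
        rewrite [A i j']idA // -[i == j']val_eqE /= gtn_eqF ?mul0r //.
        exact: leq_trans j'lt ki.
      by rewrite (negPf j'k) mulr0.
    have uA : A \in unitmx by rewrite unitmxE dA unitr1.
    have /matrixP/(_ k0 0) : w = 0 by rewrite -(mulKmx uA w) Aw mulmx0.
    by rewrite !mxE ltnn eqxx => /eqP; rewrite oner_eq0.
  have k1k : (k0 == k1) = false by rewrite -val_eqE /= ltn_eqF.
  (* With zeros below a nonzero pivot, adding row k to the next row leads back to the case [mid]. *)
  have [|||h Hh idh] := mid ((1 + 1 *: delta_mx k1 k0) * A) k1.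
  - by [].
  - rewrite el_mul eqxx !mul1r; have := A0 k1; rewrite /= ltnSn /= negbK => /eqP ->.
    by rewrite add0r.
  - move=> a b bk; rewrite el_mul [A a b]idA // [A k0 b]idA // -[k0 == b]val_eqE /=.
    by rewrite gtn_eqF // !mulr0 addr0.
  by exists (h * (1 + 1 *: delta_mx k1 k0)); rewrite -?mulrA // mxinM // H0 // eq_sym k1k.
have all k A : (k <= n)%N -> \det A = 1 -> exists2 h, mxin H h & id_on k (h * A).
  elim: k => [|k IHk] kn dA; first by exists 1; rewrite ?mxin1.
  have [h Hh idh] := IHk (ltnW kn) dA.
  have [|h' Hh' idh'] := step k (h * A) kn _ idh.
    by rewrite det_mulmx (dH h Hh) mul1r.
  by exists (h' * h); rewrite -?mulrA // mxinM.
apply: sub_SL => A dA; have [h Hh idh] := all n A (leqnn n) dA.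
have uh := mxin_unit Hh; pose B := h * A.
have dB : \det B = 1 by rewrite det_mulmx (dH h Hh) mul1r.
have EA : A = h^-1 * B by rewrite mulKr.
rewrite -/B in idh; clearbody B; rewrite EA.
have lt_max (j : 'I_n.+1) : j != ord_max -> (j < n)%N.
  by move=> jm; rewrite ltn_neqAle -ltnS ltn_ord andbT.
(* The other columns are those of 1, so this entry is the determinant. *)
have Bnn : B ord_max ord_max = 1.
  rewrite -dB -det_tr det_trig => [|]; last first.
    apply/is_trig_mxP=> a b ab; rewrite mxE idh.
      by rewrite -val_eqE /= gtn_eqF.
    by apply: leq_trans ab _; rewrite -ltnS.
  rewrite (bigD1 ord_max) //= big1 ?mulr1 => [|i im]; first by rewrite mxE.
  by rewrite mxE idh ?eqxx ?lt_max.
apply: mxinM; first by apply: mxinV Hh _; rewrite mulrV.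
suff -> : B = 1 + \sum_(i <- [seq i <- enum 'I_n.+1 | i != ord_max]) B i ord_max *: delta_mx i ord_max.
  by apply: mxin_col => [|i im]; [rewrite mem_filter eqxx | apply: H0].
apply/matrixP=> i j; rewrite mxE summxE big_filter big_enum_cond /=.
have [->|jm] := eqVneq j ord_max.
  have [->|im] := eqVneq i ord_max.
    rewrite Bnn big1 ?addr0 => [|k km]; rewrite !mxE ?eqxx //.
    by rewrite eq_sym (negPf km) mulr0.
  rewrite (bigD1 i) //= big1 => [|k /andP[_ ki]]; rewrite !mxE ?(negPf im) ?eqxx ?mulr1 ?addr0 ?add0r //.
  by rewrite eq_sym (negPf ki) mulr0.
rewrite big1 ?addr0 => [|k km]; rewrite !mxE ?(negPf jm) ?andbF ?mulr0 //.
by rewrite idh ?lt_max.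
Qed.

Lemma mxinJ H H' A B C : H \subset 'N(H')%g -> mxin H' A -> mxin H B -> B * C = 1 ->
  mxin H' (B * A * C).
Proof.
move=> nHH' /mxinP[u Hu <-] /mxinP[v Hv <-] vC.
have -> : C = val (v^-1)%g by rewrite -[LHS](mulKr (valP v)) vC mulr1.
have -> : val v * val u * val (v^-1)%g = val (u ^ v^-1)%g by rewrite conjgE invgK mulgA.
by rewrite mxin_val memJ_norm // groupV (subsetP nHH').
Qed.

(** * Transvections and the simplicity of SL *)

Implicit Types (f h : 'cV[K]_n.+1) (x y : 'rV[K]_n.+1).

Definition tv f x : 'M[K]_n.+1 := 1 + f *m x.

Lemma tvM f x h y : tv f x * tv h y = 1 + f *m x + h *m y + f *m (x *m h) *m y.
Proof.
rewrite /tv mulrDr mulr1 mulrDl mul1r addrA; congr (_ + _).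
by rewrite -[_ * _]/(_ *m _) !mulmxA.
Qed.

Lemma tvD f x y : x *m f = 0 -> tv f x * tv f y = tv f (x + y).
Proof. by move=> xf; rewrite tvM xf mulmx0 mul0mx addr0 /tv mulmxDr addrA. Qed.

Lemma tvNr f x : x *m f = 0 -> tv f x * tv f (- x) = 1.
Proof. by move=> xf; rewrite tvD // subrr /tv mulmx0 addr0. Qed.

Lemma tv_comm f x h y : x *m f = 0 -> y *m h = 0 -> y *m f = 0 ->
  tv f x * tv h y * tv f (- x) * tv h (- y) = tv f (x *m h *m y).
Proof.
move=> xf yh yf; have -> : tv f x * tv h y = tv f (x *m h *m y) * (tv h y * tv f x).
  rewrite [tv h y * _]tvM yf mulmx0 mul0mx addr0 tvM mulmxA.
  rewrite [tv f (x *m h *m y)]/tv mulrDl mul1r [1 + f *m x + _]addrAC.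
  congr (_ + _); rewrite !mulrDr mulr1 -![f *m _ * _]/(_ *m _) !mulmxA.
  by rewrite -(mulmxA _ y h) -(mulmxA _ y f) yh yf !mulmx0 !mul0mx !addr0.
by rewrite -!mulrA [tv f x * _]mulrA tvNr // mul1r tvNr // mulr1.
Qed.

(** The matrix Z has two factorizations into block triangular matrices; their determinants are
    compared. *)
Lemma det_tv f x : x *m f = 0 -> \det (tv f x) = 1.
Proof.
move=> xf; pose Z : 'M[K]_(n.+1 + 1) := block_mx 1%:M (- f) x 1%:M.
have Z1 : Z = block_mx 1%:M 0 x 1%:M *m block_mx 1%:M (- f) 0 1%:M.
  rewrite mulmx_block !mulmx0 !mul1mx !mul0mx !mulmx1 !addr0 mulmxN xf oppr0 add0r.
  by [].
have Z2 : Z = block_mx 1%:M (- f) 0 1%:M *m block_mx (tv f x) 0 x 1%:M.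
  by rewrite mulmx_block !mul0mx !mulmx1 !mul1mx !add0r mulNmx addrK.
have : \det Z = 1 by rewrite Z1 det_mulmx det_lblock det_ublock !det1 !mulr1.
by rewrite Z2 det_mulmx det_ublock det_lblock !det1 !mul1r mulr1.
Qed.

Lemma tv_SL f x : x *m f = 0 -> mxin SL (tv f x).
Proof. by move=> xf; rewrite mxin_SL det_tv. Qed.

Lemma row_sep x y : ~~ (x <= y)%MS -> exists2 f, x *m f = 1 & y *m f = 0.
Proof.
rewrite submxE; move: (cokermx y) (mulmx_coker y) => C yC /eqP/matrixP nz.
have [j nzj] : exists j, (x *m C) 0 j != 0.
  apply/existsP; rewrite -negb_forall; apply/forallP=> H; apply: nz => i j.
  by rewrite ord1 [RHS]mxE; apply/eqP; apply: H.
exists (((x *m C) 0 j)^-1 *: col j C); rewrite -scalemxAr colE mulmxA; last first.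
  by rewrite yC mul0mx scaler0.
rewrite -[X in _ *: X]colE; apply/matrixP=> a b; rewrite !ord1 [LHS]mxE [X in _ * X]mxE.
by rewrite mulVf // mxE eqxx.
Qed.

Lemma col_sep f h : ~~ (f^T <= h^T)%MS -> exists2 x, x *m f = 1 & x *m h = 0.
Proof.
case/row_sep=> y yf yh; exists y^T; apply: trmx_inj; rewrite trmx_mul trmxK.
  by rewrite yf trmx1.
by rewrite yh trmx0.
Qed.

Lemma row_sub_sym x y : x != 0 -> (x <= y)%MS -> (y <= x)%MS.
Proof.
move=> x0 /sub_rVP[a xa]; move: x0; rewrite xa scaler_eq0 negb_or => /andP[a0 _].
by apply/sub_rVP; exists a^-1; rewrite scalerA mulVf ?scale1r.
Qed.

Lemma row_ker_nonsub f x : (1 < n)%N ->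
  exists2 y : 'rV_n.+1, y *m f = 0 & ~~ (y <= x)%MS.
Proof.
move=> n1; have /row_subPn[i Hi] : ~~ (kermx f <= x)%MS.
  apply/negP=> /mxrankS; rewrite mxrank_ker => /leq_trans/(_ (rank_leq_row x)).
  rewrite leq_subLR => /leq_trans/(_ (leq_add (rank_leq_col f) (leqnn 1))).
  by rewrite ltnS leqNgt n1.
by exists (row i (kermx f)); rewrite // -row_mul mulmx_ker row0.
Qed.

Lemma row_ker2 f h : (1 < n)%N ->
  exists2 y : 'rV_n.+1, y != 0 & y *m f = 0 /\ y *m h = 0.
Proof.
move=> n1; have /rowV0Pn[y] : kermx (row_mx f h) != 0.
  rewrite -mxrank_eq0 mxrank_ker subn_eq0 -ltnNge.
  by rewrite ltnS (leq_trans (rank_leq_col _)).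
move=> /sub_kermxP; rewrite mul_mx_row => yfh nz; exists y => //.
by split; [have := congr1 lsubmx yfh | have := congr1 rsubmx yfh]; rewrite ?row_mxKl ?row_mxKr ?linear0.
Qed.

Section Normal.

Variable N : {group GL}.
Hypotheses (n_gt1 : (1 < n)%N) (sNS : N \subset SL) (nNS : SL \subset 'N(N)%g).

Lemma mxin_comm A A' B B' : mxin N A -> A * A' = 1 -> mxin SL B -> B * B' = 1 ->
  mxin N (A * B * A' * B').
Proof.
move=> NA AA SB BB; rewrite -!mulrA; apply: mxinM => //; rewrite mulrA.
by apply: mxinJ SB BB => //; apply: mxinV AA.
Qed.

(** If z is not a multiple of w, take h with z h = 1 and w h = 0: the commutator of [tv f z] and
    [tv h w] is [tv f w]. Proportional rows are joined through a third one, the kernel of f having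
    dimension at least 2. *)
Lemma tvN_row f x y : x != 0 -> x *m f = 0 -> y *m f = 0 -> mxin N (tv f x) -> mxin N (tv f y).
Proof.
have indep z w : ~~ (z <= w)%MS -> z *m f = 0 -> w *m f = 0 -> mxin N (tv f z) -> mxin N (tv f w).
  move=> zw zf wf Nz; have [h zh wh] := row_sep zw.
  have /(mxin_comm Nz (tvNr zf)) := tv_SL wh.
  by move/(_ _ (tvNr wh)); rewrite tv_comm // zh mul1mx.
move=> x0 xf yf Nx; have [xy|] := boolP (x <= y)%MS; last by move/indep; apply.
have [w wf wx] := row_ker_nonsub f x n_gt1.
have Nw : mxin N (tv f w).
  by apply: indep Nx => //; apply: contra wx; apply: row_sub_sym.
apply: indep Nw => //; apply: contra wx => /submx_trans; apply.
exact: row_sub_sym xy.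
Qed.

(** Dual to [tvN_row]; the commutator is now [tv w (- x)], the inverse of what is wanted. *)
Lemma tvN_col f h x : f != 0 -> x *m f = 0 -> x *m h = 0 -> mxin N (tv f x) -> mxin N (tv h x).
Proof.
have indep z w : ~~ (z^T <= w^T)%MS -> x *m z = 0 -> x *m w = 0 ->
    mxin N (tv z x) -> mxin N (tv w x).
  move=> zw xz xw Nz; have [y yz yw] := col_sep zw.
  have /(mxin_comm Nz (tvNr xz)) := tv_SL yw.
  move/(_ _ (tvNr yw)) => Nc.
  have xNw : - x *m w = 0 by rewrite mulNmx xw oppr0.
  suff Nx : mxin N (tv w (- x)) by have := mxinV Nx (tvNr xNw); rewrite opprK.
  congr (mxin N _): Nc.
  have -> : tv z x * tv w y = tv w (- x) * (tv w y * tv z x).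
    rewrite [tv w y * _]tvM yz mulmx1 tvM xw mulmx0 mul0mx addr0 [tv w (- x)]/tv mulrDl mul1r.
    rewrite !mulrDr mulr1 -![w *m - x * _]/(_ *m _) !mulmxA -(mulmxA w (- x) w).
    rewrite -(mulmxA w (- x) z) !mulNmx xw xz oppr0 !mulmx0 !mul0mx !addr0 mulmxN addrK.
    by rewrite addrAC.
  by rewrite -!mulrA [tv z x * _]mulrA tvNr // mul1r tvNr // mulr1.
move=> f0 xf xh Nf; have [fh|] := boolP (f^T <= h^T)%MS; last by move/indep; apply.
have [y yx yf] := row_ker_nonsub x^T f^T n_gt1.
have xy : x *m y^T = 0 by apply: trmx_inj; rewrite trmx_mul trmxK yx trmx0.
have f0' : f^T != 0 by rewrite -trmx0 (inj_eq (@trmx_inj _ _ _)).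
have Nw : mxin N (tv y^T x).
  by apply: indep Nf => //; apply: contra yf; rewrite trmxK; apply: row_sub_sym.
apply: indep Nw => //; rewrite trmxK; apply: contra yf => /submx_trans; apply.
exact: row_sub_sym fh.
Qed.

(** A row y killing both f and e_i is the bridge to an elementary matrix: change x to y, then f to
    e_i, then y to l e_j. *)
Lemma tvN_SL f x : f != 0 -> x != 0 -> x *m f = 0 -> mxin N (tv f x) -> SL \subset N.
Proof.
move=> f0 x0 xf Nx; apply: SL_gen => i j l nij.
have [y y0 [yf yi]] := row_ker2 f (delta_mx i 0) n_gt1.
have ij0 : (l *: delta_mx 0 j : 'rV_n.+1) *m (delta_mx i 0 : 'cV_n.+1) = 0.
  by rewrite -scalemxAl mul_delta_mx_0 ?scaler0 // eq_sym.
have := tvN_row y0 yi ij0 (tvN_col f0 yf yi (tvN_row x0 xf yf Nx)).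
by rewrite /tv -scalemxAr mul_delta_mx.
Qed.

(* The commutator h of A and a transvection moves every row within a plane, hence
   fixes some linear form p; commuting h with transvections along p either gives a
   transvection or shows that h itself is one. *)
Lemma normal_SL A B f x : mxin N A -> A * B = 1 -> x *m f = 0 -> f != 0 ->
  B * (1 - f *m x) * A * (1 + f *m x) != 1 -> SL \subset N.
Proof.
move=> NA AB xf f0; set h := _ * (1 + f *m x) => nh.
have BA : B * A = 1 by apply: (mulrI (mxin_unit NA)); rewrite mulrA AB mul1r mulr1.
have tNt : tv f (- x) * tv f x = 1.
  by have := @tvNr f (- x); rewrite opprK mulNmx xf oppr0; apply.
have tE : 1 - f *m x = tv f (- x) by rewrite /tv mulmxN.
have Nh : mxin N h.
  rewrite /h -/(tv f x) tE -!mulrA; apply: mxinM; first exact: mxinV AB.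
  rewrite mulrA; apply: mxinJ nNS NA _ tNt; apply: tv_SL.
  by rewrite mulNmx xf oppr0.
have [k k0 [kx kxA]] := row_ker2 x^T (x *m A)^T n_gt1.
pose p := k^T; have p0 : p != 0 by rewrite -trmx0 (inj_eq (@trmx_inj _ _ _)).
have xp : x *m p = 0 by apply: trmx_inj; rewrite trmx_mul trmxK kx trmx0.
have xAp : x *m A *m p = 0 by apply: trmx_inj; rewrite trmx_mul trmxK kxA trmx0.
have hp : h *m p = p.
  have fp : (1 + f *m x) *m p = p by rewrite mulmxDl mul1mx -mulmxA xp mulmx0 addr0.
  have fAp : (1 - f *m x) *m (A *m p) = A *m p.
    by rewrite mulmxBl mul1mx -mulmxA (mulmxA x) xAp mulmx0 subr0.
  by rewrite -!mulmxA fp fAp mulmxA -[B *m A]/(B * A) BA mul1mx.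
move: h nh Nh hp => h nh Nh hp.
have [g hg] : exists g, h * g = 1 by exists h^-1; rewrite mulrV // (mxin_unit Nh).
have gh : g * h = 1 by apply: (mulrI (mxin_unit Nh)); rewrite mulrA hg mul1r mulr1.
have gp : g *m p = p by rewrite -[in LHS]hp mulmxA -[g *m h]/(g * h) gh mul1mx.
have [/existsP[i]|/existsPn Hker] := boolP [exists i, row i (kermx p) *m h != row i (kermx p)].
  set w := row i _ => nw; have wp : w *m p = 0 by rewrite -row_mul mulmx_ker row0.
  apply: (@tvN_SL p (w *m h - w)); rewrite ?subr_eq0 //; last first.
    have wNp : - w *m p = 0 by rewrite mulNmx wp oppr0.
    have tNt' : tv p (- w) * tv p w = 1 by have := tvNr wNp; rewrite opprK.
    have E : g * tv p w * h = tv p (w *m h).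
      rewrite /tv mulrDr mulr1 mulrDl gh; congr (_ + _).
      by rewrite -[g * _ * h]/(g *m (p *m w) *m h) mulmxA gp mulmxA.
    have -> : tv p (w *m h - w) = (tv p (- w) * g * tv p w) * h.
      by rewrite -!mulrA [g * _]mulrA E tvD // addrC.
    by apply: mxinM; [apply: mxinJ nNS (mxinV Nh hg) _ tNt'; apply: tv_SL | apply: Nh].
  by rewrite mulmxBl wp subr0 -mulmxA hp wp.
have [w wp1 _] : exists2 w : 'rV_n.+1, w *m p = 1 & w *m (0 : 'cV_n.+1) = 0.
  apply: col_sep; apply: contra p0 => /submxP[D /(congr1 trmx)].
  by rewrite trmx0 mulmx0 trmxK trmx0 => ->.
have hE (y : 'rV_n.+1) : y *m h = y + y *m p *m (w *m h - w).
  have yk : ((y - y *m p *m w) <= kermx p)%MS.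
    by apply/sub_kermxP; rewrite mulmxBl -(mulmxA _ w p) wp1 mulmx1 subrr.
  have kh : kermx p *m h = kermx p.
    by apply/row_matrixP=> i; rewrite row_mul; apply/eqP; rewrite -[_ == _]negbK Hker.
  have {yk} : (y - y *m p *m w) *m h = y - y *m p *m w.
    by have /submxP[D ->] := yk; rewrite -mulmxA kh.
  by rewrite mulmxBl mulmxBr => /(canRL (subrK _)) ->; rewrite mulmxA -addrA [- _ + _]addrC.
have hT : h = tv p (w *m h - w).
  apply/row_matrixP=> i; rewrite /tv linearD /= !rowE hE -(mulmxA _ p).
  by rewrite mulmx1.
apply: (@tvN_SL p (w *m h - w)) => //; last by rewrite -hT.
  by apply: contra nh => /eqP h0; rewrite hT h0 /tv mulmx0 addr0.
by rewrite mulmxBl -mulmxA hp subrr.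
Qed.

End Normal.

Lemma el_neq1 i j : i != j -> 1 + 1 *: delta_mx i j != 1 :> 'M[K]_n.+1.
Proof.
move=> nij; apply/eqP=> /matrixP/(_ i j); rewrite !mxE !eqxx (negPf nij) mulr1 add0r.
by move/eqP; rewrite oner_eq0.
Qed.

Lemma comm_el_scalar A : (forall i j, i != j -> A * (1 + 1 *: delta_mx i j) = (1 + 1 *: delta_mx i j) * A) ->
  A = (A 0 0)%:M.
Proof.
move=> cA; have cE i j : i != j -> A *m delta_mx i j = delta_mx i j *m A.
  by move/cA; rewrite mulrDr mulrDl mulr1 mul1r !scale1r => /addrI.
have E i j a b : i != j -> A a i * (b == j)%:R = (a == i)%:R * A j b.
  move/cE/matrixP/(_ a b).
  have -> : (A *m delta_mx i j) a b = A a i * (b == j)%:R.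
    rewrite mxE (bigD1 i) //= big1 => [|k ki]; rewrite mxE ?eqxx ?addr0 //.
    by rewrite (negPf ki) mulr0.
  have -> : (delta_mx i j *m A) a b = (a == i)%:R * A j b.
    rewrite mxE (bigD1 j) //= big1 => [|k ki]; rewrite mxE ?eqxx ?addr0 ?andbT //.
    by rewrite (negPf ki) andbF mul0r.
  by [].
have diag i j : i != j -> A i i = A j j.
  by move=> nij; have := E i j i j nij; rewrite !eqxx mulr1 mul1r.
have off i j : i != j -> A i j = 0.
  move=> nij; have := E j i i i; rewrite eq_sym nij => /(_ isT).
  by rewrite eqxx mulr1 (negPf nij) mul0r.
apply/matrixP=> i j; rewrite !mxE; have [<-|nij] := eqVneq i j; last by rewrite off.
by have [->//|n0] := eqVneq i 0; rewrite (diag _ _ n0).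
Qed.

Theorem SL_simple : (1 < n)%N -> (forall l : K, l ^+ n.+1 = 1 -> l = 1) -> simple SL.
Proof.
move=> n1 Kn; have n10 : (ord_max : 'I_n.+1) != 0 by rewrite -val_eqE /= -lt0n ltnW.
apply/simpleP; split.
  have /mxinP[u Su Eu] : mxin SL (1 + 1 *: delta_mx ord_max 0) by rewrite mxin_SL det_el.
  apply/trivgPn; exists u => //; apply: contraNneq (el_neq1 n10) => u1.
  by rewrite -Eu u1.
move=> N /andP[sNS nNS]; have [->|/trivgPn[u Nu nu]] := eqVneq (N : {set GL}) 1%g; first by left.
right; apply/eqP; rewrite eqEsubset sNS /=.
have [/existsP[i /existsP[j /andP[nij nc]]]|H] := boolP [exists i, exists j : 'I_n.+1,
  (i != j) && (val u * (1 + 1 *: delta_mx i j) != (1 + 1 *: delta_mx i j) * val u)].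
  apply: (@normal_SL N n1 nNS (val u) (val u)^-1 (delta_mx i 0) (delta_mx 0 j)).
  - by rewrite mxin_val.
  - by rewrite mulrV ?(valP u).
  - by rewrite mul_delta_mx_0 // eq_sym.
  - by apply/eqP=> /matrixP/(_ i 0); rewrite !mxE !eqxx; apply/eqP; rewrite oner_eq0.
  rewrite mul_delta_mx -[delta_mx i j]scale1r; apply: contra nc => /eqP E.
  have tt : (1 - 1 *: delta_mx i j) * (1 + 1 *: delta_mx i j) = 1 :> 'M[K]_n.+1.
    rewrite mulrDr mulr1 mulrBl mul1r !scale1r -[_ * _]/(_ *m _) mul_delta_mx_0 1?eq_sym //.
    by rewrite subr0 subrK.
  have E2 : (val u)^-1 * ((1 - 1 *: delta_mx i j) * (val u * (1 + 1 *: delta_mx i j))) = 1.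
    by rewrite !mulrA.
  have {E2} := congr1 (fun B => (1 + 1 *: delta_mx i j) * (val u * B)) E2.
  rewrite mulr1 => <-; rewrite !mulrA mulrK ?(valP u) //.
  have -> : (1 + 1 *: delta_mx i j) * (1 - 1 *: delta_mx i j) = 1 :> 'M[K]_n.+1.
    rewrite mulrBr mulr1 mulrDl mul1r !scale1r -[delta_mx i j * _]/(_ *m _).
    by rewrite mul_delta_mx_0 1?eq_sym // addr0 addrK.
  by rewrite mul1r.
have uA : val u = (val u 0 0)%:M.
  apply: comm_el_scalar => i j nij; apply/eqP; apply: contraNT H => nc.
  by apply/existsP; exists i; apply/existsP; exists j; rewrite nij.
case/eqP: nu; apply: val_inj; rewrite uA /=.
have /SLP := subsetP sNS u Nu; rewrite uA det_scalar => /Kn ->.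
by [].
Qed.

End SpecialLinear.

(** * Hilbert 90 and symmetric forms over the field with nine elements *)

Section Forms.

Local Open Scope ring_scope.

Variables (K : finFieldType) (sg : {rmorphism K -> K}) (io : K).
Hypothesis K3 : 3%:R = 0 :> K.
Hypothesis sgK : involutive sg.
Hypothesis io2 : io * io = -1.
Hypothesis sg_io : sg io = - io.
Hypothesis K8 : forall x : K, x != 0 -> x ^+ 8 = 1.
Hypothesis sg_fix : forall x : K, sg x = x -> [|| x == 0, x == 1 | x == -1].

Lemma double_neg (V : lmodType K) (x : V) : x + x = - x.
Proof.
apply/eqP; rewrite -addr_eq0; apply/eqP.
by rewrite -[x]scale1r -!scalerDl -addrA -[1 + (1 + 1)]/(3%:R) K3 scale0r.
Qed.

Lemma double_eq0 (V : lmodType K) (x : V) : x + x = 0 -> x = 0.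
Proof. by rewrite double_neg => /eqP; rewrite oppr_eq0 => /eqP. Qed.

Lemma io_neq0 : io != 0.
Proof.
apply: contraTneq (oner_neq0 K) => i0; move: io2.
by rewrite i0 mul0r => /esym/eqP; rewrite oppr_eq0 => ->.
Qed.

Section Hilbert.

Variable n : nat.
Local Notation sgm := (map_mx sg).

(* Every [y + sgm y *m t] is fixed by [k |-> sgm k *m t], and these rows span. *)
Lemma hilbert90 (t : 'M[K]_n.+1) : sgm t *m t = 1%:M ->
  exists2 k, k \in unitmx & sgm k *m t = k.
Proof.
move=> tt; pose Y : 'M[K]_(#|'rV[K]_n.+1|, n.+1) := \matrix_i enum_val i.
pose W := Y + sgm Y *m t.
have C0 : cokermx W = 0.
  have WC := mulmx_coker W; move: (cokermx W) WC => C WC.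
  have yC (y : 'rV_n.+1) : y *m C + sgm y *m (t *m C) = 0.
    have := congr1 (row (enum_rank y)) WC.
    by rewrite row0 row_mul /W linearD /= row_mul -map_row rowK enum_rankK mulmxDl mulmxA.
  apply/row_matrixP=> i; rewrite row0 rowE.
  (* For io e_i the second term changes sign relative to e_i, because [sg] negates io; the two
     identities together give twice e_i C = 0. *)
  have := yC (io *: delta_mx 0 i); rewrite map_mxZ sg_io -!scalemxAl scaleNr -scalerBr.
  move/eqP; rewrite scaler_eq0 (negPf io_neq0) subr_eq0 => /eqP yE.
  by apply: double_eq0; rewrite {2}yE yC.
have full : row_full W by rewrite -sub1mx submxE C0 mulmx0.
(* A basis chosen among the rows of W; every row is fixed, hence so is this matrix. *)
exists (rowsub (fullrankfun full) W); first exact: fullrowsub_unit.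
have WE : sgm W *m t = W.
  rewrite /W map_mxD map_mxM mulmxDl -mulmxA tt mulmx1 addrC; congr (_ + _).
  by rewrite -map_mx_comp map_mx_id // => x; rewrite /= sgK.
move: (fullrankfun full) WE; clear; move: W => W f WE; apply/matrixP=> i j.
by rewrite [RHS]mxE -[in RHS]WE !mxE; apply: eq_bigr => k _; rewrite !mxE.
Qed.

(** The determinant of k is fixed by [sg], hence 1 or -1, and in odd dimension k may be negated. *)
Lemma hilbert90_SL (t : 'M[K]_n.+1) : odd n.+1 -> \det t = 1 -> sgm t *m t = 1%:M ->
  exists2 k, \det k = 1 & sgm k *m t = k.
Proof.
move=> odd_n dt /hilbert90[k uk kt].
have : sg (\det k) = \det k.
  by rewrite -[in RHS]kt det_mulmx dt mulr1 det_map_mx.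
move/sg_fix; rewrite unitmxE unitfE in uk; rewrite (negPf uk) /=.
case/orP=> /eqP dk; first by exists k.
exists (- k); last by rewrite map_mxN mulNmx kt.
by rewrite -scaleN1r detZ dk -signr_odd odd_n expr1 mulrN1 opprK.
Qed.

End Hilbert.

(** If x^4 = 1 then x is one of 1, -1, io, -io, with square roots 1, io, 1 - io, 1 + io. Otherwise
    x^4 = -1, so the quotient of two such elements is a square. *)
Lemma sq_cases (a b : K) : a != 0 -> b != 0 ->
  [\/ exists2 s, s != 0 & a = s * s, exists2 s, s != 0 & b = s * s |
      exists2 s, s != 0 & b = s * s * a].
Proof.
have sq4 (x : K) : x ^+ 4 = 1 -> exists2 s, s != 0 & x = s * s.
  move=> x4; suff [s xs] : exists s, x = s * s.
    exists s => //; apply/eqP=> s0; have := oner_neq0 K.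
    by rewrite -x4 xs s0 mul0r exprS mul0r eqxx.
  have : (x ^+ 2) ^+ 2 == 1 ^+ 2 by rewrite -exprM x4 expr1n.
  rewrite eqf_sqr => /orP[]; last first.
    have <- : io ^+ 2 = -1 by rewrite expr2.
    have io1 : io + io = - io := @double_neg K^o io.
    rewrite eqf_sqr => /orP[] /eqP->; [exists (1 - io) | exists (1 + io)].
      have -> : (1 - io) * (1 - io) = 1 + io * io - (io + io) by ring.
      by rewrite io2 subrr sub0r io1 opprK.
    have -> : (1 + io) * (1 + io) = 1 + io * io + (io + io) by ring.
    by rewrite io2 subrr add0r io1.
  rewrite -[X in _ == X](expr1n _ 2) eqf_sqr => /orP[] /eqP->.
    by exists 1; rewrite mulr1.
  by exists io.
have pm (x : K) : x != 0 -> x ^+ 4 = 1 \/ x ^+ 4 = -1.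
  move=> x0; have : (x ^+ 4) ^+ 2 == 1 ^+ 2 by rewrite -exprM K8 // expr1n.
  by rewrite eqf_sqr => /orP[] /eqP; auto.
move=> a0 b0; have [/sq4|a4] := pm a a0; first by constructor 1.
have [/sq4|b4] := pm b b0; first by constructor 2.
constructor 3; have [|s s0 Es] := sq4 (b / a).
  by rewrite expr_div_n a4 b4 divff // oppr_eq0 oner_eq0.
by exists s; rewrite // -Es divfK.
Qed.

(** * Symmetric bilinear forms up to congruence *)

Section Bilinear.

Variables (n : nat) (A : 'M[K]_n.+1).
Hypotheses (A_sym : A^T = A) (A_unit : A \in unitmx).
Implicit Types x y z : 'rV[K]_n.+1.

Definition bf x y : K := (x *m A *m y^T) 0 0.

Lemma bfC x y : bf x y = bf y x.
Proof.
rewrite /bf; have -> : x *m A *m y^T = (y *m A *m x^T)^T.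
  by rewrite !trmx_mul trmxK A_sym mulmxA.
by rewrite mxE.
Qed.

Lemma bfDr x y z : bf x (y + z) = bf x y + bf x z.
Proof. by rewrite /bf linearD /= mulmxDr mxE. Qed.

Lemma bfZr x a y : bf x (a *: y) = a * bf x y.
Proof. by rewrite /bf linearZ /= -scalemxAr mxE. Qed.

Lemma bfDl x y z : bf (x + y) z = bf x z + bf y z.
Proof. by rewrite bfC bfDr !(bfC z). Qed.

Lemma bfZl x a y : bf (a *: x) y = a * bf x y.
Proof. by rewrite bfC bfZr bfC. Qed.

Lemma bf_nondeg x : (forall y, bf x y = 0) -> x = 0.
Proof.
move=> x0; rewrite -[x](mulmxK A_unit) (_ : x *m A = 0) ?mul0mx //.
apply/rowP=> j; have := x0 (delta_mx 0 j).
by rewrite /bf trmx_delta -colE !mxE.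
Qed.

Lemma bf_polar (P : 'rV[K]_n.+1 -> Prop) : (forall x y, P x -> P y -> P (x + y)) ->
  (forall x, P x -> bf x x = 0) -> forall x y, P x -> P y -> bf x y = 0.
Proof.
move=> PD P0 x y Px Py; have := P0 _ (PD _ _ Px Py).
rewrite bfDl !bfDr !P0 // add0r addr0 (bfC y) => /(@double_eq0 K^o).
by [].
Qed.

(** There are orthogonal w and w' of nonzero value. If neither value is a square, their ratio is
    one, and w' can be rescaled to have the same value a as w; it remains to write a^-1 as a sum of
    two squares. *)
Lemma bf_one : (0 < n)%N -> exists x, bf x x = 1.
Proof.
move=> n0.
have [w w0] : exists w, bf w w != 0.
  apply/existsP; rewrite -negb_forall; apply/negP=> /forallP H.
  have: (delta_mx 0 0 : 'rV[K]_n.+1) = 0.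
    apply: bf_nondeg => y; apply: (bf_polar (P := fun=> True)) => // x _.
    exact/eqP/H.
  by move/matrixP/(_ 0 0)/eqP; rewrite !mxE oner_eq0.
have [w' w'0 ww'] : exists2 w', bf w' w' != 0 & bf w w' = 0.
  have [y y0 yw] : exists2 y, y != 0 & bf y w = 0.
    have /rowV0Pn[y /sub_kermxP yk y0] : kermx (A *m w^T) != 0.
      by rewrite -mxrank_eq0 mxrank_ker subn_eq0 -ltnNge ltnS (leq_trans (rank_leq_col _)).
    by exists y; rewrite // /bf -mulmxA yk mxE.
  (* Otherwise the complement of w is totally isotropic, so y is orthogonal to it as well as to w
     and lies in the radical. *)
  suff /existsP[w' /andP[w'w w'0]] : [exists w', (bf w w' == 0) && (bf w' w' != 0)].
    by exists w' => //; apply/eqP.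
  apply: contraNT y0 => /existsPn H; apply/eqP/bf_nondeg => u.
  pose c := bf u w / bf w w.
  have -> : u = (u - c *: w) + c *: w by rewrite subrK.
  rewrite bfDr bfZr yw mulr0 addr0.
  apply: (bf_polar (P := fun z => bf w z = 0)).
  - by move=> z1 z2 z1w z2w; rewrite bfDr z1w z2w addr0.
  - by move=> z zw; apply/eqP; move: (H z); rewrite zw eqxx negbK.
  - by rewrite bfC.
  by rewrite bfDr -scaleNr bfZr mulNr bfC divfK // subrr.
have normal z s : s != 0 -> bf z z = s * s -> exists x, bf x x = 1.
  by move=> s0 zs; exists (s^-1 *: z); rewrite bfZl bfZr zs mulKf // mulVf.
have [[s s0 E]|[s s0 E]|[s s0 E]] := sq_cases w0 w'0; [exact: normal E | exact: normal E|].
pose a := bf w w; pose d := (s * s * a)^-1.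
have [z zE wz] : exists2 z, bf z z = a & bf w z = 0.
  by exists (s^-1 *: w'); [rewrite bfZl bfZr E -mulrA !mulKf | rewrite bfZr ww' mulr0].
(* As io^2 = -1, the sum of squares is (a^-1 + 1)^2 - (a^-1 - 1)^2 = 4 a^-1, which is a^-1 in
   characteristic 3. *)
pose al := - (a^-1 + 1); pose be := io * (a^-1 - 1).
exists (al *: w + be *: z).
rewrite bfDl !bfDr !bfZl !bfZr (bfC z) wz zE.
rewrite -[bf w w]/a /al /be !(mulr0, addr0, add0r).
have ac : a^-1 * a = 1 by rewrite mulVf.
have -> : - (a^-1 + 1) * (- (a^-1 + 1) * a) + io * (a^-1 - 1) * (io * (a^-1 - 1) * a)
  = (a^-1 + 1) ^+ 2 * a + io * io * (a^-1 - 1) ^+ 2 * a by ring.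
rewrite io2; have -> : (a^-1 + 1) ^+ 2 * a + -1 * (a^-1 - 1) ^+ 2 * a = 3%:R * (a^-1 * a) + a^-1 * a by ring.
by rewrite K3 mul0r add0r.
Qed.

End Bilinear.

Definition congr_mx n (A B : 'M[K]_n) := exists2 P, P \in unitmx & P *m A *m P^T = B.

Lemma congr_mx_sym n (A B : 'M[K]_n) : congr_mx A B -> congr_mx B A.
Proof.
case=> P uP <-; exists (invmx P); rewrite ?unitmx_inv //.
by rewrite !mulmxA mulVmx // mul1mx -mulmxA trmx_inv mulmxV ?unitmx_tr // mulmx1.
Qed.

Lemma congr_mx_trans n (A B C : 'M[K]_n) : congr_mx A B -> congr_mx B C -> congr_mx A C.
Proof.
case=> P uP <- [Q uQ <-]; exists (Q *m P); first by rewrite unitmx_mul uQ.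
by rewrite trmx_mul !mulmxA.
Qed.

Lemma congr_mx_split n (A : 'M[K]_(1 + n.+1)) : A^T = A -> A \in unitmx ->
  exists B : 'M[K]_n.+1, [/\ B^T = B, B \in unitmx & congr_mx A (block_mx 1%:M 0 0 B)].
Proof.
move=> A_sym uA; have [v v1] := @bf_one n.+1 A A_sym uA isT.
have v0 : v != 0 by apply/eqP=> v0; have := oner_neq0 K; rewrite -v1 v0 /bf !mul0mx mxE eqxx.
have [P uP vP] : exists2 P, P \in unitmx & v = delta_mx 0 0 *m P.
  pose c := (col_ebase v) 0 0.
  have rv : \rank v = 1%N.
    by apply/eqP; rewrite eqn_leq rank_leq_row lt0n mxrank_eq0.
  exists (c *: row_ebase v).
    have c0 : c != 0 by rewrite /c -det_mx11 -unitfE -unitmxE col_ebase_unit.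
    by rewrite unitmxE detZ unitrM unitrX ?unitfE //= -unitfE -unitmxE row_ebase_unit.
  rewrite -{1}(mulmx_ebase v) rv [col_ebase v]mx11_scalar -/c mul_scalar_mx -scalemxAr -scalemxAl.
  congr (_ *: (_ *m _)); apply/matrixP=> i j; rewrite !mxE ord1 /=.
  by rewrite ltnS leqn0 [in RHS]eq_sym -val_eqE; case: j => [[]].
pose C : 'M[K]_(1 + n.+1) := P *m A *m P^T.
have C_sym : C^T = C by rewrite /C !trmx_mul trmxK A_sym mulmxA.
have uC : C \in unitmx by rewrite /C !unitmx_mul uP uA unitmx_tr uP.
have AC : congr_mx A C by exists P.
have C00 : C 0 0 = 1.
  have : ((delta_mx 0 0 : 'rV_(1 + n.+1)) *m C *m (delta_mx 0 0 : 'rV_(1 + n.+1))^T) 0 0 = 1.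
    by rewrite -v1 /bf vP trmx_mul /C !mulmxA.
  by rewrite trmx_delta -rowE -colE !mxE.
clearbody C; have C1 : ulsubmx C = 1%:M.
  rewrite [ulsubmx C]mx11_scalar !mxE -C00; congr (C _ _)%:M; exact: val_inj.
pose u := ursubmx C; pose L : 'M[K]_(1 + n.+1) := block_mx 1%:M 0 (- u^T) 1%:M.
have CE : C = block_mx 1%:M u u^T (drsubmx C).
  by rewrite -[LHS]submxK C1 /u trmx_ursub C_sym.
have uL : L \in unitmx by rewrite unitmxE det_lblock !det1 mulr1 unitr1.
have LE : L *m C *m L^T = block_mx 1%:M 0 0 (drsubmx C - u^T *m u).
  have -> : L *m C = block_mx 1%:M u 0 (drsubmx C - u^T *m u).
    rewrite [in LHS]CE /L mulmx_block !mul1mx !mul0mx !addr0 mulmx1 addNr mulNmx.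
    by rewrite [- _ + _]addrC.
  rewrite /L tr_block_mx mulmx_block !trmx1 trmx0 linearN /= trmxK.
  by rewrite !mulmx1 !mulmx0 !mul0mx mul1mx !addr0 !add0r addNr.
exists (drsubmx C - u^T *m u).
have uB : drsubmx C - u^T *m u \in unitmx.
  have : L *m C *m L^T \in unitmx by rewrite !unitmx_mul uL uC unitmx_tr uL.
  by rewrite LE !unitmxE det_ublock det1 mul1r.
split=> //; last by apply: congr_mx_trans AC _; exists L.
by rewrite linearB /= trmx_mul trmxK trmx_drsub C_sym.
Qed.

(** Both forms split off a block 1. The base changes alter the determinants by squares, so the
    remaining blocks again have determinants differing by a square factor. *)
Lemma congr_mx_det n (A B : 'M[K]_n.+1) s : A^T = A -> B^T = B -> A \in unitmx -> B \in unitmx ->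
  s != 0 -> \det B = s * s * \det A -> congr_mx A B.
Proof.
elim: n A B s => [|n IHn] A B s A_sym B_sym uA uB s0 dB.
  exists s%:M; first by rewrite unitmxE det_scalar1 unitfE.
  rewrite tr_scalar_mx [A]mx11_scalar [B]mx11_scalar -!scalar_mxM -!det_mx11 dB.
  by congr _%:M; ring.
have [A' [A'_sym uA' [P uP AA']]] := @congr_mx_split n A A_sym uA.
have [B' [B'_sym uB' [Q uQ BB']]] := @congr_mx_split n B B_sym uB.
have dA' := congr1 (fun X => \det X) AA'; have dB' := congr1 (fun X => \det X) BB'.
rewrite /= det_ublock det1 mul1r !det_mulmx det_tr in dA'.
rewrite /= det_ublock det1 mul1r !det_mulmx det_tr in dB'.
rewrite !unitmxE !unitfE in uP uQ.
have [||||||R uR RA] := IHn A' B' (\det Q * s / \det P) => //.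
- by rewrite !mulf_neq0 // invr_neq0.
- rewrite -dA' -dB' dB; field; exact: uP.
have CAB : congr_mx (block_mx 1%:M 0 0 A' : 'M_(1 + n.+1)) (block_mx 1%:M 0 0 B').
  exists (block_mx 1%:M 0 0 R); first by rewrite unitmxE det_ublock det1 mul1r -unitmxE.
  rewrite tr_block_mx !mulmx_block trmx1 !trmx0 !(mul1mx, mulmx1, mul0mx, mulmx0, addr0, add0r).
  by rewrite RA.
apply: (@congr_mx_trans (1 + n.+1) A _ B).
  by exists P; [rewrite unitmxE unitfE | exact: AA'].
apply: congr_mx_trans CAB _; apply: congr_mx_sym.
by exists Q; [rewrite unitmxE unitfE | exact: BB'].
Qed.

Lemma congr_mx_SL n (A B : 'M[K]_n.+1) : odd n.+1 -> A^T = A -> B^T = B -> A \in unitmx ->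
  \det A = \det B -> exists2 P, \det P = 1 & P *m A *m P^T = B.
Proof.
move=> odd_n A_sym B_sym uA dAB.
have uB : B \in unitmx by rewrite unitmxE -dAB -unitmxE.
have [|P uP PA] := congr_mx_det A_sym B_sym uA uB (oner_neq0 K); first by rewrite dAB !mul1r.
have : \det P ^+ 2 == 1.
  have /eqP := congr1 (fun X => \det X) PA; rewrite !det_mulmx det_tr -dAB.
  rewrite -[X in _ == X]mul1r mulrAC -expr2; apply: contraTT => dP.
  by rewrite -subr_eq0 -mulrBl mulf_neq0 ?subr_eq0 // -unitfE -unitmxE.
rewrite -[X in _ == X](expr1n _ 2) eqf_sqr => /orP[] /eqP dP; first by exists P.
exists (- P); last by rewrite mulNmx linearN /= mulmxN mulNmx opprK.
by rewrite -scaleN1r detZ dP -signr_odd odd_n expr1 mulrN1 opprK.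
Qed.

End Forms.

(** * The matrices a_i *)

Section Matrices.

Local Open Scope ring_scope.

Variables (K : finFieldType) (sg : {rmorphism K -> K}) (io : K).
Hypothesis K3 : 3%:R = 0 :> K.
Hypothesis sgK : involutive sg.
Hypothesis io2 : io * io = -1.
Hypothesis sg_io : sg io = - io.
Hypothesis K8 : forall x : K, x != 0 -> x ^+ 8 = 1.
Hypothesis sg_fix : forall x : K, sg x = x -> [|| x == 0, x == 1 | x == -1].

Variables (F : finFieldType) (m : nat) (idx : F -> 'I_m.+1) (lb : 'I_m.+1 -> F).
Hypothesis idxK : cancel idx lb.
Hypothesis lbK : cancel lb idx.
Variables (pos : pred F) (g : F -> K).
Hypothesis pos0 : ~~ pos 0.
Hypothesis posN : forall k, k != 0 -> pos (- k) = ~~ pos k.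
Hypothesis g_pos : forall k, (g k != 0) = pos k.
Hypothesis sg_g : forall k, sg (g k) = g k.

Local Notation Mx := 'M[K]_m.+1.
Local Notation GL := {unit 'M[K]_m.+1}.
Local Notation sgm := (map_mx sg).

Definition Phi : Mx := \matrix_(a, b) g (lb b - lb a).
Hypothesis Phi_unit : Phi \in unitmx.

Lemma g0 : g 0 = 0.
Proof. by apply/eqP; rewrite -[_ == _]negbK g_pos. Qed.

Lemma g_anti k : g k * g (- k) = 0.
Proof.
apply/eqP; rewrite mulf_eq0 -[_ == _]negbK -[X in _ || X]negbK !g_pos.
have [->|k0] := eqVneq k 0; first by rewrite pos0.
by rewrite posN // orbN.
Qed.

Lemma g_rev l : pos l -> g (- l) = 0.
Proof.
move=> pl; have /eqP := g_anti l; rewrite mulf_eq0 => /orP[] /eqP // gl.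
by move: pl; rewrite -g_pos gl eqxx.
Qed.

Lemma idx_inj : injective idx. Proof. exact: can_inj idxK. Qed.

(* [E i j] is the column e_i times the row f_j of [Phi]; these products form a
   basis, and [co] reads off coordinates in it. *)
Definition E i j : Mx := delta_mx (idx i) (idx j) *m Phi.

Lemma EE i j k l : E i j * E k l = g (k - j) *: E i l.
Proof.
rewrite /E -[_ * _]/(_ *m _) mulmxA -(mulmxA _ Phi).
have -> : delta_mx (idx i) (idx j) *m (Phi *m delta_mx (idx k) (idx l))
    = g (k - j) *: delta_mx (idx i) (idx l) :> Mx.
  apply/matrixP=> a b; rewrite !mxE (bigD1 (idx j)) //= big1 => [|c cj]; last first.
    by rewrite !mxE (negPf cj) andbF mul0r.
  rewrite !mxE eqxx andbT (bigD1 (idx k)) //= big1 => [|c ck]; last first.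
    by rewrite !mxE (negPf ck) mulr0.
  rewrite !mxE eqxx !idxK !addr0 /=.
  by case: (a == _); rewrite ?mul0r ?mulr0 ?mul1r.
by rewrite scalemxAl.
Qed.

Definition co (X : Mx) (i j : F) : K := (X *m invmx Phi) (idx i) (idx j).

Lemma coE i j k l : co (E i j) k l = ((k == i) && (l == j))%:R.
Proof. by rewrite /co mulmxK // mxE !(inj_eq idx_inj). Qed.

Lemma coD X Y i j : co (X + Y) i j = co X i j + co Y i j.
Proof. by rewrite /co mulmxDl mxE. Qed.

Lemma coN X i j : co (- X) i j = - co X i j.
Proof. by rewrite /co mulNmx mxE. Qed.

Lemma coZ c X i j : co (c *: X) i j = c * co X i j.
Proof. by rewrite /co -scalemxAl mxE. Qed.

Lemma sgE i j : sgm (E i j) = E i j.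
Proof.
rewrite map_mxM; congr (_ *m _); apply/matrixP=> a b; rewrite !mxE ?sg_g //.
by case: andP; rewrite ?rmorph1 ?rmorph0.
Qed.

Definition b i : Mx := io *: E i i.

Lemma bb i : b i * b i = 0.
Proof. by rewrite /b -scalerAl -scalerAr EE subrr g0 scale0r !scaler0. Qed.

Lemma b2 i j : b i * b j = - (g (j - i) *: E i j).
Proof. by rewrite /b -scalerAl -scalerAr EE !scalerA io2 mulN1r scaleNr. Qed.

Lemma b3 i j k : b i * b j * b k = - (io *: ((g (j - i) * g (k - j)) *: E i k)).
Proof.
rewrite b2 /b mulNr -scalerAr -scalerAl EE !scalerA; congr (- (_ *: _)).
by rewrite mulrA.
Qed.

Lemma bbb i j : b i * b j * b i = 0.
Proof. by rewrite b3 -[i - j]opprB g_anti scale0r scaler0 oppr0. Qed.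

Lemma sgb i : sgm (b i) = - b i.
Proof. by rewrite map_mxZ sgE sg_io scaleNr. Qed.

Definition a i : Mx := 1 + b i.
Definition ai i : Mx := 1 - b i.

Lemma aK i : a i * ai i = 1.
Proof. by rewrite /a /ai mulrBr mulr1 mulrDl mul1r bb addr0 addrK. Qed.

Lemma aiK i : ai i * a i = 1.
Proof. by rewrite /a /ai mulrDr mulr1 mulrBl mul1r bb subr0 subrK. Qed.

Lemma sga i : sgm (a i) = ai i.
Proof. by rewrite /a map_mxD sgb map_mx1. Qed.

Lemma sgai i : sgm (ai i) = a i.
Proof. by rewrite -sga -map_mx_comp map_mx_id // => x; rewrite /= sgK. Qed.

Definition xm (t : F) : Mx := \matrix_(c, d) (lb c == lb d + t)%:R.

Lemma xm_row t (X : 'M[K]_m.+1) c d : (xm t *m X) c d = X (idx (lb c - t)) d.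
Proof.
rewrite mxE (bigD1 (idx (lb c - t))) //= big1 => [|e ec]; rewrite mxE.
  by rewrite idxK subrK eqxx mul1r addr0.
case: eqP => [E0|]; last by rewrite mul0r.
by move: ec; rewrite E0 addrK lbK eqxx.
Qed.

Lemma xm_col t (X : 'M[K]_m.+1) c d : (X *m xm t) c d = X c (idx (lb d + t)).
Proof.
rewrite mxE (bigD1 (idx (lb d + t))) //= big1 => [|e ec]; rewrite mxE.
  by rewrite idxK eqxx mulr1 addr0.
case: eqP => [E0|]; last by rewrite mulr0.
by move: ec; rewrite -E0 lbK eqxx.
Qed.

Lemma xm0 : xm 0 = 1.
Proof. by apply/matrixP=> c d; rewrite !mxE addr0 (inj_eq (can_inj lbK)). Qed.

Lemma xmD s t : xm (s + t) = xm s * xm t.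
Proof.
apply/matrixP=> c d; rewrite -[xm s * _]/(_ *m _) xm_row !mxE idxK.
by rewrite subr_eq -addrA [s + t]addrC.
Qed.

Lemma xmN t : xm t * xm (- t) = 1.
Proof. by rewrite -xmD subrr xm0. Qed.

Lemma xm_unit t : xm t \is a GRing.unit.
Proof. by apply/unitrP; exists (xm (- t)); rewrite xmN -{2}[t]opprK xmN. Qed.

Lemma sg_xm t : sgm (xm t) = xm t.
Proof. by apply/matrixP=> c d; rewrite !mxE; case: eqP; rewrite ?rmorph1 ?rmorph0. Qed.

Lemma xmE t i j : xm t * E i j = E (i + t) j.
Proof.
rewrite /E -[_ * _]/(_ *m _) mulmxA; congr (_ *m _); apply/matrixP=> c d.
rewrite xm_row !mxE (inj_eq idx_inj) subr_eq.
by rewrite [lb c == _](can2_eq lbK idxK).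
Qed.

Lemma delta_mulE (i j c d : 'I_m.+1) (Y : Mx) :
  (delta_mx i j *m Y) c d = (c == i)%:R * Y j d.
Proof.
rewrite mxE (bigD1 j) //= big1 => [|e ec]; rewrite mxE ?eqxx ?andbT ?addr0 //.
by rewrite (negPf ec) andbF mul0r.
Qed.

Lemma Exm t i j : E i j * xm t = E i (j - t).
Proof.
rewrite /E -[_ * _]/(_ *m _) -mulmxA; apply/matrixP=> c d.
by rewrite !delta_mulE xm_col !mxE !idxK opprB addrA.
Qed.

Lemma xm_b t i : xm t * b i = b (i + t) * xm t.
Proof. by rewrite /b -scalerAr -scalerAl xmE Exm addrK. Qed.

Lemma xm_a t i : xm t * a i = a (i + t) * xm t.
Proof. by rewrite /a mulrDr mulrDl mulr1 mul1r xm_b. Qed.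

Lemma xm_ai t i : xm t * ai i = ai (i + t) * xm t.
Proof. by rewrite /ai mulrBr mulrBl mulr1 mul1r xm_b. Qed.

Lemma cubeD (X : Mx) : (1 + X) ^+ 3 = 1 + X ^+ 3.
Proof.
have ch3 : 3 \in [pchar Mx].
  rewrite inE /=; apply/eqP.
  by change (1 + (1 + 1) = 0 :> Mx); rewrite (double_neg K3) addrN.
have := pFrobenius_autD_comm ch3 (commr_sym (commr1 X)).
by rewrite !pFrobenius_autE expr1n.
Qed.

Lemma cube1 (X : Mx) : X * (X * X) = 0 -> (1 + X) ^+ 3 = 1.
Proof. by move=> X3; rewrite cubeD !exprS expr0 mulr1 X3 addr0. Qed.

(** X = a_j a_i^-1 - 1 satisfies b_i X^2 = b_j X^2 = 0 because b_i b_j b_i = 0; hence X^3 = 0. *)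
Lemma hexagonE i j : (a j * ai i) ^+ 3 = 1.
Proof.
pose X : Mx := b j - b i - b j * b i.
have -> : a j * ai i = 1 + X.
  by rewrite /a /ai mulrBr mulr1 mulrDl mul1r /X; rewrite -!addrA opprD.
have bX : b i * X = b i * b j by rewrite /X !mulrBr bb subr0 mulrA bbb subr0.
have bX' : b j * X = - (b j * b i).
  by rewrite /X !mulrBr bb sub0r mulrA bb mul0r subr0.
have bXX : b i * (X * X) = 0 by rewrite mulrA bX -mulrA bX' mulrN mulrA bbb oppr0.
have bXX' : b j * (X * X) = 0 by rewrite mulrA bX' mulNr -mulrA bX mulrA bbb oppr0.
apply: cube1; have XE : X = b j - b i - b j * b i by [].
by clearbody X; rewrite {1}XE !mulrBl -mulrA bXX bXX' mulr0 !subr0.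
Qed.

Lemma expand3 (x y z : Mx) :
  (1 + x) * (1 - y) * (1 + z) = (1 - x * y + x * z - y * z) + (x - y + z - x * y * z).
Proof.
rewrite [(1 + x) * (1 - y)]mulrBr mulr1 [(1 + x) * y]mulrDl mul1r mulrDr mulr1 mulrBl !mulrDl mul1r.
move: (x * y) (x * z) (y * z) (x * y * z) => xy xz yz xyz.
by apply/matrixP=> c d; rewrite !mxE; ring.
Qed.

(* Applying [sg] separates the even and the odd parts in the [b i]; the odd part
   of the left-hand side has at most one coefficient off the diagonal. *)
Lemma hexagon_uniqE i1 i2 i3 i4 i5 i6 t : i1 != i2 -> i2 != i3 -> i3 != i4 ->
  a i6 * ai i5 * a i4 = xm t * (a i1 * ai i2 * a i3) -> i1 = i3.
Proof.
pose re i j k := 1 - b i * b j + b i * b k - b j * b k.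
pose im i j k := b i - b j + b k - b i * b j * b k.
have prodE i j k : a i * ai j * a k = re i j k + im i j k.
  exact: expand3.
have prodE' i j k : ai i * a j * ai k = re i j k - im i j k.
  have := expand3 (- b i) (- b j) (- b k); rewrite opprK => ->.
  rewrite /re /im !(mulNr, mulrN, opprK).
  move: (b i * b j * b k) (b i * b j) (b i * b k) (b j * b k) => w x y z.
  by apply/matrixP=> c d; rewrite !mxE; ring.
move=> n12 n23 n34 H.
have H' := congr1 sgm H; rewrite !map_mxM /= !sga !sgai sg_xm in H'.
have [Hre Him] : re i6 i5 i4 = xm t * re i1 i2 i3 /\ im i6 i5 i4 = xm t * im i1 i2 i3.
  have E1 : re i6 i5 i4 + im i6 i5 i4 = xm t * re i1 i2 i3 + xm t * im i1 i2 i3.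
    by rewrite -mulrDr -!prodE.
  have E2 : re i6 i5 i4 - im i6 i5 i4 = xm t * re i1 i2 i3 - xm t * im i1 i2 i3.
    by rewrite -mulrBr -!prodE'.
  have half (X Y X' Y' : Mx) : X + Y = X' + Y' -> X - Y = X' - Y' -> X = X' /\ Y = Y'.
    move=> D B; have XX : X = X'.
      apply: oppr_inj; rewrite -!(double_neg K3) -[X](addrK Y) -{2}[X](subrK Y).
      rewrite D B.
      by move: X' Y' Y {D B} => *; apply/matrixP=> c d; rewrite !mxE; ring.
    by split=> //; apply: (addrI X); rewrite D XX.
  exact: half E1 E2.
have [//|n13] := eqVneq i1 i3; exfalso.
have coim i j k c d : co (im i j k) c d = io * (((c == i) && (d == i))%:R - ((c == j) && (d == j))%:R
   + ((c == k) && (d == k))%:R + g (j - i) * g (k - j) * ((c == i) && (d == k))%:R).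
  by rewrite /im b3 opprK /b !(coD, coN, coZ, coE); ring.
have coxim i j k c d : co (xm t * im i j k) c d = io * (((c == i + t) && (d == i))%:R - ((c == j + t) && (d == j))%:R
   + ((c == k + t) && (d == k))%:R + g (j - i) * g (k - j) * ((c == i + t) && (d == k))%:R).
  rewrite /im b3 opprK /b !(mulrDr, mulrN) -!scalerAr !xmE.
  by rewrite !(coD, coN, coZ, coE); ring.
have eqim c d : ((c == i6) && (d == i6))%:R - ((c == i5) && (d == i5))%:R
   + ((c == i4) && (d == i4))%:R + g (i5 - i6) * g (i4 - i5) * ((c == i6) && (d == i4))%:R
   = ((c == i1 + t) && (d == i1))%:R - ((c == i2 + t) && (d == i2))%:R
   + ((c == i3 + t) && (d == i3))%:R + g (i2 - i1) * g (i3 - i2) * ((c == i1 + t) && (d == i3))%:R :> K.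
  by apply: (mulfI (io_neq0 io2)); rewrite -coim -coxim Him.
have n21 : (i2 == i1) = false by rewrite eq_sym (negPf n12).
have n31 : (i3 == i1) = false by rewrite eq_sym (negPf n13).
have n32 : (i3 == i2) = false by rewrite eq_sym (negPf n23).
have shift_ne (i : F) : t != 0 -> (i + t == i) = false.
  by move=> t0; apply/negP=> /eqP; rewrite -[RHS]addr0 => /addrI/eqP; rewrite (negPf t0).
have [t0|t0] := eqVneq t 0; last first.
  (* For t <> 0 the terms of i1 and i2 on the right are off the diagonal, where the left-hand side
     lives in column i4 only; this gives i1 = i4 = i2. *)
  have col (i : F) (s : K) : (s == 1) || (s == -1) -> i != i3 ->
     ((i + t == i1 + t) && (i == i1))%:R - ((i + t == i2 + t) && (i == i2))%:R = s -> i = i4.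
    move=> s1 i3n Es; have := eqim (i + t) i; rewrite Es.
    have off (j : F) : (i + t == j) && (i == j) = false.
      by apply/negP=> /andP[/eqP <-]; rewrite eq_sym shift_ne.
    rewrite !off (negPf i3n) !andbF !mulr0 !addr0 subrr add0r.
    case: (eqVneq i i4) => // _; rewrite andbF mulr0 => Es0; move: s1; rewrite -Es0.
    by rewrite eq_sym oner_eq0 eq_sym oppr_eq0 oner_eq0.
  have E14 : i1 = i4.
    by apply: (col i1 1) => //; rewrite ?eqxx ?(negPf n12) ?andbF ?subr0.
  have E24 : i2 = i4.
    by apply: (col i2 (-1)) => //; rewrite ?eqxx ?n21 ?andbF ?sub0r ?orbT.
  by rewrite E14 E24 eqxx in n12.
have one_neqN1 : (1 == -1 :> K) = false.
  apply/negP=> /eqP E11; have := oner_neq0 K; rewrite -oppr_eq0 -(double_neg K3 (1 : K^o)).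
  by rewrite {2}E11 subrr eqxx.
have diag i : (i == i6)%:R - (i == i5)%:R + (i == i4)%:R = (i == i1)%:R - (i == i2)%:R + (i == i3)%:R :> K.
  have Z j k l : g (k - j) * g (l - k) * ((i == j) && (i == l))%:R = 0.
    case: eqP => [<-|_]; last by rewrite mulr0.
    case: eqP => [<-|_]; last by rewrite mulr0.
    by rewrite -[i - k]opprB g_anti mul0r.
  by have := eqim i i; rewrite t0 !addr0 !Z !addr0 !andbb.
have E36 : i3 = i6.
  have := diag i3; rewrite (negPf n34) n31 n32 eqxx !addr0 subr0 add0r.
  case: (eqVneq i3 i6) => // _; rewrite sub0r => /eqP.
  by case: (i3 == i5); rewrite ?oppr0 eq_sym ?one_neqN1 ?oner_eq0.
have E14 : i1 = i4.
  have := diag i1; rewrite -E36 (negPf n13) (negPf n12) eqxx !addr0 subr0 sub0r => /eqP.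
  case: (eqVneq i1 i4) => // _; rewrite addr0.
  by case: (i1 == i5); rewrite ?oppr0 eq_sym ?one_neqN1 ?oner_eq0.
have E25 : i2 = i5.
  have := diag i2; rewrite -E36 -E14 (negPf n23) n21 eqxx !addr0 !sub0r => /oppr_inj.
  by case: eqVneq => // _ /eqP; rewrite eq_sym oner_eq0.
have core i j k c d : co (re i j k) c d = co 1 c d + g (j - i) * ((c == i) && (d == j))%:R
   - g (k - i) * ((c == i) && (d == k))%:R + g (k - j) * ((c == j) && (d == k))%:R.
  by rewrite /re !b2 !opprK !(coD, coN, coZ, coE).
have H0 c d := congr1 (fun X => co X c d) Hre; rewrite t0 xm0 mul1r /= in H0.
(* The even parts now belong to one triple read in opposite directions; they make both g(i2 - i1)
   and g(i1 - i2) vanish. *)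
have g12 : g (i2 - i1) = 0.
  have := H0 i1 i2; rewrite !core -E36 -E14 -E25 (negPf n12) (negPf n13) (negPf n23) !eqxx.
  by rewrite !(mulr0, subr0, addr0, andbF, mulr1) -[LHS]addr0 => /addrI.
have g21 : g (i1 - i2) = 0.
  have := H0 i2 i1; rewrite !core -E36 -E14 -E25 (negPf n13) (negPf n23) n21 !eqxx.
  by rewrite !(mulr0, subr0, addr0, andbF, mulr1) -[RHS]addr0 => /addrI.
have := g_pos (i1 - i2); rewrite g21 eqxx -[i1 - i2]opprB posN; last by rewrite subr_eq0 n21.
by rewrite -g_pos g12 eqxx.
Qed.

(* The characteristic polynomial of a nilpotent matrix divides a power of 'X. *)
Lemma nil_trace (X : Mx) N : X ^+ N = 0 -> \tr X = 0.
Proof.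
move=> XN; pose Xp : 'M[{poly K}]_m.+1 := map_mx polyC X.
have cX : GRing.comm ('X%:M : 'M[{poly K}]_m.+1) Xp.
  by rewrite /GRing.comm -[_ * Xp]/(_ *m _) -[Xp * _]/(_ *m _) scalar_mxC.
have XpN : Xp ^+ N = 0 by rewrite /Xp -rmorphXn XN rmorph0.
have dv : char_poly X %| ('X - 0%:P) ^+ (N * m.+1).
  have := congr1 (fun Y => \det Y) (subrXX_comm N cX).
  rewrite /= XpN -rmorphXn /= subr0 det_scalar -exprM -[_ * \sum_(i < N) _]/(_ *m _) det_mulmx.
  by rewrite polyC0 subr0 => ->; apply: dvdp_mulr.
have /dvdp_exp_XsubCP[k _] := dv.
rewrite eqp_monic ?char_poly_monic ?monic_exp ?monicXsubC // polyC0 subr0 => /eqP cp.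
have := size_char_poly X; rewrite cp size_polyXn => -[km].
have := char_poly_trace X (ltn0Sn m); rewrite cp coefXn km /=.
by rewrite ltn_eqF // => /esym/eqP; rewrite oppr_eq0 => /eqP.
Qed.

(** A word that sees a triple; a single product a_i a_j^-1 has cube 1 for every pair. *)
Definition uw i j k := a i * ai j * a i * ai k.

(** Here b_j b_i, b_k b_i and b_k b_j vanish, which gives X^4 = 0 for X = [uw i j k] - 1; in
    characteristic 3 the ninth power is 1 + X^9. *)
Lemma uw_transitive i j k : g (i - j) = 0 -> g (i - k) = 0 -> g (j - k) = 0 -> uw i j k ^+ 9 = 1.
Proof.
move=> gji gki gkj.
have bji : b j * b i = 0 by rewrite b2 gji scale0r oppr0.
have bki : b k * b i = 0 by rewrite b2 gki scale0r oppr0.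
have bkj : b k * b j = 0 by rewrite b2 gkj scale0r oppr0.
have ba c d : b c * b d = 0 -> b c * a d = b c by rewrite /a mulrDr mulr1 => ->; rewrite addr0.
have bai c d : b c * b d = 0 -> b c * ai d = b c by rewrite /ai mulrBr mulr1 => ->; rewrite subr0.
have [X XE] : exists X, X = uw i j k - 1 by exists (uw i j k - 1).
have kX : b k * X = 0.
  by rewrite XE mulrBr mulr1 /uw !mulrA ba // bai // ba // bai ?bb // subrr.
have jX : b j * X = - (b j * b k).
  by rewrite XE mulrBr mulr1 /uw !mulrA ba // bai ?bb // ba // /ai mulrBr mulr1 addrC addKr.
have iX : b i * X = - (b i * b j) + (b i * b j - b i) * b k.
  rewrite XE mulrBr mulr1 /uw !mulrA ba ?bb //.
  have -> : b i * ai j * a i = b i - b i * b j.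
    by rewrite /ai mulrBr mulr1 /a mulrDr mulr1 mulrBl bb bbb subr0 addr0.
  rewrite /ai mulrBr mulr1 -[- (_ * b k)]mulNr opprB.
  move: ((b i * b j - b i) * b k) (b i * b j) => x y.
  by apply/matrixP=> c d; rewrite !mxE; ring.
have jXX : b j * X * X = 0 by rewrite jX mulNr -mulrA kX mulr0 oppr0.
have iXXX : b i * X * X * X = 0.
  by rewrite iX mulrDl mulNr -!mulrA kX mulr0 addr0 jX mulrN opprK -!mulrA kX !mulr0.
have X4 : X * X * X * X = 0.
  (* X is a left combination of b_i, b_j, b_k, and each of these multiplies X^3 to 0. *)
  have [c1 [c2 [c3 Ec]]] : exists c1 c2 c3, X = c1 * b i + c2 * b j + c3 * b k.
    exists (1 + a i * ai j), (- a i), (- (a i * ai j * a i)).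
    have Ea (Y : Mx) l : Y * a l = Y + Y * b l by rewrite /a mulrDr mulr1.
    have Eai (Y : Mx) l : Y * ai l = Y - Y * b l by rewrite /ai mulrBr mulr1.
    rewrite XE /uw Eai Ea Eai !mulNr [(1 + _) * b i]mulrDl mul1r.
    move: (a i * b j) => x; rewrite /a.
    move: ((1 + b i - x + (1 + b i - x) * b i) * b k) ((1 + b i - x) * b i) => y z.
    by apply/matrixP=> c d; rewrite !mxE; ring.
  rewrite {1}Ec !mulrDl -!mulrA.
  have -> : b k * (X * (X * X)) = 0 by rewrite mulrA kX mul0r.
  have -> : b j * (X * (X * X)) = 0 by rewrite !mulrA jXX mul0r.
  have -> : b i * (X * (X * X)) = 0 by rewrite !mulrA iXXX.
  by rewrite !mulr0 !addr0.
have -> : uw i j k = 1 + X by rewrite XE addrC subrK.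
rewrite (exprM _ 3 3) !cubeD -exprM -[(3 * 3)%N]/(4 + 5)%N exprD.
by rewrite !exprSr expr0 mul1r X4 mul0r addr0.
Qed.

Lemma trE i j : \tr (E i j) = g (i - j).
Proof.
rewrite /mxtrace (bigD1 (idx i)) //= big1 => [|c ci]; last first.
  by rewrite delta_mulE (negPf ci) mul0r.
by rewrite delta_mulE eqxx mul1r mxE !idxK addr0.
Qed.

(* If [uw i j k] is unipotent, its trace is that of 1; hence [uw] tells transitive
   from cyclic triples of the tournament [pos (j - i)]. *)
Lemma uw_trace i j k : uw i j k ^+ 9 = 1 ->
  g (j - i) * g (k - j) * g (i - k) + g (i - j) * g (k - i) * g (j - k) = 0.
Proof.
pose X : Mx := - (b i * b j) - b j * b i + b i + b i - b j - b k + b i * b j * b k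
  + b j * b i * b k - b i * b k - b i * b k + b j * b k.
have uE : uw i j k = 1 + X.
  rewrite /uw /a expand3 bb bbb subr0 addr0 /ai mulrBr mulr1.
  have -> (Y Z : Mx) : (1 - Y - Z + (b i - b j + b i)) * b k
      = b k - Y * b k - Z * b k + b i * b k - b j * b k + b i * b k.
    by rewrite !(mulrDl, mulNr, mulrBl) mul1r !addrA.
  rewrite /X; move: (b i * b j * b k) (b j * b i * b k) (b i * b k) (b j * b k) => x y z t.
  by move: (b i * b j) (b j * b i) => *; apply/matrixP=> c d; rewrite !mxE; ring.
rewrite uE (exprM _ 3 3) !cubeD -exprM -[X in _ = X -> _]addr0 => /addrI/nil_trace.
have trb l : \tr (b l) = 0 by rewrite mxtraceZ trE subrr g0 mulr0.
have trbb l r : \tr (b l * b r) = 0.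
  by rewrite b2 -scaleNr mxtraceZ trE mulNr -[l - r]opprB g_anti oppr0.
rewrite /X !b3 !(mxtraceD, raddfN) /= !trbb !trb !mxtraceZ !trE.
rewrite !(oppr0, addr0, add0r) -opprD -mulrDr => /eqP.
by rewrite oppr_eq0 mulf_eq0 (negPf (io_neq0 io2)) => /eqP.
Qed.

(** The vanishing products are those of a transitive triple. Written without inverses, 1 + n + w is
    the commutator P Q P^-1 Q^-1, and 1 + w is the commutator of P with it. *)
Lemma unitri_comm (x y z : Mx) (n := x * y - x * z + y * z) (w := x * y * z)
    (P := (1 + x) * (1 - y)) (Q := (1 + y) * (1 - z)) :
  x * x = 0 -> y * y = 0 -> z * z = 0 -> y * x = 0 -> z * x = 0 -> z * y = 0 ->
  P * Q = (1 + n + w) * (Q * P) /\ P * (1 + n + w) = (1 + w) * ((1 + n + w) * P).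
Proof.
move=> xx yy zz yx zx zy.
have fixD (u v : Mx) : u * v = 0 -> u * (1 + v) = u by rewrite mulrDr mulr1 => ->; rewrite addr0.
have fixB (u v : Mx) : u * v = 0 -> u * (1 - v) = u by rewrite mulrBr mulr1 => ->; rewrite subr0.
have nx : n * x = 0 by rewrite /n mulrDl mulrBl -!mulrA yx zx !mulr0 subrr addr0.
have ny : n * y = 0 by rewrite /n mulrDl mulrBl -!mulrA yy zy !mulr0 subrr addr0.
have nz : n * z = w by rewrite /n mulrDl mulrBl -!mulrA zz !mulr0 subr0 addr0 mulrA.
have yn : y * n = 0 by rewrite /n mulrDr mulrBr !mulrA yx yy !mul0r subrr addr0.
have xn : x * n = w by rewrite /n mulrDr mulrBr !mulrA xx !mul0r subrr add0r.
have wx : w * x = 0 by rewrite /w -mulrA zx mulr0.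
have wy : w * y = 0 by rewrite /w -mulrA zy mulr0.
have wz : w * z = 0 by rewrite /w -mulrA zz mulr0.
have xw : x * w = 0 by rewrite /w !mulrA xx !mul0r.
have yw : y * w = 0 by rewrite /w !mulrA yx !mul0r.
have wn : w * n = 0 by rewrite /n mulrDr mulrBr !mulrA wx wy !mul0r subrr addr0.
have ww : w * w = 0 by rewrite {2}/w !mulrA wx !mul0r.
have wP : w * P = w by rewrite /P mulrA fixD // fixB.
have nP : n * P = n by rewrite /P mulrA fixD // fixB.
have wQ : w * Q = w by rewrite /Q mulrA fixD // fixB.
have nQ : n * Q = n - w by rewrite /Q mulrA fixD // mulrBr mulr1 nz.
have PE : P = 1 + x - y - x * y by rewrite /P mulrBr mulr1 mulrDl mul1r opprD addrA.
have QE : Q = 1 + y - z - y * z by rewrite /Q mulrBr mulr1 mulrDl mul1r opprD addrA.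
have PQE : P * Q = Q * P + n.
  have -> : P * Q = 1 + x - z - x * z.
    rewrite /P /Q -mulrA (mulrA (1 - y)).
    have -> : (1 - y) * (1 + y) = 1 by rewrite mulrDr mulr1 mulrBl mul1r yy subr0 subrK.
    by rewrite mul1r mulrBr mulr1 mulrDl mul1r opprD addrA.
  have -> : Q * P = 1 + x - y - x * y + (y - y * z - z).
    rewrite PE QE; have -> : (1 + y - z - y * z) * (1 + x - y - x * y)
      = (1 + x - y - x * y) + (y * (1 + x - y - x * y) - z * (1 + x - y - x * y)
          - y * (z * (1 + x - y - x * y))).
      rewrite [(1 + y - z - y * z) * _]mulrBl [(1 + y - z) * _]mulrBl [(1 + y) * _]mulrDl mul1r.
      by rewrite -(mulrA y) !addrA.
    have yP : y * (1 + x - y - x * y) = y.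
      by rewrite !(mulrBr, mulrDr) mulr1 mulrA yx yy mul0r !subr0 addr0.
    have -> : z * (1 + x - y - x * y) = z.
      by rewrite !(mulrBr, mulrDr) mulr1 mulrA zx zy mul0r !subr0 addr0.
    by rewrite yP; congr (_ + _); rewrite addrAC.
  by rewrite /n; move: (x * y) (x * z) (y * z) => *; apply/matrixP=> c d; rewrite !mxE; ring.
have PE' : P = (1 + x) * (1 - y) by [].
clearbody P Q n w; split.
  by rewrite PQE [RHS]mulrDl [(1 + n) * _]mulrDl mul1r !mulrA nQ mulrBl nP wP wQ wP addrA subrK.
have -> : P * (1 + n + w) = P + n + w + w.
  have -> : P * (1 + n + w) = P + (1 + x) * ((1 - y) * (n + w)).
    by rewrite -addrA mulrDr mulr1 mulrA -PE'.
  rewrite mulrBl mul1r [y * _]mulrDr yn yw addr0 subr0 mulrDl mul1r mulrDr xn xw addr0.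
  by rewrite !addrA.
have -> : (1 + n + w) * P = P + n + w by rewrite !mulrDl mul1r nP wP.
by rewrite mulrDl mul1r !mulrDr wP wn ww !addr0.
Qed.

(** * Generation of SL by the products a_i a_j^-1 *)

Section Generation.

Variable H : {group GL}.
Hypothesis H_a : forall i j, mxin H (a i * ai j).
(** In the application h is r, so that 2h = -1; the other hypotheses are the facts about sums of
    positive indices that the argument uses. *)
Variable h : F.
Hypotheses (pos_1 : pos 1) (pos_2 : pos 2%:R) (F2 : 2%:R != 0 :> F) (F3 : 3%:R != 0 :> F) (F4 : 4%:R != 0 :> F).
Hypothesis pos_pred : forall s, pos s -> s != 1 -> pos (s - 1).
Hypothesis pos_sum : forall d, d != 0 -> d != 1 -> exists s t, [/\ pos s, pos t & d = s + t].
Hypothesis pos_sum' : forall d, d != 0 -> d != 1 -> d != 2%:R ->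
  exists s t, [/\ pos s, pos t, s != 1 & d = s + t].
Hypotheses (h_pos : pos h) (h_neq1 : h != 1) (h_half : h + h + 1 = 0).
Hypothesis pos_h : forall t, pos t -> ~~ pos (t + h + 1).

Local Notation e i := (delta_mx (idx i) 0 : 'cV[K]_m.+1).
Local Notation fr j := (row (idx j) Phi).

Lemma fr_e i j : fr i *m e j = (g (j - i))%:M.
Proof.
rewrite -colE [LHS]mx11_scalar; congr _%:M.
by rewrite !mxE !idxK.
Qed.

Lemma e_fr i j c : e i *m (c *: fr j) = c *: E i j.
Proof. by rewrite -scalemxAr rowE mulmxA mul_delta_mx. Qed.

(* The rows f for which [1 + e_i f] is a transvection lying in [H]. *)
Definition rootv i (f : 'rV[K]_m.+1) := (f *m e i == 0) && mxin H (tv (e i) f).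

Lemma rootvP i f : reflect (f *m e i = 0 /\ mxin H (tv (e i) f)) (rootv i f).
Proof. by apply: (iffP andP) => -[/eqP]. Qed.

Lemma rootv0 i : rootv i 0.
Proof. by apply/rootvP; rewrite mul0mx /tv mulmx0 addr0 mxin1. Qed.

Lemma rootvD i f f' : rootv i f -> rootv i f' -> rootv i (f + f').
Proof.
move=> /rootvP[fi Hf] /rootvP[fi' Hf']; apply/rootvP; rewrite mulmxDl fi fi' addr0.
by split=> //; rewrite -tvD // mxinM.
Qed.

Lemma rootvN i f : rootv i f -> rootv i (- f).
Proof.
move=> /rootvP[fi Hf]; apply/rootvP; rewrite mulNmx fi oppr0; split=> //.
exact: mxinV Hf (tvNr fi).
Qed.

Lemma rootv_rule i j f f' : rootv i f -> rootv j f' -> f' *m e i = 0 -> rootv i (f *m e j *m f').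
Proof.
move=> /rootvP[fi Hf] /rootvP[fj Hf'] f'i; apply/rootvP; split; first by rewrite -mulmxA f'i mulmx0.
rewrite -tv_comm //; apply: mxinM; last exact: mxinV Hf' (tvNr fj).
by apply: mxinM; [apply: mxinM | exact: mxinV Hf (tvNr fi)].
Qed.

Lemma rootv_real i c f : sg c = c -> c != 0 -> rootv i (c *: f) -> rootv i f.
Proof.
move=> /sg_fix/orP[/eqP->|/orP[] /eqP->]; first by rewrite eqxx.
  by rewrite scale1r.
by rewrite scaleN1r => _ /rootvN; rewrite opprK.
Qed.

(** f_k e_j = g(j - k) is 1 or -1, so the commutator carries f' from j to i with the factor c. *)
Lemma rootv_rule_row i j k c f' : rootv i (c *: fr k) -> pos (j - k) -> rootv j f' -> f' *m e i = 0 ->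
  rootv i (c *: f').
Proof.
move=> Hf pjk Hf' f'i; have := rootv_rule Hf Hf' f'i.
rewrite -scalemxAl fr_e scale_scalar_mx mul_scalar_mx mulrC -scalerA.
by apply: rootv_real; rewrite ?g_pos.
Qed.

Lemma rootv_scal i f : rootv i f -> rootv i (io *: f) -> forall c, rootv i (c *: f).
Proof.
move=> Hf Hif c; have FFr d v : sg d = d -> rootv i v -> rootv i (d *: v).
  move=> /sg_fix/orP[/eqP->|/orP[] /eqP-> Hv]; first by rewrite scale0r rootv0.
    by rewrite scale1r.
  by rewrite scaleN1r rootvN.
(* Real and imaginary parts with respect to [sg]: in characteristic 3 the inverse of 2 is -1. *)
pose x := - (c + sg c); pose y := io * (c - sg c).
have -> : c = x + y * io.
  rewrite /x /y mulrAC io2; have := @double_neg K K3 K^o c.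
  by move=> cc; rewrite -[LHS]opprK -cc; ring.
rewrite scalerDl -scalerA; apply: rootvD; apply: FFr => //.
  by rewrite /x rmorphN rmorphD sgK addrC.
by rewrite /y rmorphM rmorphB sgK sg_io; ring.
Qed.

(** For a transitive triple the double commutator of [unitri_comm] is 1 + b_i b_j b_k, a
    transvection along e_i with row proportional to io f_k. *)
Lemma rootv_triple i j k : pos (j - i) -> pos (k - j) -> pos (k - i) -> rootv i (io *: fr k).
Proof.
move=> pij pjk pik.
have rev0 := g_rev.
have bji : b j * b i = 0 by rewrite b2 -opprB rev0 // scale0r oppr0.
have bki : b k * b i = 0 by rewrite b2 -opprB rev0 // scale0r oppr0.
have bkj : b k * b j = 0 by rewrite b2 -opprB rev0 // scale0r oppr0.
pose P : Mx := a i * ai j; pose Q : Mx := a j * ai k.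
pose n := b i * b j - b i * b k + b j * b k; pose w := b i * b j * b k.
have [PQ PR] : P * Q = (1 + n + w) * (Q * P) /\ P * (1 + n + w) = (1 + w) * ((1 + n + w) * P).
  exact: unitri_comm (bb i) (bb j) (bb k) bji bki bkj.
have HR : mxin H (1 + n + w) by apply: (mxin_div _ _ PQ); rewrite mxinM // H_a.
have Hw : mxin H (1 + w) by apply: (mxin_div _ _ PR); rewrite mxinM // H_a.
have {Hw} : rootv i (- (io *: ((g (j - i) * g (k - j)) *: fr k))).
  apply/rootvP; split.
    by rewrite mulNmx -!scalemxAl fr_e -[i - k]opprB rev0 // raddf0 !scaler0 oppr0.
  by move: Hw; rewrite /w b3 /tv mulmxN !scalerA e_fr.
move/rootvN; rewrite opprK scalerA mulrC -scalerA; apply: rootv_real.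
  by rewrite rmorphM !sg_g.
by rewrite mulf_neq0 ?g_pos.
Qed.

Lemma rootv_io_pos i s : pos s -> s != 1 -> rootv i (io *: fr (i + s)).
Proof.
move=> ps s1; apply: (@rootv_triple i (i + 1)).
- by rewrite addrAC subrr add0r.
- by rewrite opprD addrACA subrr add0r pos_pred.
by rewrite addrAC subrr add0r.
Qed.

(** With d = s + t, both positive and s <> 1, the row io f_(i+s) known at i carries f over from i +
    d. *)
Lemma rootv_io_mul i d f : d != 0 -> d != 1 -> d != 2%:R -> rootv (i + d) f -> f *m e i = 0 -> rootv i (io *: f).
Proof.
move=> d0 d1 d2 Hf fi; have [s [t [ps pt s1 E]]] := pos_sum' d0 d1 d2.
apply: (rootv_rule_row (rootv_io_pos i ps s1) _ Hf fi).
by rewrite E addrA [i + s + t]addrC addrK.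
Qed.

Lemma two_neq1 : 2%:R != 1 :> F.
Proof. by rewrite -subr_eq0 -[2%:R]/(1 + 1) addrK oner_neq0. Qed.

Lemma ioio (v : 'rV[K]_m.+1) : io *: (io *: v) = - v.
Proof. by rewrite scalerA io2 scaleN1r. Qed.

Lemma fr_e0 c i j : g (j - i) = 0 -> c *: fr i *m e j = 0.
Proof. by move=> gji; rewrite -scalemxAl fr_e gji raddf0 scaler0. Qed.

(** The difference 1 is too short for a transitive triple. Instead io f_(i+1), known at i - 1, is
    carried to i with a second factor io. *)
Lemma rootv_succ i : rootv i (fr (i + 1)).
Proof.
have Hf : rootv (i + -1) (io *: fr (i + 1)).
  have -> : i + 1 = i + -1 + 2%:R by rewrite -addrA -[2%:R]/(1 + 1) addKr.
  exact: rootv_io_pos two_neq1.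
have := rootv_io_mul _ _ _ Hf; rewrite ioio => H1; rewrite -[fr _]opprK; apply/rootvN/H1.
- by rewrite oppr_eq0 oner_neq0.
- by rewrite eq_sym -subr_eq0 opprK.
- by rewrite eq_sym -subr_eq0 opprK natr1.
by apply: fr_e0; rewrite opprD addrA subrr add0r g_rev.
Qed.

Lemma rootv_self i : rootv i (fr i).
Proof.
have Hf : rootv (i + - 2%:R) (io *: fr i).
  have {2}-> : i = i + - 2%:R + 2%:R by rewrite subrK.
  exact: rootv_io_pos two_neq1.
have := rootv_io_mul _ _ _ Hf; rewrite ioio => H1; rewrite -[fr _]opprK; apply/rootvN/H1.
- by rewrite oppr_eq0.
- by rewrite eq_sym -subr_eq0 opprK addrC natr1.
- by rewrite eq_sym -subr_eq0 opprK -natrD.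
by apply: fr_e0; rewrite subrr g0.
Qed.

Lemma rootv_from_succ i d f : pos (d - 1) -> rootv (i + d) f -> f *m e i = 0 -> rootv i f.
Proof.
move=> pd Hf fi; rewrite -[f]scale1r.
have H1 : rootv i (1 *: fr (i + 1)) by rewrite scale1r rootv_succ.
apply: (rootv_rule_row H1 _ Hf fi).
by rewrite opprD addrACA subrr add0r.
Qed.

(** Since 2h + 1 = 0, the index i is h steps beyond i + h + 1, where io f_i is therefore known; it
    is carried from there. *)
Lemma rootv_io_self i : rootv i (io *: fr i).
Proof.
apply: (@rootv_from_succ i (h + 1)); first by rewrite addrK.
  have {2}-> : i = i + (h + 1) + h by rewrite -addrA addrAC h_half addr0.
  exact: rootv_io_pos.
by apply: fr_e0; rewrite subrr g0.
Qed.

Lemma rootv_pos i s : pos s -> rootv i (fr (i + s)).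
Proof.
move=> ps; suff : rootv i (io *: (io *: fr (i + s))) by rewrite ioio => /rootvN; rewrite opprK.
apply: (rootv_rule_row (rootv_io_self i) _ (rootv_io_self (i + s))); first by rewrite addrAC subrr add0r.
by apply: fr_e0; rewrite opprD addrA subrr add0r g_rev.
Qed.

Lemma rootv_from i d f : d != 0 -> d != 1 -> rootv (i + d) f -> f *m e i = 0 -> rootv i f.
Proof.
move=> d0 d1 Hf fi; have [s [t [ps pt E]]] := pos_sum d0 d1; rewrite -[f]scale1r.
have H1 : rootv i (1 *: fr (i + s)) by rewrite scale1r rootv_pos.
apply: (rootv_rule_row H1 _ Hf fi).
by rewrite E opprD addrACA subrr add0r [s + t]addrC addrK.
Qed.

Lemma rootv_scale i k c : ~~ pos (i - k) -> rootv i (c *: fr k).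
Proof.
move=> nk; apply: rootv_scal.
  have [<-|ki] := eqVneq i k; first exact: rootv_self.
  have -> : k = i + (k - i) by rewrite addrC subrK.
  by apply: rootv_pos; rewrite -[k - i]opprB posN ?subr_eq0.
have [<-|ki] := eqVneq i k; first exact: rootv_io_self.
have pk : pos (k - i) by rewrite -[k - i]opprB posN ?subr_eq0.
have kE : k = i + (k - i) by rewrite addrC subrK.
have [k1|k1] := eqVneq (k - i) 1; last by rewrite kE; apply: rootv_io_pos.
apply: (@rootv_from i (-1)).
- by rewrite oppr_eq0 oner_neq0.
- by rewrite eq_sym -subr_eq0 opprK.
- have -> : k = i + -1 + 2%:R by rewrite kE k1 -addrA -[2%:R]/(1 + 1) addKr.
  exact: rootv_io_pos two_neq1.
by apply: fr_e0; rewrite -opprB k1 g_rev.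
Qed.

Lemma rootv_sum i (I : finType) (P : pred I) (f : I -> 'rV[K]_m.+1) :
  (forall l, P l -> rootv i (f l)) -> rootv i (\sum_(l | P l) f l).
Proof.
by move=> Hf; elim/big_rec: _ => [|l x Pl Hx]; [apply: rootv0 | apply: rootvD Hx; apply: Hf].
Qed.

(** Expand v in the rows f_l. Those with i - l not positive are known at i. The others do not kill
    e_i one by one, but all are known at i + h + 1 by [pos_h], and their combination does kill e_i,
    so it is carried to i as a whole. *)
Lemma rootv_full i v : v *m e i = 0 -> rootv i v.
Proof.
have h0 : h != 0 by apply: contraNneq pos0 => <-.
move=> vi; have vE : v = v *m invmx Phi *m Phi by rewrite mulmxKV.
pose w P := \sum_(l | P l) (v *m invmx Phi) 0 l *: row l Phi.
have {vE} vE : v = w (fun l => pos (i - lb l)) + w (fun l => ~~ pos (i - lb l)).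
  by rewrite [LHS]vE mulmx_sum_row (bigID (fun l => pos (i - lb l))).
have w2 : rootv i (w (fun l => ~~ pos (i - lb l))).
  by apply: rootv_sum => l nl; rewrite -[l]lbK; apply: rootv_scale; rewrite ?lbK.
rewrite vE; apply: (rootvD _ w2); apply: (@rootv_from i (h + 1)).
- by apply: contraNneq h0 => h1; rewrite -h_half -addrA h1 addr0.
- by rewrite -subr_eq0 addrK.
- apply: rootv_sum => l pl; rewrite -[l]lbK; apply: rootv_scale; rewrite ?lbK.
  rewrite [i + (h + 1)]addrC -addrA [h + 1 + _]addrC addrA; exact: pos_h.
have /rootvP[w2i _] := w2.
by have := vi; rewrite {1}vE mulmxDl w2i addr0.
Qed.

Lemma SL_sub_gen : SL K m \subset H.
Proof.
apply: SL_gen => c d l ncd; have /rootvP[_] : rootv (lb c) (l *: delta_mx 0 d).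
  by apply: rootv_full; rewrite lbK -scalemxAl mul_delta_mx_0 ?scaler0 // eq_sym.
by rewrite /tv -scalemxAr lbK mul_delta_mx.
Qed.

End Generation.

(** * The group SL_p(9) with the maps c and theta *)

Section GroupLevel.

Variable r : nat.
Hypothesis r_gt1 : (1 < r)%N.
Hypothesis m_r : m = r.*2.
Hypothesis F_nat : forall k : F, exists2 n, (n < r.*2.+1)%N & k = n%:R.
Hypothesis F_p : r.*2.+1%:R = 0 :> F.
Hypothesis natF : forall n, (0 < n < r.*2.+1)%N -> n%:R != 0 :> F.
Hypothesis posE : forall n, (n < r.*2.+1)%N -> pos n%:R = (0 < n <= r)%N.
Hypothesis K_root : forall l : K, l ^+ m.+1 = 1 -> l = 1.

Lemma pos_one : pos 1.
Proof. by rewrite -[1]/(1%:R) posE; lia. Qed.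

Definition mkU (A : Mx) : GL := insubd (1%g : GL) A.

Lemma val_mkU A : A \is a GRing.unit -> val (mkU A) = A.
Proof. by move=> uA; rewrite /mkU insubdK. Qed.

Lemma mkU_eq A B : A * B = 1 -> val (mkU A) = A.
Proof.
move=> AB; apply: val_mkU; apply/unitrP; exists B; split=> //.
exact: mulmx1C AB.
Qed.

Lemma valM (u v : GL) : val (u * v)%g = val u * val v. Proof. by []. Qed.

Lemma valV_eq (u : GL) A : val u * A = 1 -> val u^-1%g = A.
Proof. by move=> uA; rewrite -[RHS](mulKr (valP u)) uA mulr1. Qed.

Lemma mulV (u : GL) : val u * val u^-1%g = 1.
Proof. by rewrite -valM mulgV. Qed.

Definition ua i : GL := mkU (a i).
Definition xg t : GL := mkU (xm t).
Definition sgu (u : GL) : GL := mkU (sgm (val u)).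
Definition cg (u : GL) : GL := (ua 0 * sgu u * (ua 0)^-1)%g.

Lemma val_ua i : val (ua i) = a i. Proof. exact: mkU_eq (aK i). Qed.
Lemma val_xg t : val (xg t) = xm t. Proof. exact: mkU_eq (xmN t). Qed.
Lemma val_sgu u : val (sgu u) = sgm (val u).
Proof.
apply: (@mkU_eq _ (sgm (val u^-1%g))).
by rewrite -[_ * _]/(_ *m _) -map_mxM -[_ *m _]/(_ * _) mulV map_mx1.
Qed.
Lemma val_cg u : val (cg u) = a 0 * sgm (val u) * ai 0.
Proof. by rewrite !valM val_ua val_sgu (@valV_eq _ (ai 0)) // val_ua aK. Qed.

Lemma cgM : {morph cg : u v / (u * v)%g}.
Proof.
move=> u v; apply: val_inj; rewrite valM !val_cg valM.
rewrite [sgm _]map_mxM -[sgm _ *m _]/(_ * _) !mulrA; congr (_ * _).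
by rewrite -[in RHS](mulrA _ (ai 0)) aiK mulr1.
Qed.

Lemma sgmK (A : Mx) : sgm (sgm A) = A.
Proof. by rewrite -map_mx_comp map_mx_id // => x; rewrite /= sgK. Qed.

Lemma sgmM (A B : Mx) : sgm (A * B) = sgm A * sgm B.
Proof. exact: map_mxM. Qed.

Lemma cgK : involutive cg.
Proof.
move=> u; apply: val_inj; rewrite !val_cg !sgmM sga sgai sgmK !mulrA aK mul1r.
by rewrite -mulrA aK mulr1.
Qed.

Lemma a_cube i : a i * a i * a i = 1.
Proof.
have /cube1 : b i * (b i * b i) = 0 by rewrite bb mulr0.
by rewrite !exprS expr0 mulr1 mulrA.
Qed.

Lemma K3root (l : K) : l ^+ 3 = 1 -> l = 1.
Proof.
move=> l3; have : (l - 1) ^+ 3 = 0.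
  have -> : (l - 1) ^+ 3 = l ^+ 3 - 1 - 3%:R * (l ^+ 2 - l) by ring.
  by rewrite l3 K3 mul0r subr0 subrr.
by move/eqP; rewrite expf_eq0 /= subr_eq0 => /eqP.
Qed.

Lemma det_a i : \det (a i) = 1.
Proof.
apply: K3root; have := congr1 (fun A => \det A) (a_cube i).
by rewrite /= -[_ * a i]/(_ *m _) -[a i * _]/(_ *m _) !det_mulmx det1 !exprS expr0 mulr1 mulrA.
Qed.

Lemma det_ai i : \det (ai i) = 1.
Proof. by rewrite -sga det_map_mx det_a rmorph1. Qed.

Lemma det_xm t : \det (xm t) = 1.
Proof.
have xn n : xm t ^+ n = xm (t *+ n).
  by elim: n => [|n IHn]; rewrite ?xm0 // exprS IHn mulrS xmD.
have dn (A : Mx) n : \det (A ^+ n) = \det A ^+ n.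
  elim: n => [|n IHn]; first by rewrite !expr0 det1.
  by rewrite !exprS -[A * _]/(_ *m _) det_mulmx IHn.
have Fm : m.+1%:R = 0 :> F by rewrite m_r.
by apply: K_root; rewrite -dn xn -mulr_natr Fm mulr0 xm0 det1.
Qed.

(** [Phi] with its rows reflected by k |-> -k, hence symmetric; [thm] is the adjoint for this
    form. *)
Definition Nm : Mx := \matrix_(c, d) g (lb c + lb d).
Definition Rm : Mx := \matrix_(c, d) (lb c == - lb d)%:R.

Lemma Rm_row (X : Mx) c d : (Rm *m X) c d = X (idx (- lb c)) d.
Proof.
rewrite mxE (bigD1 (idx (- lb c))) //= big1 => [|e ec]; rewrite mxE.
  by rewrite idxK opprK eqxx mul1r addr0.
case: eqP => [E0|]; last by rewrite mul0r.
by move: ec; rewrite E0 opprK lbK eqxx.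
Qed.

Lemma RmK : Rm *m Rm = 1%:M.
Proof.
apply/matrixP=> c d; rewrite Rm_row !mxE idxK (inj_eq oppr_inj).
by rewrite (inj_eq (can_inj lbK)).
Qed.

Lemma Nm_Phi : Nm = Rm *m Phi.
Proof. by apply/matrixP=> c d; rewrite Rm_row !mxE idxK opprK addrC. Qed.

Lemma Nm_unit : Nm \in unitmx.
Proof. by rewrite Nm_Phi unitmx_mul Phi_unit andbT (proj1 (mulmx1_unit RmK)). Qed.

Lemma Nm_sym : Nm^T = Nm.
Proof. by apply/matrixP=> c d; rewrite !mxE addrC. Qed.

Lemma sg_Nm : sgm Nm = Nm.
Proof. by apply/matrixP=> c d; rewrite !mxE sg_g. Qed.

(* theta(t) is [thm] of the conjugate of t^-1, so [thm] itself reverses products. *)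
Definition thm (A : Mx) : Mx := invmx Nm *m A^T *m Nm.

Lemma thmM (A B : Mx) : thm (A * B) = thm B * thm A.
Proof.
rewrite /thm -[A * B]/(A *m B) trmx_mul -[_ * _ in RHS]/(_ *m _) !mulmxA.
by rewrite (mulmxK Nm_unit).
Qed.

Lemma thmD (A B : Mx) : thm (A + B) = thm A + thm B.
Proof. by rewrite /thm linearD /= mulmxDr mulmxDl. Qed.

Lemma thm1 : thm 1 = 1.
Proof. by rewrite /thm trmx1 mulmx1 mulVmx ?Nm_unit. Qed.

Lemma thmN A : thm (- A) = - thm A.
Proof. by rewrite /thm linearN /= mulmxN mulNmx. Qed.

Lemma thmK A : thm (thm A) = A.
Proof.
rewrite /thm !trmx_mul trmxK trmx_inv Nm_sym !mulmxA mulVmx ?Nm_unit // mul1mx.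
by rewrite mulmxKV ?Nm_unit.
Qed.

Lemma sg_thm A : sgm (thm A) = thm (sgm A).
Proof. by rewrite /thm !map_mxM /= map_invmx sg_Nm map_trmx. Qed.

Lemma det_thm A : \det (thm A) = \det A.
Proof.
rewrite /thm !det_mulmx det_inv det_tr mulrAC mulVr ?mul1r //.
by rewrite -unitmxE Nm_unit.
Qed.

(** The adjoint thus fixes a_0, which is what makes theta commute with c. *)
Lemma thm_b i : thm (b i) = b (- i).
Proof.
rewrite /thm /b linearZ /= -scalemxAr -scalemxAl; congr (_ *: _).
rewrite /E trmx_mul trmx_delta.
have -> : Phi^T = Nm *m Rm.
  have Rsym : Rm^T = Rm.
    by apply/matrixP=> c d; rewrite !mxE -eqr_oppLR eq_sym.
  by rewrite -[RHS]trmxK trmx_mul Nm_sym Rsym Nm_Phi mulmxA RmK mul1mx.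
rewrite !mulmxA mulVmx ?Nm_unit // mul1mx Nm_Phi !mulmxA; congr (_ *m _).
apply/matrixP=> c d; rewrite -mulmxA Rm_row delta_mulE !mxE.
rewrite (inj_eq idx_inj) eqr_oppLR [lb c == _](can2_eq lbK idxK) -mulnb natrM; congr (_ * _%:R).
by rewrite idxK eq_sym eqr_oppLR [lb d == _](can2_eq lbK idxK).
Qed.

Lemma thm_a i : thm (a i) = a (- i).
Proof. by rewrite /a thmD thm1 thm_b. Qed.

Lemma thm_ai i : thm (ai i) = ai (- i).
Proof. by rewrite /ai thmD thmN thm1 thm_b. Qed.

Lemma thm_xm t : thm (xm t) = xm t.
Proof.
have -> : thm (xm t) = invmx Nm *m (Nm *m xm t); last by rewrite mulKmx ?Nm_unit.
rewrite /thm -mulmxA; congr (_ *m _); apply/matrixP=> c d.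
rewrite xm_col mxE (bigD1 (idx (lb c + t))) //= big1 => [|e ec]; rewrite !mxE.
  by rewrite !idxK eqxx mul1r addr0 addrAC addrA.
case: eqP => [E0|]; last by rewrite mul0r.
by move: ec; rewrite -E0 lbK eqxx.
Qed.

Definition thg (u : GL) : GL := mkU (thm (sgm (val u^-1%g))).

Lemma val_thg u : val (thg u) = thm (sgm (val u^-1%g)).
Proof.
apply: (@mkU_eq _ (thm (sgm (val u)))).
by rewrite -thmM -sgmM mulV [sgm 1]map_mx1 thm1.
Qed.

Lemma thgM : {morph thg : u v / (u * v)%g}.
Proof. by move=> u v; apply: val_inj; rewrite valM !val_thg invMg valM sgmM thmM. Qed.

Lemma val_thgV u : val (thg u)^-1%g = thm (sgm (val u)).
Proof.
by apply: valV_eq; rewrite val_thg -thmM -sgmM mulV [sgm 1]map_mx1 thm1.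
Qed.

Lemma thgK : involutive thg.
Proof. by move=> u; apply: val_inj; rewrite val_thg val_thgV sg_thm sgmK thmK. Qed.

Lemma val_cgV u : val (cg u)^-1%g = a 0 * sgm (val u^-1%g) * ai 0.
Proof.
apply: valV_eq; rewrite val_cg !mulrA -[_ * ai 0 * a 0]mulrA aiK mulr1.
by rewrite -[a 0 * _ * _]mulrA -sgmM mulV [sgm 1]map_mx1 mulr1 aK.
Qed.

Lemma cg_thg u : cg (thg u) = thg (cg u).
Proof.
apply: val_inj; rewrite val_cg !val_thg sg_thm sgmK val_cgV !sgmM sgmK sga sgai.
by rewrite !thmM thm_a thm_ai oppr0 mulrA.
Qed.

Lemma thg_xg t : thg (xg t) = xg (- t).
Proof.
apply: val_inj; rewrite val_thg (@valV_eq _ (xm (- t))) ?val_xg ?xmN //.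
by rewrite sg_xm thm_xm.
Qed.

Local Notation T := (SL K m).

Lemma ua_SL i : ua i \in T. Proof. by apply/SLP; rewrite val_ua det_a. Qed.
Lemma xg_SL t : xg t \in T. Proof. by apply/SLP; rewrite val_xg det_xm. Qed.

Lemma cg_SL u : u \in T -> cg u \in T.
Proof.
move=> /SLP du; apply/SLP; rewrite val_cg -[_ * ai 0]/(_ *m _) -[a 0 * _]/(_ *m _).
by rewrite !det_mulmx det_map_mx du det_a det_ai rmorph1 !mulr1.
Qed.

Lemma thg_SL u : u \in T -> thg u \in T.
Proof.
by rewrite -groupV => /SLP du; apply/SLP; rewrite val_thg det_thm det_map_mx du rmorph1.
Qed.

Lemma xgD s t : xg (s + t) = (xg s * xg t)%g.
Proof. by apply: val_inj; rewrite valM !val_xg xmD. Qed.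

Lemma b_inj : injective b.
Proof.
move=> i j /(congr1 (fun X => co X i i)); rewrite /b !coZ !coE !eqxx.
by move/(mulfI (io_neq0 io2)); case: eqP => // _ /eqP; rewrite oner_eq0.
Qed.

Lemma cg_xg t : val (cg (xg t)) = a 0 * ai t * xm t.
Proof. by rewrite val_cg val_xg sg_xm -!mulrA xm_ai add0r. Qed.

(** Equality would make a_0 a_s^-1 a shift, fixed by [sg]; but [sg] sends it to a_0^-1 a_s, and
    comparison gives 2 b_0 = 2 b_s. *)
Lemma xg_TI s t : cg (xg s) = xg t -> s = 0.
Proof.
move/(congr1 val); rewrite cg_xg val_xg => E1.
have E2 : a 0 * ai s = xm (t - s).
  by rewrite xmD -E1 -!mulrA xmN mulr1.
have E3 := congr1 sgm E2; rewrite sgmM sga sgai sg_xm in E3.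
move: E3; rewrite -E2 /a /ai => E3.
apply: b_inj; apply: oppr_inj; rewrite -!(double_neg K3).
move: E3; rewrite mulrBr mulrDr !mulr1 mulrBl mulrDl !mul1r.
move: (b 0 * b s) => x E3; apply/eqP; rewrite -subr_eq0.
move/eqP: E3; rewrite -subr_eq0; congr (_ == 0).
by apply/matrixP=> c d; rewrite !mxE; ring.
Qed.

Lemma SL_simpleT : simple T.
Proof.
by apply: SL_simple K_root; rewrite m_r -addnn; apply: leq_trans r_gt1 _; rewrite leq_addr.
Qed.

Lemma SL_nonabelian : ~~ abelian T.
Proof.
apply/negP=> /centsP/(_ _ (xg_SL 1) _ (ua_SL 0)) /(congr1 val).
rewrite !valM val_xg val_ua xm_a add0r => /(mulIr (xm_unit 1))/addrI/b_inj/eqP.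
by rewrite oner_eq0.
Qed.

Lemma val_dstep b i : val (dstep xg cg b i) = if b then a i * ai 0 else a 0 * ai i.
Proof.
case: b; rewrite dstepE valM -[zh xg cg true _]/(cg (xg _)) -[zh xg cg false _]/(xg _).
  by rewrite cg_xg val_xg !mulrA xm_a add0r -(mulrA (a i)) xm_ai addNr -!mulrA xmN mulr1.
by rewrite cg_xg val_xg -!mulrA xmN mulr1.
Qed.

Lemma prod3_swap (x y : GL) : (x * (y * (x * (y * (x * y)))) = 1 -> y * (x * (y * (x * (y * x)))) = 1)%g.
Proof.
move=> E1; apply: (mulgI x); rewrite mulg1 -[RHS]mul1g -E1.
by rewrite !mulgA.
Qed.

Lemma T_hexagon (e : bool) i j : (dstep xg cg (~~ e) j * (dstep xg cg e i * (dstep xg cg (~~ e) j *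
   (dstep xg cg e i * (dstep xg cg (~~ e) j * dstep xg cg e i)))) = 1)%g.
Proof.
wlog -> : e i j / e = false => [IH|].
  by case: e; [apply: prod3_swap; apply: (IH false) | apply: IH].
apply: val_inj; have := hexagonE i j; rewrite !exprS expr0 mulr1.
rewrite !valM !val_dstep => H.
have aa : a j * ai i = (a j * ai 0) * (a 0 * ai i) by rewrite mulrA -(mulrA _ (ai 0)) aiK mulr1.
by rewrite aa -!mulrA in H; rewrite /= -!mulrA.
Qed.

Lemma T_hexagon_uniq i1 i2 i3 i4 i5 i6 t : i1 != i2 -> i2 != i3 -> i3 != i4 ->
  (dstep xg cg true i6 * (dstep xg cg false i5 * (dstep xg cg true i4 * (dstep xg cg false i3 *
     (dstep xg cg true i2 * dstep xg cg false i1)))) = xg t)%g -> i1 = i3.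
Proof.
move=> n12 n23 n34 /(congr1 val); rewrite !valM !val_dstep val_xg => H.
apply: (hexagon_uniqE n12 n23 n34 (i5 := i5) (i6 := i6) (t := t)); rewrite -H.
have aa (X : Mx) : ai 0 * (a 0 * X) = X by rewrite mulrA aiK mul1r.
have aa' j (X : Mx) : ai j * (a j * X) = X by rewrite mulrA aiK mul1r.
have ab j (X : Mx) : a j * (ai j * X) = X by rewrite mulrA aK mul1r.
by rewrite -!mulrA !aa aa' ab aiK mulr1.
Qed.

Lemma a_sq i : a i * a i = ai i.
Proof. by rewrite -[LHS]mulr1 -(aK i) mulrA a_cube mul1r. Qed.

Lemma m_odd : odd m.+1.
Proof. by rewrite m_r /= odd_double. Qed.

(** For s = a_0^-1 t the condition reads sg(s) s = 1. A solution of sg(k) s = k yields the witness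
    a_0^-1 k, because a_0^2 = a_0^-1. *)
Lemma T_coboundary t : t \in T -> (cg t * t = 1)%g -> exists2 k, k \in T & (cg k * t = k)%g.
Proof.
move=> /SLP dt /(congr1 val); rewrite valM val_cg => H.
have [||k dk Ek] := @hilbert90_SL K sg io K3 sgK io2 sg_io sg_fix m (ai 0 * val t) m_odd.
- by rewrite -[_ * _]/(_ *m _) det_mulmx det_ai dt mulr1.
- by rewrite -[_ *m _]/(_ * _) sgmM sgai !mulrA.
have uk : ai 0 * k \is a GRing.unit.
  rewrite -[_ \is a _]/(_ \in unitmx) unitmxE -[_ * k]/(_ *m _) det_mulmx det_ai dk mulr1.
  exact: unitr1.
exists (mkU (ai 0 * k)).
  by apply/SLP; rewrite val_mkU // -[_ * k]/(_ *m _) det_mulmx det_ai dk mulr1.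
apply: val_inj; rewrite valM val_cg val_mkU // sgmM sgai -!mulrA.
by rewrite -[sgm k * _]/(sgm k *m _) Ek mulrA a_sq.
Qed.

(** S = N a_0^-1 is symmetric, as the adjoint fixes a_0^-1, and the condition makes A = S t
    symmetric too. A congruence P S P^T = A of determinant 1 gives the witness P^T. *)
Lemma T_coboundary_th t : t \in T -> (cg (thg t) * t = 1)%g ->
  exists2 k, k \in T & (cg (thg k) * t = k)%g.
Proof.
move=> /SLP dt /(congr1 val); rewrite valM val_cg val_thg sg_thm sgmK => H.
pose S1 : Mx := Nm *m ai 0; pose A : Mx := S1 *m val t.
have S1E : S1 = (ai 0)^T *m Nm.
  have := thm_ai 0; rewrite oppr0 /S1 => {1}<-.
  by rewrite /thm !mulmxA mulmxV ?Nm_unit // mul1mx.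
have S1_sym : S1^T = S1 by rewrite {1}S1E trmx_mul trmxK Nm_sym.
have H' : S1 *m (a 0 * thm (val t^-1%g) * ai 0 * val t) = S1 by rewrite H mulmx1.
have S1V : S1 *m (a 0 * thm (val t^-1%g) * ai 0 * val t) = (val t^-1%g)^T *m A.
  rewrite -[a 0 * _ * _ * _]/(a 0 *m thm _ *m ai 0 *m val t) /S1 /A /S1 /thm !mulmxA.
  rewrite -(mulmxA Nm (ai 0)) -[ai 0 *m a 0]/(ai 0 * a 0) aiK mulmx1.
  by rewrite mulmxV ?Nm_unit // mul1mx.
have A_sym : A^T = A.
  have : (val t)^T *m ((val t^-1%g)^T *m A) = A.
    rewrite mulmxA -trmx_mul -[_ *m val t]/(_ * val t) -valM mulVg.
    by rewrite trmx1 mul1mx.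
  by rewrite -S1V H' => {2}<-; rewrite /A trmx_mul S1_sym.
have uS1 : S1 \in unitmx.
  by rewrite /S1 unitmx_mul Nm_unit unitmxE det_ai unitr1.
have dA : \det S1 = \det A by rewrite [RHS]det_mulmx dt mulr1.
have [P dP PE] := @congr_mx_SL K io K3 io2 K8 m S1 A m_odd S1_sym A_sym uS1 dA.
have uP : P^T \is a GRing.unit.
  by rewrite -[_ \is a _]/(_ \in unitmx) unitmxE det_tr dP unitr1.
exists (mkU P^T); first by apply/SLP; rewrite val_mkU // det_tr.
apply: val_inj; rewrite valM val_cg val_thg sg_thm sgmK.
have VE : P^T * val (mkU P^T)^-1%g = 1 by rewrite -{1}(val_mkU uP) mulV.
rewrite val_mkU //; move: (val (mkU P^T)^-1%g) VE => V VE.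
apply: (can_inj (mulKmx uS1)).
have -> : S1 *m (a 0 * thm V * ai 0 * val t) = V^T *m A.
  rewrite -[a 0 * _ * _ * _]/(a 0 *m thm _ *m ai 0 *m val t) /S1 /A /S1 /thm !mulmxA.
  rewrite -(mulmxA Nm (ai 0)) -[ai 0 *m a 0]/(ai 0 * a 0) aiK mulmx1.
  by rewrite mulmxV ?Nm_unit // mul1mx.
rewrite -PE !mulmxA -[P in V^T *m P]trmxK -trmx_mul -[P^T *m V]/(P^T * V) VE trmx1 mul1mx.
by [].
Qed.

(** If theta were conjugation by k, then k b_(-i) = b_i k, so b_0 b_1 k = k b_0 b_(-1). The right
    side is 0 since g(-1) = 0, while b_0 b_1 is not. *)
Lemma thg_outer k : k \in T -> ~ (forall u, u \in T -> thg u = (u ^ k)%g).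
Proof.
move=> _ Hk; have kb i : val k * b (- i) = b i * val k.
  have := congr1 val (Hk _ (ua_SL i)).
  have -> : val (thg (ua i)) = a (- i).
    by rewrite val_thg (@valV_eq _ (ai i)) ?val_ua ?aK // sgai thm_a.
  move=> E1; have {E1} : val k * a (- i) = a i * val k.
    by rewrite E1 -val_ua -!valM conjgE mulKVg.
  by rewrite /a mulrDr mulrDl mulr1 mul1r => /addrI.
have : b 0 * b 1 * val k = 0.
  rewrite -mulrA -kb mulrA -kb oppr0 -mulrA b2 subr0 g_rev ?scale0r ?oppr0 ?mulr0 //.
  exact: pos_one.
move=> H0; have : b 0 * b 1 * val k * val k^-1%g = 0 by rewrite H0 mul0r.
rewrite -(mulrA _ (val k)) mulV mulr1 b2.
move/(congr1 (fun X => co X 0 1)); rewrite coN coZ coE !eqxx mulr1 subr0.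
have -> : co 0 0 1 = 0 by rewrite /co mul0mx mxE.
by move/eqP; rewrite oppr_eq0; apply/negP; rewrite g_pos pos_one.
Qed.

Lemma natF_eq n k : (n < r.*2.+1)%N -> (k < r.*2.+1)%N -> (n%:R == k%:R :> F) = (n == k).
Proof.
wlog nk : n k / (n <= k)%N => [IH|] np kp.
  by have [/IH->//|/ltnW/IH] := leqP n k; rewrite eq_sym [n == k]eq_sym => ->.
apply/idP/eqP => [|->]; last by rewrite eqxx.
rewrite eq_sym -subr_eq0 -natrB // => nk0; apply/eqP; apply: contraTT nk0 => nk0.
by apply: natF; lia.
Qed.

Lemma T_gen : T \subset <<[set xg i | i : F] :|: [set cg (xg i) | i : F]>>%g.
Proof.
pose H := <<[set xg i | i : F] :|: [set cg (xg i) | i : F]>>%G.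
have zH e t : zh xg cg e t \in H.
  by apply: mem_gen; rewrite inE; case: e; rewrite imset_f ?orbT.
have dH e i : dstep xg cg e i \in H by rewrite dstepE groupM ?zH.
have aH i j : mxin H (a i * ai j).
  have -> : a i * ai j = val (dstep xg cg true i * dstep xg cg false j)%g.
    by rewrite valM !val_dstep mulrA -(mulrA _ (ai 0)) aiK mulr1.
  by rewrite mxin_val groupM ?dH.
have nE k : exists2 n, (n < r.*2.+1)%N & k = n%:R := F_nat k.
apply: (@SL_sub_gen H aH r%:R).
- exact: pos_one.
- by rewrite posE; lia.
- by apply: natF; lia.
- by apply: natF; lia.
- by apply: natF; lia.
- move=> s; have [n np ->] := nE s; rewrite posE // => /andP[n0 nr] n1.
  have n1' : n != 1%N by rewrite -(natF_eq np) //; lia.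
  by rewrite -[1]/(1%:R) -natrB // posE; lia.
- move=> d; have [n np ->] := nE d => n0 n1.
  have n0' : n != 0%N by rewrite -(natF_eq np).
  have n1' : n != 1%N by rewrite -(natF_eq np) //; lia.
  have [nr|rn] := leqP n r.+1.
    exists 1, (n - 1)%:R; rewrite pos_one posE; last by lia.
    by split=> //; [lia | rewrite natrB ?lt0n // addrC subrK].
  exists r%:R, (n - r)%:R; rewrite !posE; try lia.
  split; [lia | lia | rewrite -natrD; congr _%:R; lia].
- move=> d; have [n np ->] := nE d => n0 n1 n2.
  have n0' : n != 0%N by rewrite -(natF_eq np).
  have n1' : n != 1%N by rewrite -(natF_eq np) //; lia.
  have n2' : n != 2%N by rewrite -(natF_eq np) //; lia.
  have [nr|rn] := leqP n r.+2.
    exists 2%:R, (n - 2)%:R; rewrite !posE; try lia.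
    split; [lia | lia | | rewrite -natrD; congr _%:R; lia].
    by rewrite -[1]/(1%:R) natF_eq; lia.
  exists r%:R, (n - r)%:R; rewrite !posE; try lia.
  split; [lia | lia | | rewrite -natrD; congr _%:R; lia].
  by rewrite -[1]/(1%:R) natF_eq; lia.
- by rewrite posE; lia.
- by rewrite -[1]/(1%:R) natF_eq; lia.
- by rewrite -natrD natr1 addnn F_p.
move=> t; have [n np ->] := nE t; rewrite posE // => /andP[n0 nr].
rewrite -natrD natr1; have [->|nr'] := eqVneq n r; first by rewrite addnn F_p.
by rewrite posE; lia.
Qed.

(** Spells [uw i j k] in X and Y: the first two letters give a_i a_0^-1, the next two a_0 a_j^-1,
    and so on. *)
Definition uword (i j k : F) : seq (bool * F) :=
  [:: (false, i); (true, - i); (true, j); (false, - j); (false, i); (true, - i); (true, k); (false, - k)].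

Lemma uwordE i j k s : val (\prod_(q <- uword i j k) zh xg cg q.1 (s * q.2)%R)%g
  = uw (s * i) (s * j) (s * k).
Proof.
rewrite !big_cons big_nil mulg1; cbn [fst snd]; rewrite !mulrN.
have dT l : (zh xg cg false l * zh xg cg true (- l))%g = dstep xg cg true l by rewrite dstepE.
have dF l : (zh xg cg true l * zh xg cg false (- l))%g = dstep xg cg false l by rewrite dstepE.
have -> (x1 x2 x3 x4 x5 x6 x7 x8 : GL) : (x1 * (x2 * (x3 * (x4 * (x5 * (x6 * (x7 * x8)))))) =
  ((x1 * x2) * (x3 * x4)) * ((x5 * x6) * (x7 * x8)))%g by rewrite !mulgA.
rewrite !dT !dF !valM !val_dstep /uw.
have aa l n : a l * ai 0 * (a 0 * ai n) = a l * ai n by rewrite mulrA -(mulrA _ (ai 0)) aiK mulr1.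
by rewrite !aa !mulrA.
Qed.

Lemma prod_flatten_nseq (w : seq (bool * F)) n (f : bool * F -> GL) :
  (\prod_(q <- flatten (nseq n w)) f q = (\prod_(q <- w) f q) ^+ n)%g.
Proof. by elim: n => [|n IHn]; rewrite /= ?big_nil // big_cat /= IHn expgS. Qed.

Lemma val_expg (u : GL) n : val (u ^+ n)%g = val u ^+ n.
Proof. by elim: n => [|n IHn]; rewrite ?expg0 // expgS valM IHn exprS. Qed.

Lemma pos_neg x : x != 0 -> ~~ pos x -> g (- x) != 0.
Proof. by move=> x0 px; rewrite g_pos posN. Qed.

Lemma g_npos x : ~~ pos x -> g x = 0.
Proof. by rewrite -g_pos negbK => /eqP. Qed.

Lemma uw_cyclic x y z : x != 0 -> y != 0 -> z != 0 -> pos x = pos y -> pos y = pos z ->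
  g x * g y * g z + g (- x) * g (- z) * g (- y) != 0.
Proof.
move=> x0 y0 z0 xy yz; case px : (pos x).
  have py : pos y by rewrite -xy. have pz : pos z by rewrite -yz.
  by rewrite (g_rev px) !mul0r addr0 !mulf_neq0 ?g_pos.
have py : ~~ pos y by rewrite -xy px. have pz : ~~ pos z by rewrite -yz.
by rewrite (g_npos (negbT px)) !mul0r add0r !mulf_neq0 // pos_neg // px.
Qed.

(** Up to sign s is some i with 1 <= i <= r. If i > 1 and q is the quotient of r by i, then q + 1 <=
    r although i (q + 1) lies between r + 1 and 2r, outside [pos]. *)
Lemma pos_mult s : s != 0 -> (forall n, (0 < n <= r)%N -> pos (s * n%:R) = pos s) ->
  s = 1 \/ s = -1.
Proof.
move=> s0 Hs; wlog ps : s s0 Hs / pos s => [IH|].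
  have [/(IH s s0 Hs) //|ns] := boolP (pos s).
  suff [E1|E1] : - s = 1 \/ - s = -1.
  - by right; rewrite -[s]opprK E1.
  - by left; rewrite -[s]opprK E1 opprK.
  apply: IH; first by rewrite oppr_eq0.
    by move=> n Hn; rewrite mulNr !posN ?Hs // mulf_neq0 //; apply: natF; lia.
  by rewrite posN.
have [i ip Ei] := F_nat s; have := ps; rewrite {1}Ei posE // => /andP[i0 ir].
have [i1|i1] := eqVneq i 1%N; first by left; rewrite Ei i1.
have dr := divn_eq r i; have mr : (r %% i < i)%N by rewrite ltn_mod.
have qr : (r %/ i < r)%N by apply: ltn_Pdiv; lia.
have q_lt : (i * (r %/ i).+1 < r.*2.+1)%N by rewrite mulnS mulnC; lia.
have := Hs (r %/ i).+1; rewrite ps Ei -natrM posE // => /(_ qr)/andP[_].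
by rewrite mulnS mulnC; lia.
Qed.

(* The triples (0, 1, n+1) with 0 < n < r are transitive; if no multiple by s were
   cyclic, then [pos] would be constant on s, 2s, ..., rs. *)
Lemma T_sep s : s != 0 -> s != 1 -> s != -1 -> exists2 w : seq (bool * F),
  (\prod_(q <- w) zh xg cg q.1 q.2 = 1)%g & (\prod_(q <- w) zh xg cg q.1 (s * q.2)%R != 1)%g.
Proof.
move=> s0 s1 sN1.
have [/existsP[n /and4P[n0 nr pn pn1]]|/existsPn H] := boolP [exists n : 'I_r,
   [&& (0 < n)%N, (n < r)%N, pos (s * n%:R) == pos s & pos (s * n.+1%:R) != pos s]].
  have tr : uw 0 1 n.+1%:R ^+ 9 = 1.
    apply: uw_transitive; rewrite ?sub0r ?g_rev ?pos_one ?posE //; try lia.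
    by rewrite -opprB -{2}[1]/(1%:R) -natrB // subn1 g_rev // posE; lia.
  exists (flatten (nseq 9 (uword 0 1 n.+1%:R))).
    rewrite prod_flatten_nseq; apply: val_inj; rewrite val_expg.
    have E9 := uwordE 0 1 n.+1%:R 1; rewrite !mul1r in E9; rewrite -[RHS]tr -E9; congr (val _ ^+ 9).
    by apply: eq_bigr => q _; rewrite mul1r.
  rewrite prod_flatten_nseq; apply/eqP=> /(congr1 val); rewrite val_expg uwordE.
  move/uw_trace/eqP; apply/negP; rewrite mulr0 mulr1 subr0.
  have nz k : (0 < k < r.*2.+1)%N -> s * k%:R != 0 by move=> kp; rewrite mulf_neq0 // natF.
  have -> : s * n.+1%:R - s = s * n%:R by rewrite -natr1 mulrDr mulr1 addrK.
  have -> : s - s * n.+1%:R = - (s * n%:R) by rewrite -natr1 mulrDr mulr1 opprD addrCA subrr addr0.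
  rewrite !sub0r subr0; have := @uw_cyclic s (s * n%:R) (- (s * n.+1%:R)).
  rewrite opprK; apply=> //; rewrite ?oppr_eq0 ?nz //; try lia.
  by rewrite posN ?nz //; [move: pn pn1; do 3!case: (pos _) | lia].
have [] : s = 1 \/ s = -1; last 2 first.
- by move/eqP; rewrite (negPf s1).
- by move/eqP; rewrite (negPf sN1).
apply: pos_mult => //; elim=> [|n IHn] // nr.
have [->|n0] := eqVneq n 0%N; first by rewrite mulr1.
have nr' : (n < r)%N by lia.
have := H (Ordinal nr'); rewrite /= lt0n n0 nr' IHn ?eqxx /= ?negbK; last by lia.
by move/eqP.
Qed.

Theorem matrix_graph_theorem : exists (V : finType) (adj : rel V) (G : {group {perm V}}),
    [/\ simple_graph adj, connected_graph adj, bipartite_graph adj,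
        regular_of_valency adj #|F| & group_of_automorphisms adj G] /\
    [/\ two_arc_transitive adj G, diagonal_PA_type adj G &
        ~ is_standard_double_cover adj].
Proof.
have Fn (k : F) : exists n, k = n%:R by have [n _ ->] := F_nat k; exists n.
have pos_gt1 : (1 < #|pos|)%N.
  apply/card_gt1P; exists 1, 2%:R; split; first exact: pos_one.
    by rewrite unfold_in posE; lia.
  by rewrite -[1]/(1%:R) natF_eq; lia.
exact: (@twisted_graph_theorem F _ T xg cg thg pos Fn pos0 posN pos_gt1 SL_simpleT SL_nonabelian
  xg_SL xgD cgM cgK cg_SL thgM thgK thg_SL cg_thg thg_xg xg_TI T_gen T_hexagon T_hexagon_uniq
  T_sep thg_outer T_coboundary T_coboundary_th).
Qed.

End GroupLevel.

End Matrices.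

(** * The circulant matrix Phi and the construction of the graph *)

Section Fields.

Local Open Scope ring_scope.

(** X^5 - X has at most 5 roots, so some nonzero x has x^4 <> 1. As x^8 = 1, this forces x^4 = -1,
    and x^2 serves as io. *)
Lemma field9 : exists (K : finFieldType) (sg : {rmorphism K -> K}) (io : K),
  [/\ 3 \in [pchar K], involutive sg, io * io = -1 & sg io = - io] /\
  [/\ forall x : K, x != 0 -> x ^+ 8 = 1 &
      forall x : K, sg x = x -> [|| x == 0, x == 1 | x == -1]].
Proof.
have [K ch3 cardK] := PrimePowerField (isT : prime 3) (isT : (0 < 2)%N).
have K9 (x : K) : x ^+ 9 = x by rewrite -[in RHS](expf_card x) cardK.
have K8 (x : K) : x != 0 -> x ^+ 8 = 1.
  by move=> x0; apply: (mulfI x0); rewrite -exprS K9 mulr1.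
have [x x0 x4] : exists2 x : K, x != 0 & x ^+ 4 != 1.
  suff /existsP[x /andP[x0 x4]] : [exists x : K, (x != 0) && (x ^+ 4 != 1)] by exists x.
  apply: contraT; rewrite negb_exists => /forallP H.
  pose q : {poly K} := 'X^5 - 'X.
  have : (size (enum K) < size q)%N.
    apply: max_poly_roots.
    - rewrite -size_poly_gt0 size_polyDl size_polyXn //.
      by rewrite size_polyN size_polyX.
    - apply/allP=> x _; rewrite rootE !hornerE; have := H x.
      rewrite negb_and !negbK => /orP[/eqP->|/eqP x4]; first by rewrite expr0n subrr.
      by rewrite exprS x4 mulr1 subrr.
    exact: enum_uniq.
  by rewrite -cardE cardK size_polyDl size_polyXn // size_polyN size_polyX.
have io2 : x ^+ 2 * x ^+ 2 = -1.
  rewrite -exprD; have : (x ^+ 4) ^+ 2 == 1 ^+ 2 by rewrite -exprM K8 // expr1n.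
  by rewrite eqf_sqr (negPf x4) => /eqP.
exists K, (pFrobenius_aut ch3), (x ^+ 2); split; split=> //.
- by move=> y; rewrite /= !pFrobenius_autE -exprM K9.
- rewrite /= pFrobenius_autE; move: (x ^+ 2) io2 => io io2.
  by rewrite !exprS expr0 mulr1 io2 mulrN1.
move=> y; rewrite /= pFrobenius_autE => y3.
have : y * ((y - 1) * (y + 1)) == 0.
  have -> : y * ((y - 1) * (y + 1)) = y ^+ 3 - y by ring.
  by rewrite y3 subrr.
by rewrite !mulf_eq0 subr_eq0 addr_eq0.
Qed.

Lemma prime_index_field p : prime p -> exists (F : finFieldType) (v : F -> nat),
  [/\ #|F| = p, forall k, (v k < p)%N, forall k, k = (v k)%:R & forall n, v n%:R = (n %% p)%N].
Proof.
move=> pr; exists 'F_p, (fun k => nat_of_ord k); split.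
- exact: card_Fp.
- by move=> k; have := ltn_ord k; rewrite [X in (_ < X)%N]Fp_cast.
- by move=> k; rewrite natr_Zp.
by move=> n; rewrite val_Fp_nat.
Qed.

End Fields.

Section Circulant.

Local Open Scope ring_scope.

Variables (K : finFieldType) (F : finFieldType) (r : nat) (v : F -> nat).
Hypothesis K3 : 3%:R = 0 :> K.
Hypothesis ch3 : 3 \in [pchar K].
Hypothesis r_gt1 : (1 < r)%N.
Hypothesis vK : forall k : F, k = (v k)%:R.
Hypothesis F_p : r.*2.+1%:R = 0 :> F.
Variable g : nat -> K.
(** A coefficient sum 0 in K would put the constant vectors in the kernel. All ones sum to r, so
    when 3 divides r the last one becomes -1 and the sum r - 2. *)
Hypothesis gE : forall k, (0 < k <= r)%N -> g k = if (3 %| r)%N && (k == r) then -1 else 1.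

Lemma twice_r : r%:R + r%:R = -1 :> F.
Proof. by apply/eqP; rewrite -addr_eq0 -natrD addnn natr1 F_p. Qed.

(* If 3 does not divide r, subtracting consecutive equations gives w(i) = w(i-r),
   and 2r = -1. Otherwise, with t = r+1, they give w(i) + w(i+t) + w(i+3t) = 0,
   a recurrence of period 8 over F_3, and 8t = 4. *)
Lemma circulant_inj (w : F -> K) :
  (forall i, \sum_(1 <= k < r.+1) g k * w (i - k%:R) = 0) -> forall i, w i = 0.
Proof.
move=> w0.
have iterw (t : F) : (forall i, w (i + t) = w i) -> forall n i, w (i + t * n%:R) = w i.
  move=> wt; elim=> [|n IHn] i; first by rewrite mulr0 addr0.
  by rewrite -natr1 mulrDr mulr1 addrA wt IHn.
have const c : (forall i, w i = c) -> (r%:R - (3 %| r)%:R * 2%:R) * c = 0.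
  move=> wc; rewrite -[RHS](w0 0) big_nat_recr ?(ltnW r_gt1) //= wc.
  rewrite big_nat_cond (eq_bigr (fun=> c)) => [|k /andP[/andP[k1 kr] _]]; last first.
    by rewrite gE ?wc; [rewrite (ltn_eqF kr) andbF mul1r | rewrite k1 ltnW].
  rewrite -big_nat_cond sumr_const_nat gE ?leqnn ?(ltnW r_gt1) // eqxx andbT.
  have -> : r%:R = (r - 1)%:R + 1 :> K by rewrite natr1 subn1 prednK // ltnW.
  rewrite -[c *+ _]mulr_natr; case: (3 %| r)%N => /=; ring.
have split_w i : \sum_(1 <= k < r) w (i - k%:R) = - (g r * w (i - r%:R)).
  apply/eqP; rewrite -addr_eq0 -[X in _ == X](w0 i) big_nat_recr ?(ltnW r_gt1) //=.
  apply/eqP; congr (_ + _); rewrite big_nat_cond [RHS]big_nat_cond.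
  apply: eq_bigr => k /andP[/andP[k1 kr] _].
  by rewrite gE ?k1 ?(ltnW kr) // (ltn_eqF kr) andbF mul1r.
have shift n i : \sum_(1 <= k < n.+1) w (i + 1 - k%:R) + w (i - n%:R)
    = w i + \sum_(1 <= k < n.+1) w (i - k%:R).
  have <- : \sum_(0 <= k < n.+1) w (i - k%:R) = w i + \sum_(1 <= k < n.+1) w (i - k%:R).
    by rewrite big_ltn // subr0.
  rewrite [RHS]big_nat_recr //=; congr (_ + _); rewrite big_add1 /=.
  by apply: eq_bigr => k _; rewrite -natr1 opprD addrACA subrr addr0.
have conclude : (forall i, w (i + 1) = w i) -> forall i, w i = 0.
  move=> w1 i; have wc j : w j = w i.
    by have := iterw 1 w1 (v (j - i)) i; rewrite mul1r -vK addrC subrK.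
  have /eqP := const (w i) wc; rewrite mulf_eq0 => /orP[|/eqP //].
  have := dvdn_pcharf ch3 r; case: (3 %| r)%N => [/esym/eqP->|/esym E0].
    rewrite mul1r sub0r -[2%:R]/(1 + 1) (@double_neg _ K3 K^o) opprK => /eqP E1.
    by have := oner_neq0 K; rewrite E1 eqxx.
  by rewrite mul0r subr0 E0.
have [r3|r3] := boolP (3 %| r)%N; last first.
  have wr i : w (i - r%:R) = w i.
    have A j : \sum_(1 <= k < r.+1) w (j - k%:R) = 0.
      rewrite -[RHS](w0 j) big_nat_cond [RHS]big_nat_cond; apply: eq_bigr => k /andP[/andP[k1 kr] _].
      by rewrite gE ?k1 // (negPf r3) mul1r.
    by have := shift r i; rewrite !A add0r addr0.
  apply: conclude => i; rewrite -[RHS]wr -[RHS]wr; congr w.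
  by rewrite -addrA -opprD twice_r opprK.
have A i : \sum_(1 <= k < r) w (i - k%:R) = w (i - r%:R).
  by rewrite split_w gE ?leqnn ?(ltnW r_gt1) // r3 eqxx mulN1r opprK.
have rel i : w i + w (i - r%:R) + w (i + 1 - r%:R) = 0.
  have := shift r.-1 i; rewrite prednK ?(ltnW r_gt1) // !A => E1.
  rewrite -E1; have -> : i - r.-1%:R = i + 1 - r%:R.
    by rewrite -[r in RHS](prednK (ltnW r_gt1)) -natr1 opprD addrA addrAC addrK.
  by rewrite (@double_neg _ K3 K^o) addNr.
pose t : F := r%:R + 1.
have tt : t + t = 1.
  by rewrite /t addrACA twice_r addrA addNr add0r.
have Nr : - r%:R = t.
  by rewrite -[RHS](addrK t) tt /t opprD addrCA subrr addr0.
have rel' i : w i + w (i + t) + w (i + t + t + t) = 0.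
  rewrite -[RHS](rel i) Nr; congr (_ + w _).
  by rewrite -[i + t + t]addrA tt.
apply: conclude => i.
have w8 j : w (j + t + t + t + t + t + t + t + t) = w j.
  have E3 l : w (l + t + t + t) = - w l - w (l + t).
    by apply/eqP; rewrite -opprD -addr_eq0 addrC rel'.
  rewrite E3 !E3.
  move: (w j) (w (j + t)) (w (j + t + t)) => x y z.
  by transitivity (x + 3%:R * (- x - y)); [ring | rewrite K3 mul0r addr0].
have w4 j : w (j + 4%:R) = w j.
  rewrite -[RHS]w8; congr w.
  have -> : j + t + t + t + t + t + t + t + t = j + 4%:R * (t + t) by ring.
  by rewrite tt mulr1.
(* The shift by 4 taken r^2 times is the shift by (2r)^2 = 1. *)
have := iterw _ w4 (r * r)%N i; congr (w _ = _); congr (_ + _).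
have -> : 4%:R * (r * r)%:R = (r%:R + r%:R) * (r%:R + r%:R) :> F by rewrite natrM; ring.
by rewrite twice_r mulN1r opprK.
Qed.

End Circulant.

Section Existence.

Local Open Scope ring_scope.

Lemma matrix_graph_exists (F : finFieldType) (v : F -> nat) (r : nat) :
  prime r.*2.+1 -> (1 < r)%N -> #|F| = r.*2.+1 -> (forall k, v k < r.*2.+1)%N ->
  (forall k, k = (v k)%:R) -> (forall n, v n%:R = n %% r.*2.+1)%N ->
  exists (V : finType) (adj : rel V) (G : {group {perm V}}),
    [/\ simple_graph adj, connected_graph adj, bipartite_graph adj,
        regular_of_valency adj #|F| & group_of_automorphisms adj G] /\
    [/\ two_arc_transitive adj G, diagonal_PA_type adj G &
        ~ is_standard_double_cover adj].
Proof.
move=> pr r1 cardF v_lt vK v_nat.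
have [K [sg [io [[ch3 sgK io2 sg_io] [K8 sg_fix]]]]] := field9.
have K3 : 3%:R = 0 :> K by apply/eqP; rewrite -(dvdn_pcharf ch3).
have v_id n : (n < r.*2.+1)%N -> v n%:R = n by move=> np; rewrite v_nat modn_small.
have v_inj : injective v by move=> k l E; rewrite (vK k) E -vK.
have v0 : v 0 = 0%N by rewrite -[0]/(0%:R) v_nat mod0n.
have F_p : r.*2.+1%:R = 0 :> F by apply: v_inj; rewrite v_nat modnn v0.
pose idx (k : F) : 'I_r.*2.+1 := cast_ord cardF (enum_rank k).
pose lb (c : 'I_r.*2.+1) : F := enum_val (cast_ord (esym cardF) c).
have idxK : cancel idx lb by move=> k; rewrite /lb /idx cast_ordK enum_rankK.
have lbK : cancel lb idx by move=> c; rewrite /lb /idx enum_valK cast_ordKV.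
pose pos (k : F) := (0 < v k <= r)%N.
pose g (k : F) : K := if pos k then (if (3 %| r)%N && (v k == r) then -1 else 1) else 0.
have N1 : -1 != 0 :> K by rewrite oppr_eq0 oner_eq0.
have g_pos k : (g k != 0) = pos k.
  by rewrite /g; case: (pos k); rewrite ?eqxx //; case: ifP; rewrite ?N1 ?oner_neq0.
have sg_g k : sg (g k) = g k.
  by rewrite /g; case: (pos k); rewrite ?rmorph0 //; case: ifP; rewrite ?rmorphN ?rmorph1.
have pos0 : ~~ pos 0 by rewrite /pos v0.
have posN k : k != 0 -> pos (- k) = ~~ pos k.
  move=> k0; have vk0 : (0 < v k)%N.
    by rewrite lt0n; apply: contraNneq k0 => k0; rewrite (vK k) k0.
  have vk := v_lt k; have -> : - k = (r.*2.+1 - v k)%:R.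
    by rewrite natrB ?(ltnW vk) // F_p sub0r -vK.
  by rewrite /pos v_id; lia.
have posE n : (n < r.*2.+1)%N -> pos n%:R = (0 < n <= r)%N by move=> np; rewrite /pos v_id.
have natF n : (0 < n < r.*2.+1)%N -> n%:R != 0 :> F.
  by move=> /andP[n0 np]; apply: contraTneq n0 => /(congr1 v); rewrite v_id // v0 => ->.
have K_root (l : K) : l ^+ r.*2.+1 = 1 -> l = 1.
  move=> lp; have l0 : l != 0.
    by apply/eqP=> l0; move/eqP: lp; rewrite l0 exprS mul0r eq_sym oner_eq0.
  have := congr1 (fun x => x ^+ r.*2.+1) lp; rewrite /= -exprM expr1n.
  (* An odd square is 1 modulo 8, so raising to the power p twice is the identity on nonzero
     elements of K. *)
  have [q ->] : exists q, (r.*2.+1 * r.*2.+1 = 8 * q + 1)%N.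
    by exists 'C(r.+1, 2); rewrite bin2 /=; have := odd_double_half (r.+1 * r); rewrite oddM /= andNb; lia.
  by rewrite exprD exprM K8 // expr1n mul1r.
have Phi_unit : Phi lb g \in unitmx.
  rewrite -row_free_unit -kermx_eq0; apply/rowV0P=> u /sub_kermxP uP.
  apply/rowP=> c; rewrite mxE -[c]lbK.
  apply: (@circulant_inj K F r v K3 ch3 r1 vK F_p (fun n => g n%:R) _ (fun k => u 0 (idx k))).
    by move=> k /[dup] kr /andP[k0 kr']; rewrite /g posE ?kr ?v_id //; lia.
  move=> i; have := congr1 (fun X : 'rV_ _ => X 0 (idx i)) uP; rewrite [RHS]mxE mxE => S0.
  rewrite -[RHS]S0 {S0}.
  (* Summing over the difference n turns the entry of [Phi] into g(n); the terms with n = 0 or n > r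
     then vanish. *)
  pose h (n : 'I_r.*2.+1) := idx (i - n%:R).
  have h_bij : bijective h.
    exists (fun c => Ordinal (v_lt (i - lb c))) => [n|d].
      by apply: val_inj; rewrite /= idxK subKr v_id.
    by rewrite /h /= -vK subKr lbK.
  have -> : \sum_c u 0 c * Phi lb g c (idx i) = \sum_(n < r.*2.+1) g n%:R * u 0 (idx (i - n%:R)).
    rewrite (reindex h) /=; last exact: onW_bij.
    by apply: eq_bigr => n _; rewrite mxE /h !idxK subKr mulrC.
  rewrite -(big_mkord xpredT (fun n => g n%:R * u 0 (idx (i - n%:R)))).
  rewrite [RHS]big_ltn // [g 0]/g (negPf pos0) mul0r add0r.
  rewrite [RHS](@big_cat_nat _ _ _ r.+1) //=; last by lia.
  rewrite [X in _ = _ + X]big1_seq ?addr0 // => n; rewrite mem_index_iota => /andP[_ /andP[rn np]].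
  by rewrite /g posE // (_ : (0 < n <= r)%N = false) ?mul0r //; lia.
apply: (@matrix_graph_theorem K sg io K3 sgK io2 sg_io K8 sg_fix F r.*2 idx lb idxK lbK pos g
  pos0 posN g_pos sg_g Phi_unit r r1 erefl _ F_p natF posE K_root).
by move=> k; exists (v k).
Qed.

End Existence.

Theorem theorem1p3 (p : nat) : prime p -> 5 <= p ->
  exists (V : finType) (adj : rel V) (G : {group {perm V}}),
    [/\ simple_graph adj, connected_graph adj, bipartite_graph adj,
        regular_of_valency adj p & group_of_automorphisms adj G] /\
    [/\ two_arc_transitive adj G, diagonal_PA_type adj G &
        ~ is_standard_double_cover adj].
Proof.
move=> pr p5; have [F [v [cardF v_lt vK v_nat]]] := prime_index_field pr.
have pE : p = p./2.*2.+1.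
  by case: (even_prime pr) p5 => [->//|po] _; rewrite -{1}(odd_double_half p) po.
(* Here p >= 5 enters: r = 1 would leave a single simple factor. *)
have r1 : (1 < p./2)%N by lia.
rewrite -cardF; apply: (@matrix_graph_exists F v p./2); rewrite -?pE //.
Qed.
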